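(* Let $(V,X,(S_i)_{i=1,\dots,N})$ be a conformal iterated function system. Let $f:\Sigma^{\mathbb N}\to\mathbb R$ be a Lipschitz function. For $C\subseteq\mathbb R$ and a continuous function $\varphi:\Sigma^{\mathbb N}\to\mathbb R$ define the dynamical ergodic multifractal zeta-function by $$\zeta^{\mathrm{dyn\text{-}erg}}_{C,f}(\varphi;z)=\sum_n\frac{z^n}{n}\left(\sum_{|\mathbf i|=n,\ \frac1n\sum_{k=0}^{n-1}f(S^k\overline{\mathbf i})\in C}\ \sup_{\mathbf u\in[\mathbf i]}\exp\sum_{k=0}^{n-1}\varphi(S^k\mathbf u)\right),$$ where $\overline{\mathbf i}=\mathbf i\mathbf i\mathbf i\dots$ for a finite string $\mathbf i$. Let $\Lambda:\Sigma^{\mathbb N}\to\mathbb R$ be the scaling map (see context). Assume that $C\subseteq\mathbb R$ is closed. (1) There is a unique real number $\mathfrak f(C)$ such that $$\lim_{r\searrow0}\sigma_{\mathrm{rad}}\big(\zeta^{\mathrm{dyn\text{-}erg}}_{B(C,r),f}(\mathfrak f(C)\Lambda;\cdot)\big)=1.$$ If $\alpha\in\mathbb R$ and $C=\{\alpha\}$, write $\mathfrak f(\alpha)=\mathfrak f(C)$. (2) We have $$\mathfrak f(C)=\sup_{\alpha\in C}\ \sup_{\mu\in\mathcal P_S(\Sigma^{\mathbb N}),\ \int f\,d\mu=\alpha}\ -\frac{h(\mu)}{\int\Lambda\,d\mu}.$$ (3) If the Open Set Condition is satisfied, then $$\mathfrak f(C)=\dim_{\mathrm H}\pi\Big\{\mathbf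 i\in\Sigma^{\mathbb N}:\ \operatorname*{acc}_n\frac1n\sum_{k=0}^{n-1}f(S^k\mathbf i)\subseteq C\Big\}.$$ In particular, if the Open Set Condition is satisfied and $\alpha\in\mathbb R$, then $$\mathfrak f(\alpha)=\dim_{\mathrm H}\pi\Big\{\mathbf i\in\Sigma^{\mathbb N}:\ \lim_n\frac1n\sum_{k=0}^{n-1}f(S^k\mathbf i)=\alpha\Big\}.$$
   Context: Symbolic notation: $\Sigma^{\mathbb N}=\{1,\dots,N\}^{\mathbb N}$; finite strings $\mathbf i=i_1\dots i_n$ have length $|\mathbf i|=n$; $[\mathbf i]\subseteq\Sigma^{\mathbb N}$ is the cylinder of infinite strings beginning with $\mathbf i$; $\mathbf i|n=i_1\dots i_n$ for $\mathbf i\in\Sigma^{\mathbb N}$; $S$ (without index) is the shift $S(i_1i_2\dots)=i_2i_3\dots$. Fix $\gamma\in(0,1)$ and equip $\Sigma^{\mathbb N}$ with the metric $d_\gamma(\mathbf i,\mathbf j)=0$ if $\mathbf i=\mathbf j$ and $d_\gamma(\mathbf i,\mathbf j)=\gamma^{|\mathbf i\wedge\mathbf j|}$ otherwise, where $\mathbf i\wedge\mathbf j$ is the longest common prefix; continuity and Lipschitz properties refer to $d_\gamma$. $\mathcal P_S(\Sigma^{\mathbb N})$ is the set of shift-invariant Borel probability measures on $\Sigma^{\mathbb N}$ and $h(\mu)$ is the measure-theoretic entropy of $\mu$ with respect to $S$. A conformal iterated function system $(V,X,(S_i)_{i=1,\dots,N})$ consists of: an open connected $V\subseteq\mathbb R^d$;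 a compact $X\subseteq V$ equal to the closure of its interior; contractive $C^{1+\eta}$ diffeomorphisms $S_i:V\to V$ (with $0<\eta<1$) with $S_iX\subseteq X$, such that for every $x\in V$ and every $i$ the derivative $(DS_i)(x)$ is a contractive similarity, i.e. there is $r_i(x)\in(0,1)$ with $|(DS_i)(x)u-(DS_i)(x)v|=r_i(x)|u-v|$ for all $u,v\in\mathbb R^d$. The self-conformal set $K$ is the unique non-empty compact $K\subseteq X$ with $K=\bigcup_iS_iK$; $S_{\mathbf i}=S_{i_1}\circ\cdots\circ S_{i_n}$ and $K_{\mathbf i}=S_{\mathbf i}K$ for $\mathbf i=i_1\dots i_n$. The projection $\pi:\Sigma^{\mathbb N}\to K$ is defined by $\{\pi(\mathbf i)\}=\bigcap_nK_{\mathbf i|n}$. The scaling map is $\Lambda(\mathbf i)=\log|DS_{i_1}(\pi S\mathbf i)|$ for $\mathbf i=i_1i_2\dots\in\Sigma^{\mathbb N}$. The Open Set Condition: there is an open, non-empty, bounded $O\subseteq X$ with $S_iO\subseteq O$ for all $i$ and $S_iO\cap S_jO=\varnothing$ for $i\ne j$. $\sigma_{\mathrm{rad}}$ denotes the radius of convergence of a power series; $\dim_{\mathrm H}$ is Hausdorff dimension with $\dim_{\mathrm H}\varnothing=-\infty$; $\sup\varnothing=-\infty$; $B(C,r)=\{x\in\mathbb R:\operatorname{dist}(x,C)<r\}$; $\operatorname{acc}_na_n$ is the set of accumulation points of the sequence $(a_n)_n$ as $n\to\infty$.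
   Formalization: Part (1) is stated only when some shift-invariant μ has ∫f dμ ∈ C; otherwise (e.g. C empty) the coefficients vanish for small r, the radius is +∞ and no real root exists, so f(C) is set to −∞, with which (2) and (3) hold for all closed C. *)

(* Defs.v *)
From HB Require Import structures.
From mathcomp Require Import all_boot all_order all_algebra.
From mathcomp Require Import all_classical all_reals all_analysis.

Set Implicit Arguments.
Unset Strict Implicit.
Unset Printing Implicit Defensive.

Import Order.TTheory GRing.Theory Num.Theory.
Import numFieldNormedType.Exports.

Local Open Scope classical_set_scope.
Local Open Scope ring_scope.

(* The alphabet {1, ..., N} is encoded as 'I_N.+1, so that it is never empty
   (an iterated function system with a non-empty attractor has at least one
   map). The string i_1 i_2 ... is the function k |-> i_(k+1). *)
Notation code_space N := (nat -> 'I_N.+1).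
HB.instance Definition _ (n : nat) := isPointed.Build 'I_n.+1 ord0.

Section Code.
Variables (R : realType) (N : nat).
Implicit Types (u v : code_space N) (w : seq 'I_N.+1) (g : code_space N -> R).

Definition shift u : code_space N := fun k => u k.+1.

Definition cylinder w : set (code_space N) :=
  [set u | forall k, (k < size w)%N -> u k = nth ord0 w k].

Definition periodic w : code_space N := fun k => nth ord0 w (k %% size w).

Definition birkhoff_sum g n u : R := \sum_(0 <= k < n) g (iter k shift u).

Definition birkhoff_avg g n u : R := n%:R^-1 * birkhoff_sum g n u.

(* If u and v differ somewhere, the length of their longest common prefix is
   the least index at which they differ. *)
Definition code_dist (gamma : R) u v : R :=
  if pselect (exists k, u k != v k) is left h then gamma ^+ ex_minn h else 0.

Definition code_lipschitz (gamma : R) g : Prop :=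
  exists c : R, forall u v, `|g u - g v| <= c * code_dist gamma u v.

Definition code_open (gamma : R) : set (set (code_space N)) :=
  [set A | forall u, A u ->
     exists2 e, 0 < e & forall v, code_dist gamma u v < e -> A v].

End Code.

Notation borel_code N gamma := (g_sigma_algebraType (@code_open _ N gamma)).

Section InvariantMeasures.
Variables (R : realType) (N : nat) (gamma : R).
Local Notation T := (borel_code N gamma).
Implicit Type mu : probability T R.

Definition shift_invariant mu : Prop :=
  forall A : set T, measurable A -> mu (@shift N @^-1` A) = mu A.

(* A finite measurable partition is given by its labelling map xi. *)
Definition finite_partition m (xi : T -> 'I_m) : Prop :=
  forall a, measurable (xi @^-1` [set a] : set T).

(* Shannon entropy of the join of xi, S^-1 xi, ..., S^-(n-1) xi, with
   0 ln 0 = 0 because ln 0 = 0 in the library. *)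
Definition join_entropy mu m (xi : T -> 'I_m) n : R :=
  \sum_(w : n.-tuple 'I_m)
    let p := fine (mu [set u : T | forall k : 'I_n,
                         xi (iter k (@shift N) u) = tnth w k]) in
    - (p * ln p).

Definition partition_entropy mu m (xi : T -> 'I_m) : R :=
  lim ((n%:R^-1 * join_entropy mu xi n) @[n --> \oo]).

Definition entropy mu : \bar R :=
  ereal_sup [set e | exists m (xi : T -> 'I_m),
    finite_partition xi /\ e = (partition_entropy mu xi)%:E].

End InvariantMeasures.

(* The norm of the library on row vectors is the maximum norm: it yields the
   usual topology, but similarities, diameters and operator norms have to
   refer to the Euclidean norm. *)
Definition enorm (R : realType) (d : nat) (x : 'rV[R]_d) : R :=
  Num.sqrt (\sum_i x ord0 i ^+ 2).

Definition opnorm (R : realType) (d : nat) (L : 'rV[R]_d -> 'rV[R]_d) : R :=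
  sup [set enorm (L u) | u in [set u | enorm u <= 1]].

Section HausdorffDimension.
Variables (R : realType) (d : nat).
Implicit Types A U : set 'rV[R]_d.

Local Open Scope ereal_scope.

Definition diam U : \bar R :=
  ereal_sup [set (enorm (xy.1 - xy.2)%R)%:E | xy in U `*` U].

(* The empty set weighs 0 also for s = 0, while points weigh 0 ^ 0 = 1. *)
Definition diam_pow (s : R) U : \bar R :=
  if U == set0 then 0 else diam U `^ s.

Definition hausdorff_premeasure (s delta : R) A : \bar R :=
  ereal_inf [set \sum_(0 <= k <oo) diam_pow s (U k) |
    U in [set U : nat -> set 'rV[R]_d |
            A `<=` \bigcup_k U k /\ forall k, diam (U k) <= delta%:E]].

Definition hausdorff_measure (s : R) A : \bar R :=
  ereal_sup [set hausdorff_premeasure s delta A |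
    delta in [set delta : R | (0 < delta)%R]].

Definition hausdorff_dim A : \bar R :=
  if A == set0 then -oo
  else ereal_inf [set s%:E |
         s in [set s : R | (0 <= s)%R /\ hausdorff_measure s A = 0]].

End HausdorffDimension.

Section ConformalIFS.
Variables (R : realType) (d N : nat).
Local Notation E := 'rV[R]_d.
Implicit Types (U V X K : set E) (g : E -> E) (S : 'I_N.+1 -> E -> E).

Definition C1plus (eta : R) U g : Prop :=
  (forall x, U x -> differentiable g x) /\
  (forall Q : set E, compact Q -> Q `<=` U ->
     exists c : R, forall x y, Q x -> Q y ->
       opnorm (fun u => 'd g x u - 'd g y u) <= c * enorm (x - y) `^ eta).

(* A C^(1+eta) diffeomorphism of U onto its (open) image. *)
Definition C1plus_diffeo (eta : R) U g : Prop :=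
  [/\ C1plus eta U g, open (g @` U) &
      exists2 h, C1plus eta (g @` U) h & forall x, U x -> h (g x) = x].

Definition contractive U g : Prop :=
  exists2 c : R, 0 <= c < 1 &
    forall x y, U x -> U y -> enorm (g x - g y) <= c * enorm (x - y).

Definition contractive_similarity (L : E -> E) : Prop :=
  exists2 r : R, 0 < r < 1 &
    forall u v, enorm (L u - L v) = r * enorm (u - v).

(* The maps S i are total functions of which only the restrictions to V are
   relevant. *)
Definition conformal_ifs V X S : Prop :=
  [/\ open V /\ connected V,
      [/\ compact X, X `<=` V & X = closure (interior X)],
      forall i, S i @` V `<=` V /\ S i @` X `<=` X,
      exists2 eta : R, 0 < eta < 1 &
        forall i, C1plus_diffeo eta V (S i) /\ contractive V (S i) &
      forall i x, V x -> contractive_similarity ('d (S i) x)].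

Definition self_conformal_set X S K : Prop :=
  [/\ K !=set0, compact K, K `<=` X & K = \bigcup_i (S i @` K)].

Definition word_map S (w : seq 'I_N.+1) : E -> E :=
  foldr (fun a g => S a \o g) id w.

(* pi(i) is the element of the singleton given by the intersection of the
   K_(i|n). *)
Definition coding_map S K (u : code_space N) : E :=
  xget 0 (\bigcap_n (word_map S (mkseq u n) @` K)).

Definition scaling_map S K (u : code_space N) : R :=
  ln (opnorm ('d (S (u 0%N)) (coding_map S K (shift u)))).

Definition open_set_condition X S : Prop :=
  exists O : set E,
    [/\ open O, O !=set0 /\ bounded_set O, O `<=` X,
        forall i, S i @` O `<=` O &
        forall i j, i != j -> (S i @` O) `&` (S j @` O) = set0].

End ConformalIFS.

Section Zeta.
Variables (R : realType) (N : nat).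

(* Since only the moduli |z| matter, real z suffice for the radius of
   convergence. *)
Definition sigma_rad (a : nat -> R) : \bar R :=
  ereal_sup [set `|z|%:E | z in
    [set z : R | cvgn (series (fun n => a n * z ^+ n))]].

(* B(C, r), with dist(x, set0) = +oo. *)
Definition set_nbhd (C : set R) (r : R) : set R :=
  [set x | (ereal_inf [set `|x - c|%:E | c in C] < r%:E)%E].

(* The coefficient of z^n in the zeta-function; it is 0 for n = 0 because
   0^-1 = 0. *)
Definition zeta_dyn_erg (C : set R) (f phi : code_space N -> R) (n : nat) : R :=
  n%:R^-1 *
  \sum_(w : n.-tuple 'I_N.+1 | `[< C (birkhoff_avg f n (periodic w)) >])
     sup [set expR (birkhoff_sum phi n u) | u in cylinder w].

(* t solves lim_(r -> 0+) sigma_rad (zeta_(B(C, r), f) (t Lambda; .)) = 1. *)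
Definition zeta_root (C : set R) (f Lambda : code_space N -> R) (t : R) : Prop :=
  sigma_rad (zeta_dyn_erg (set_nbhd C r) f (fun u => t * Lambda u))
    @[r --> 0^'+] --> 1%E.

(* The number f(C). If C contains no integral of f against an invariant
   measure (for instance if C is empty), then the coefficients of the zeta-
   functions vanish for small r and there is no real root; f(C) is then -oo,
   in accordance with sup set0 = -oo and dim_H set0 = -oo. *)
Definition frakf (C : set R) (f Lambda : code_space N -> R) : \bar R :=
  xget -oo%E [set t%:E | t in zeta_root C f Lambda].

End Zeta.

(* Main.v *)
(* The idea: let Z_n(C, t) be the sum of exp(t S_n Lambda) over the n-periodic
   points whose averages of f lie in C. The radius of convergence of the
   zeta-function reads off the exponential growth rate of Z_n. Equidistributing
   the periodic orbits with weights exp(t S_n Lambda) and passing to a limit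
   (Misiurewicz) turns growth at rate e for all C_r = B(C, r) into an invariant
   measure mu with int f dmu in C and h(mu) + t int Lambda dmu >= e; conversely
   such a measure carries exp(n (h(mu) - o(1))) words that are typical for f and
   Lambda. Hence the root t is characterised by sup (h(mu) + t int Lambda dmu) = 0,
   which is (1) and (2).

   For (3), bounded distortion gives diam K_i <= c exp(S_n Lambda). If s exceeds
   the root, then Z_n(B(C, r), s) decays exponentially for some r, and the
   cylinders of the words counted by Z_n cover the set with vanishing s-sum. For
   the lower bound independent blocks of typical words of an optimal mu carry a
   probability nu with nu[i] <= c exp(s S_n Lambda) for every s below the root;
   under the Open Set Condition a set of diameter rho meets boundedly many
   incomparable cylinders of size about rho, so that the mass distribution
   principle applies. *)
Require Import Defs.
From HB Require Import structures.
From mathcomp Require Import all_boot all_order all_algebra.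
From mathcomp Require Import all_classical all_reals all_analysis.
From mathcomp Require Import ring lra zify.

Set Implicit Arguments.
Unset Strict Implicit.
Unset Printing Implicit Defensive.

Import Order.TTheory GRing.Theory Num.Theory.
Import numFieldNormedType.Exports.

Local Open Scope classical_set_scope.
Local Open Scope ring_scope.
Local Notation shift := Defs.shift.
Local Notation periodic := Defs.periodic.

(** * The code space *)

Section CodeSpace.
Variables (R : realType) (N : nat).
Implicit Types (u v : code_space N) (w : seq 'I_N.+1) (g : code_space N -> R).

(** [mu] is never assumed ergodic, so typical words cannot come from the Shannon-McMillan-Breiman
    theorem. They are cut from the product measure whose one-block law is the [n]-marginal of [mu]:
    that marginal has entropy at least [n * h], and a block boundary costs at most a constant [D],
    hence [D / n] per letter. [C] is closed but not convex, whereas averaging orbits is a convex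
    operation. Before Misiurewicz' argument the words are therefore restricted to one short bin of
    averages of [f], at subexponential cost. Closedness of [C] then makes the limit measure
    admissible, so that a measure realising the root exists and strict inequalities for single
    measures become uniform decay. Uniqueness of the root rests on [Lambda <= - l0 < 0], which makes
    [h + t * \int Lambda] strictly decreasing in [t] for every measure. If no invariant measure
    integrates [f] into [C], then [frakf], the supremum and the dimension are all -oo, a case
    treated separately throughout. The geometry enters the second half only through
    [conformal_coding]. *)

Definition agree n u v : Prop := forall k, (k < n)%N -> u k = v k.

(* Exponentially small variation, for some rate [rho]: unlike [code_lipschitz]
   this does not refer to [gamma], and it also holds for the scaling map. *)
Definition holder_code g : Prop :=
  exists2 c : R, 0 <= c & exists2 rho : R, 0 < rho < 1 &
    forall n u v, agree n u v -> `|g u - g v| <= c * rho ^+ n.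

(** The sample point of a cylinder: [nth] pads [w] with the default letter. *)
Definition ext w : code_space N := nth ord0 w.

Lemma iter_shiftE k u j : iter k (@shift N) u j = u (k + j)%N.
Proof. by elim: k j => [|k IH] j //; rewrite iterS /shift IH addSnnS. Qed.

Lemma agreeS m n u v : (m <= n)%N -> agree n u v -> agree m u v.
Proof. by move=> mn H k km; apply: H; exact: leq_trans km mn. Qed.

Lemma agree_sym n u v : agree n u v -> agree n v u.
Proof. by move=> H k kn; rewrite H. Qed.

Lemma agree_trans n u v u' : agree n u v -> agree n v u' -> agree n u u'.
Proof. by move=> H H' k kn; rewrite H// H'. Qed.

Lemma agree_shift n k u v : agree (k + n) u v ->
  agree n (iter k (@shift N) u) (iter k (@shift N) v).
Proof. by move=> H j jn; rewrite !iter_shiftE H// ltn_add2l. Qed.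

Lemma cylinder_mkseq v n u : cylinder (mkseq v n) u <-> agree n u v.
Proof.
rewrite /cylinder /= size_mkseq; split => H k kn.
  by rewrite H// nth_mkseq.
by rewrite nth_mkseq// H.
Qed.

Lemma cylinderP w u : cylinder w u <-> mkseq u (size w) = w.
Proof.
split => [H|<-].
  apply: (@eq_from_nth _ ord0); rewrite size_mkseq// => i iw.
  by rewrite nth_mkseq// H.
exact/cylinder_mkseq.
Qed.

Lemma cylinder_ext w : cylinder w (ext w).
Proof. by []. Qed.

Lemma cylinder_periodic w : cylinder w (periodic w).
Proof. by move=> k kw; rewrite /periodic modn_small. Qed.

Lemma cylinder_agree w u v : cylinder w u -> cylinder w v -> agree (size w) u v.
Proof. by move=> Hu Hv k kw; rewrite Hu// Hv. Qed.

Lemma agree_cylinder w u v : agree (size w) u v -> cylinder w v -> cylinder w u.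
Proof. by move=> H Hv k kw; rewrite H// Hv. Qed.

Lemma agree_ext_mkseq u n : agree n (ext (mkseq u n)) u.
Proof. by move=> k kn; rewrite /ext nth_mkseq. Qed.

Lemma cylinder_rcons w a u :
  cylinder (rcons w a) u <-> cylinder w u /\ u (size w) = a.
Proof.
split=> [H|[H1 H2] k].
  split=> [k kw|].
    by rewrite H ?size_rcons 1?ltnW// nth_rcons kw.
  by rewrite H ?size_rcons// nth_rcons ltnn eqxx.
rewrite size_rcons ltnS leq_eqVlt => /predU1P[->|kw].
  by rewrite nth_rcons ltnn eqxx.
by rewrite H1// nth_rcons kw.
Qed.

Lemma birkhoffD n m g u : birkhoff_sum g (n + m) u =
  birkhoff_sum g n u + birkhoff_sum g m (iter n (@shift N) u).
Proof.
rewrite /birkhoff_sum (big_cat_nat (n:=n)) ?leq_addr//=; congr (_ + _).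
rewrite -{1}[n]add0n big_addn addKn.
by apply: eq_bigr => i _; rewrite iterD.
Qed.

Lemma birkhoffSl n g u :
  birkhoff_sum g n.+1 u = g u + birkhoff_sum g n (shift u).
Proof. by rewrite -add1n birkhoffD /= {1}/birkhoff_sum big_nat1. Qed.

Lemma birkhoffSr n g u : birkhoff_sum g n.+1 u =
  birkhoff_sum g n u + g (iter n (@shift N) u).
Proof. by rewrite /birkhoff_sum big_nat_recr. Qed.

Lemma birkhoff0 g u : birkhoff_sum g 0 u = 0.
Proof. by rewrite /birkhoff_sum big_nil. Qed.

Lemma birkhoffZ (t : R) g n u :
  birkhoff_sum (fun u => t * g u) n u = t * birkhoff_sum g n u.
Proof. by rewrite /birkhoff_sum mulr_sumr. Qed.

Lemma holder_bounded g : holder_code g ->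
  exists2 M : R, 0 < M & forall u, `|g u| <= M.
Proof.
move=> [c c0 [rho rho01 H]].
exists (`|g (fun=> ord0)| + c + 1); first by rewrite ltr_wpDl// addr_ge0.
move=> u.
have := H 0%N u (fun=> ord0) (fun k k0 => ltac:(by [])).
rewrite expr0 mulr1 => h.
rewrite -[X in `|X|](subrK (g (fun=> ord0))) (le_trans (ler_normD _ _))//; lra.
Qed.

Lemma birkhoff_bound g (M : R) n u : (forall u, `|g u| <= M) ->
  `|birkhoff_sum g n u| <= M * n%:R.
Proof.
move=> H; rewrite /birkhoff_sum (le_trans (ler_norm_sum _ _ _))//.
rewrite (le_trans (ler_sum _ (fun i _ => H _)))//.
by rewrite big_const_nat subn0 iter_addr_0 mulr_natr.
Qed.

(** The [k]-th shifts still share [n - k] letters, so the differences are dominated by a geometric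
    series. That [D] is independent of [n] is what all later estimates rest on. *)
Lemma holder_distortion g : holder_code g ->
  exists2 D : R, 0 < D & forall n u v, agree n u v ->
    `|birkhoff_sum g n u - birkhoff_sum g n v| <= D.
Proof.
move=> [c c0 [rho /andP[rho0 rho1] H]].
have r1 : 0 < 1 - rho by rewrite subr_gt0.
exists (c / (1 - rho) + 1); first by rewrite ltr_wpDl// divr_ge0// ltW.
move=> n u v uv.
suff: `|birkhoff_sum g n u - birkhoff_sum g n v| <=
    c * (1 - rho ^+ n.+1) / (1 - rho).
  move=> /le_trans; apply.
  rewrite (@le_trans _ _ (c / (1 - rho)))// ?lerDl// ler_wpM2r ?invr_ge0 ?(ltW r1)//.
  by rewrite ler_piMr// gerBl exprn_ge0// ltW.
elim: n u v uv => [|n IH] u v uv.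
  by rewrite !birkhoff0 subrr normr0 expr1 mulfK ?gt_eqF.
rewrite !birkhoffSl opprD addrACA (le_trans (ler_normD _ _))//.
have -> : c * (1 - rho ^+ n.+2) / (1 - rho) =
    c * rho ^+ n.+1 + c * (1 - rho ^+ n.+1) / (1 - rho).
  by rewrite [rho ^+ n.+2]exprS; field; rewrite gt_eqF.
apply: lerD; first exact: H.
by apply: IH; apply: (agree_shift (k:=1)).
Qed.

Lemma lipschitz_holder (gamma : R) g : 0 < gamma < 1 ->
  code_lipschitz gamma g -> holder_code g.
Proof.
move=> /andP[g0 g1] [c H]; exists `|c|; first by [].
exists gamma; first by rewrite g0.
move=> n u v uv; rewrite (le_trans (H _ _))// (le_trans (ler_norm _))// normrM.
rewrite ler_wpM2l// /code_dist.
case: pselect => [h|_]; last by rewrite normr0 exprn_ge0// ltW.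
case: ex_minnP => m um _.
rewrite ger0_norm ?exprn_ge0 ?(ltW g0)//.
rewrite ler_iXn2l// leqNgt; apply/negP => mn.
by move: um; rewrite uv// eqxx.
Qed.

(** The strict inequality puts the first difference at an index greater than [n], whence the gain of
    one letter. *)
Lemma code_dist_lt (gamma : R) n u v : 0 < gamma < 1 ->
  code_dist gamma u v < gamma ^+ n -> agree n.+1 u v.
Proof.
move=> /andP[g0 g1]; rewrite /code_dist; case: pselect => [h|h _ k kn].
  case: ex_minnP => m um mmin; rewrite ltr_iXn2l// => nm k kn.
  apply/eqP/negPn/negP => /mmin mk.
  by move: (leq_trans kn nm); rewrite ltnNge mk.
by apply/eqP/negPn/negP => ?; apply: h; exists k.
Qed.

Lemma agree_code_dist (gamma : R) n u v : 0 < gamma < 1 ->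
  agree n u v -> code_dist gamma u v <= gamma ^+ n.
Proof.
move=> /andP[g0 g1] uv; rewrite /code_dist; case: pselect => [h|h]; last first.
  by rewrite exprn_ge0// ltW.
case: ex_minnP => m um mmin; rewrite ler_iXn2l// leqNgt; apply/negP => mn.
by move: um; rewrite uv// eqxx.
Qed.

End CodeSpace.

(** * Entropy of finite distributions *)

Section FiniteEntropy.
Variable R : realType.
Implicit Types A B I : finType.

Definition ent A (p : A -> R) : R := \sum_a - (p a * ln (p a)).

Definition distr A (p : A -> R) : Prop :=
  (forall a, 0 <= p a) /\ \sum_a p a = 1.

Definition push A B (g : A -> B) (p : A -> R) (b : B) : R :=
  \sum_(a | g a == b) p a.

Lemma eq_ent A (p q : A -> R) : p =1 q -> ent p = ent q.
Proof. by move=> pq; apply: eq_bigr => a _; rewrite pq. Qed.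

Lemma sum_push A B (g : A -> B) (p : A -> R) (F : B -> R) :
  \sum_b push g p b * F b = \sum_a p a * F (g a).
Proof.
rewrite [RHS](partition_big g xpredT)//=; apply: eq_bigr => b _.
by rewrite /push mulr_suml; apply: eq_bigr => a /eqP ->.
Qed.

Lemma push_ge0 A B (g : A -> B) (p : A -> R) :
  (forall a, 0 <= p a) -> forall b, 0 <= push g p b.
Proof. by move=> p0 b; apply: sumr_ge0. Qed.

Lemma distr_push A B (g : A -> B) (p : A -> R) :
  distr p -> distr (push g p).
Proof.
move=> [p0 p1]; split; first exact: push_ge0.
have := sum_push g p (fun=> 1).
by under eq_bigr do rewrite mulr1; under [X in _ = X]eq_bigr do rewrite mulr1; rewrite p1.
Qed.

Lemma push_comp A B I (h : B -> I) (g : A -> B) (p : A -> R) :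
  push h (push g p) =1 push (h \o g) p.
Proof.
move=> i; rewrite /push (partition_big g (fun b => h b == i))//=.
apply: eq_bigr => b /eqP hb; apply: eq_bigl => a.
by case: eqVneq => [->|]; rewrite ?hb ?eqxx ?andbF.
Qed.

Lemma eq_push A B (g h : A -> B) (p : A -> R) : g =1 h -> push g p =1 push h p.
Proof. by move=> gh b; apply: eq_bigl => a; rewrite gh. Qed.

Lemma distr_le1 A (p : A -> R) : distr p -> forall a, p a <= 1.
Proof.
by move=> [p0 <-] a; rewrite (bigD1 a)//= lerDl; apply: sumr_ge0.
Qed.

Lemma le_push A B (g : A -> B) (p : A -> R) a :
  (forall a, 0 <= p a) -> p a <= push g p (g a).
Proof.
by move=> p0; rewrite /push (bigD1 a)//= lerDl; apply: sumr_ge0.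
Qed.

Lemma ln_le_subr1 (x : R) : 0 < x -> ln x <= x - 1.
Proof.
move=> x0; have -> : ln x = ln (1 + (x - 1)) by congr ln; lra.
by apply: le_ln1Dx; lra.
Qed.

(** Apply [ln x <= x - 1] to [q a / p a]. The entropy inequalities for pairs, for mixtures and for
    the cardinality are instances of this one. *)
Lemma gibbs_ineq A (p q : A -> R) : (forall a, 0 <= p a) ->
  (forall a, 0 <= q a) -> \sum_a q a <= \sum_a p a ->
  (forall a, q a = 0 -> p a = 0) ->
  ent p <= \sum_a - (p a * ln (q a)).
Proof.
move=> p0 q0 qp qp0; rewrite -subr_ge0 -sumrB.
rewrite (@le_trans _ _ (\sum_a (p a - q a)))//; first by rewrite sumrB subr_ge0.
apply: ler_sum => a _.
have [pa0|pa0] := eqVneq (p a) 0; first by rewrite pa0 !mul0r; have := q0 a; lra.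
have pa : 0 < p a by rewrite lt_neqAle eq_sym pa0 p0.
have qa : 0 < q a.
  by rewrite lt_neqAle eq_sym q0 andbT; apply: contraNneq pa0 => /qp0 ->.
have := ln_le_subr1 (divr_gt0 qa pa); rewrite ln_div ?posrE// => h.
have := ler_wpM2l (ltW pa) h.
rewrite mulrBr mulrBr mulr1 mulrCA divff// mulr1; lra.
Qed.

Lemma ent_push_le A B (g : A -> B) (p : A -> R) :
  (forall a, 0 <= p a) -> ent (push g p) <= ent p.
Proof.
move=> p0; rewrite /ent; under eq_bigr do rewrite -mulrN.
rewrite (sum_push g p (fun b => - ln (push g p b))).
apply: ler_sum => a _; rewrite mulrN lerN2.
have [->|pa0] := eqVneq (p a) 0; first by rewrite !mul0r.
have pa : 0 < p a by rewrite lt_neqAle eq_sym pa0 p0.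
rewrite ler_wpM2l// ler_ln ?posrE//; first exact: le_push.
exact: lt_le_trans pa (le_push _ _ _).
Qed.

(** Gibbs' inequality against the product of the two marginals. *)
Lemma ent_pair_le A B (p : A * B -> R) : distr p ->
  ent p <= ent (push fst p) + ent (push snd p).
Proof.
move=> dp; have [p0 p1] := dp.
have [q0 q1] := distr_push fst dp; have [r0 r1] := distr_push snd dp.
rewrite (le_trans (@gibbs_ineq _ _ (fun x => push fst p x.1 * push snd p x.2) p0 _ _ _))//.
- by move=> a; rewrite mulr_ge0.
- rewrite p1 -(pair_bigA _ (fun a b => push fst p a * push snd p b))/=.
  by under eq_bigr do rewrite -mulr_sumr r1 mulr1; rewrite q1.
- move=> a /eqP; rewrite mulf_eq0 => /orP[]/eqP e; apply/eqP;
    rewrite eq_le p0 andbT -e; exact: le_push.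
rewrite /ent; under [X in _ <= X + _]eq_bigr do rewrite -mulrN.
under [X in _ <= _ + X]eq_bigr do rewrite -mulrN.
rewrite (sum_push fst p (fun b => - ln (push fst p b))).
rewrite (sum_push snd p (fun b => - ln (push snd p b))) -big_split/=.
apply: ler_sum => a _; rewrite -mulrDr.
have [->|pa0] := eqVneq (p a) 0; first by rewrite !mul0r oppr0.
have pa : 0 < p a by rewrite lt_neqAle eq_sym pa0 p0.
rewrite lnM ?posrE ?(lt_le_trans pa) ?le_push//; lra.
Qed.

Lemma ent_le_card A (p : A -> R) : distr p -> ent p <= ln #|A|%:R.
Proof.
move=> [p0 p1].
have cA : (0 < #|A|)%N.
  rewrite lt0n; apply/negP => /eqP A0.
  move: p1; rewrite big1 => [/eqP|a _]; first by rewrite eq_sym oner_eq0.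
  by have := card0_eq A0 a; rewrite inE.
have cA0 : 0 < #|A|%:R :> R by rewrite ltr0n.
rewrite (le_trans (@gibbs_ineq _ _ (fun x => #|A|%:R^-1) p0 _ _ _))//.
- by rewrite p1 sumr_const -[_ *+ _]mulr_natr mulVf// gt_eqF.
- by move=> a /eqP; rewrite invr_eq0 gt_eqF.
by under eq_bigr do rewrite -mulrN; rewrite -mulr_suml p1 mul1r lnV ?posrE// opprK.
Qed.

Lemma ent_ge0 A (p : A -> R) : distr p -> 0 <= ent p.
Proof.
move=> dp; apply: sumr_ge0 => a _; rewrite -mulrN mulr_ge0 ?(proj1 dp)// oppr_ge0.
exact/ln_le0/distr_le1.
Qed.

(** Gibbs' inequality for every component [p i] against the mixture. *)
Lemma ent_concave I A (c : I -> R) (p : I -> A -> R) : distr c ->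
  (forall i, distr (p i)) ->
  \sum_i c i * ent (p i) <= ent (fun a => \sum_i c i * p i a).
Proof.
move=> [c0 c1] dp; set q := (X in _ <= ent X).
have q0 a : 0 <= q a by apply: sumr_ge0 => i _; rewrite mulr_ge0// (proj1 (dp i)).
have q1 : \sum_a q a = 1.
  rewrite exchange_big/=; under eq_bigr do rewrite -mulr_sumr (proj2 (dp _)) mulr1.
  exact: c1.
have -> : ent q = \sum_i c i * \sum_a - (p i a * ln (q a)).
  under [RHS]eq_bigr do rewrite mulr_sumr.
  rewrite exchange_big/=; apply: eq_bigr => a _.
  rewrite {1}/q mulr_suml -sumrN; apply: eq_bigr => i _.
  by rewrite mulrN mulrA.
apply: ler_sum => i _.
have [->|ci0] := eqVneq (c i) 0; first by rewrite !mul0r.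
rewrite ler_wpM2l// gibbs_ineq//; first exact: (proj1 (dp i)).
  by rewrite q1 (proj2 (dp i)).
move=> a /eqP; rewrite psumr_eq0 => [/allP/(_ i)|j _]; last first.
  by rewrite mulr_ge0// (proj1 (dp j)).
by rewrite mem_index_enum => /(_ isT)/=; rewrite mulf_eq0 (negbTE ci0) => /eqP.
Qed.

(** With [s] the square root of [x], the left side is [2 * s * (s * ln (1 / s))], and [ln y < y].
    The majorant is monotone and continuous at 0, which [- (x * ln x)] makes awkward to use
    directly. *)
Lemma eta_le_sqrt (x : R) : 0 <= x -> - (x * ln x) <= 2 * Num.sqrt x.
Proof.
rewrite le_eqVlt => /predU1P[<-|x0]; first by rewrite mul0r oppr0 sqrtr0 mulr0.
have s0 : 0 < Num.sqrt x by rewrite sqrtr_gt0.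
have -> : x * ln x = Num.sqrt x * Num.sqrt x * (ln (Num.sqrt x) *+ 2).
  by rewrite -lnXn// sqr_sqrtr ?ltW// -expr2 sqr_sqrtr ?ltW.
have := ln_sublinear (x := (Num.sqrt x)^-1); rewrite invr_gt0 => /(_ s0).
rewrite lnV ?posrE// => h.
have := ler_wpM2l (ltW s0) (ltW h); rewrite divff ?gt_eqF// => h2.
have := ler_wpM2l (ltW s0) h2; rewrite mulr2n; lra.
Qed.

Lemma eta_le_onem (x : R) : 0 <= x -> - (x * ln x) <= 1 - x.
Proof.
rewrite le_eqVlt => /predU1P[<-|x0]; first by rewrite mul0r; lra.
have := ln_le_subr1 (x := x^-1); rewrite invr_gt0 => /(_ x0).
rewrite lnV ?posrE// => h.
have := ler_wpM2l (ltW x0) h; rewrite mulrBr divff ?gt_eqF//; lra.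
Qed.

(** Every atom other than [None] has mass at most [e]; this plays the part of Fano's inequality. *)
Lemma ent_option_le A (p : option A -> R) (e : R) : distr p ->
  1 - e <= p None -> ent p <= e + #|{: option A}|%:R * (2 * Num.sqrt e).
Proof.
move=> dp pe; have [p0 p1] := dp; rewrite /ent (bigD1 None)//=; apply: lerD.
  by rewrite (le_trans (eta_le_onem _))//; lra.
apply: (@le_trans _ _ (\sum_(i : option A) 2 * Num.sqrt e)); last first.
  by rewrite sumr_const -[leLHS]mulr_natl.
rewrite [leRHS](bigD1 None)//=; rewrite ler_wpDl ?mulr_ge0 ?sqrtr_ge0//.
apply: ler_sum => a a0; rewrite (le_trans (eta_le_sqrt _))// ler_wpM2l//.
rewrite ler_wsqrtr//.
have := p1; rewrite (bigD1 None)//= (bigD1 a)//= => h.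
have h3 : 0 <= \sum_(i | (i != None) && (i != a)) p i by apply: sumr_ge0.
move: h h3 pe; set s := \sum_(_ | _) _; lra.
Qed.

(** At the limit 0 the logarithm is not continuous, and the square root bound squeezes instead. The
    filter is arbitrary because the limit is later taken along an ultrafilter. *)
Lemma cvg_eta (F : set_system nat) {FF : ProperFilter F} (x_ : nat -> R) (x : R) :
  (forall n, 0 <= x_ n <= 1) -> x_ @ F --> x ->
  - (x_ n * ln (x_ n)) @[n --> F] --> - (x * ln x).
Proof.
move=> x01 cx.
have x0 : 0 <= x.
  apply: (@closed_cvg _ _ F FF x_ [set y : R | 0 <= y]) cx; first exact: closed_ge.
  by apply: nearW => n; have /andP[] := x01 n.
move: x0; rewrite le_eqVlt => /predU1P[x0|x0].
  rewrite -x0 mul0r oppr0.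
  apply: (@squeeze_cvgr _ _ _ _ (fun=> 0) (fun n => 2 * Num.sqrt (x_ n))).
  - apply: nearW => n; have /andP[h0 h1] := x01 n.
    by rewrite eta_le_sqrt// andbT oppr_ge0 mulr_ge0_le0// ln_le0.
  - exact: cvg_cst.
  - rewrite -[X in _ --> X](mulr0 2); apply: cvgMr; rewrite -[X in _ --> X]sqrtr0 x0.
    exact: (cvg_comp _ _ cx (@sqrt_continuous R x)).
apply: cvgN; apply: cvgM => //.
exact: (cvg_comp _ _ cx (continuous_ln x0)).
Qed.

End FiniteEntropy.

(** * Labels and their laws *)

Section Laws.
Context (d : measure_display) (T : measurableType d) (R : realType).
Variable mu : probability T R.
Implicit Types A B : finType.

Definition label A (X : T -> A) : Prop := forall a, measurable (X @^-1` [set a]).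

Definition law A (X : T -> A) (a : A) : R := fine (mu (X @^-1` [set a])).

Lemma fine_probK (E : set T) : measurable E -> (fine (mu E))%:E = mu E.
Proof. by move=> mE; rewrite fineK// fin_num_measure. Qed.

Lemma label_preimage A (X : T -> A) (P : set A) : label X -> measurable (X @^-1` P).
Proof.
move=> lX; have -> : X @^-1` P = \bigcup_(a in P) X @^-1` [set a].
  by apply/seteqP; split => [u Pu|u [a Pa /= ->//]]; exists (X u).
by apply: fin_bigcup_measurable => // a _; exact: lX.
Qed.

Lemma label_comp A B (X : T -> A) (g : A -> B) : label X -> label (g \o X).
Proof. by move=> lX b; rewrite comp_preimage; exact: label_preimage. Qed.

Lemma sum_law A (X : T -> A) (P : pred A) : label X ->
  fine (mu (X @^-1` [set a | P a])) = \sum_(a | P a) law X a.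
Proof.
move=> lX; apply: EFin_inj; rewrite fine_probK; last exact: label_preimage.
rewrite -sumEFin.
have -> : X @^-1` [set a | P a] = \bigcup_(a in [set a | P a]) X @^-1` [set a].
  by apply/seteqP; split => [u Pu|u [a Pa /= ->//]]; exists (X u).
rewrite measure_fin_bigcup//.
  rewrite (fsbigE (seq.filter P (index_enum A))) ?filter_uniq ?index_enum_uniq//=.
  - rewrite big_filter_cond; apply: eq_big => [a|a _]; last by rewrite fine_probK.
    by case Pa : (P a) => //=; rewrite mem_set.
  - by move=> a /=; rewrite mem_filter => /andP[].
  - by move=> a /= Pa; rewrite mem_filter Pa mem_index_enum.
  exact: finite_finset.
by apply/trivIsetP => a b _ _ /eqP ab; apply/seteqP; split => // u [/= -> /ab].
Qed.

Lemma law_ge0 A (X : T -> A) a : 0 <= law X a.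
Proof. exact: fine_ge0. Qed.

Lemma distr_law A (X : T -> A) : label X -> distr (law X).
Proof.
move=> lX; split; first exact: law_ge0.
have := sum_law xpredT lX.
have -> : X @^-1` [set a | xpredT a] = setT by apply/seteqP.
by rewrite probability_setT /= => <-.
Qed.

Lemma law_comp A B (X : T -> A) (g : A -> B) : label X ->
  law (g \o X) =1 push g (law X).
Proof.
move=> lX b; rewrite /push -sum_law// /law; congr (fine (mu _)).
by apply/seteqP; split => u /= /eqP.
Qed.

Lemma eq_law A (X Y : T -> A) : X =1 Y -> law X =1 law Y.
Proof. by move=> /funext ->. Qed.

Lemma label_pair A B (X : T -> A) (Y : T -> B) : label X -> label Y ->
  label (fun u => (X u, Y u)).
Proof.
move=> lX lY [a b].
have -> : (fun u => (X u, Y u)) @^-1` [set (a, b)] = X @^-1` [set a] `&` Y @^-1` [set b].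
  by apply/seteqP; split => u /= [-> ->].
exact: measurableI.
Qed.

Lemma ent_law_comp A B (X : T -> A) (Y : T -> B) (g : A -> B) : label X ->
  (forall u, Y u = g (X u)) -> ent (law Y) <= ent (law X).
Proof.
move=> lX YX; rewrite (eq_ent (eq_law (YX : Y =1 g \o X))) (eq_ent (law_comp g lX)).
by apply: ent_push_le => a; exact: law_ge0.
Qed.

Lemma ent_law_pair A B (X : T -> A) (Y : T -> B) : label X -> label Y ->
  ent (law (fun u => (X u, Y u))) <= ent (law X) + ent (law Y).
Proof.
move=> lX lY; have lXY := label_pair lX lY.
rewrite (le_trans (ent_pair_le (distr_law lXY)))//.
by rewrite -(eq_ent (law_comp fst lXY)) -(eq_ent (law_comp snd lXY)).
Qed.

Lemma integrable_label A (X : T -> A) (F : A -> R) : label X ->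
  mu.-integrable setT (EFin \o (F \o X)).
Proof.
move=> lX; apply: measurable_bounded_integrable => //.
- exact: le_lt_trans (probability_le1 mu measurableT) (ltry _).
- by move=> _ E _; rewrite setTI comp_preimage; exact: label_preimage.
- exists (\sum_a `|F a|); split; first exact: num_real.
  move=> M h u _ /=; apply: le_trans (ltW h).
  by rewrite (bigD1 (X u))//= lerDl sumr_ge0.
Qed.

Lemma Rintegral_label A (X : T -> A) (F : A -> R) : label X ->
  \int[mu]_u F (X u) = \sum_a law X a * F a.
Proof.
move=> lX; rewrite /Rintegral.
have E u : (F (X u))%:E = (\sum_a (F a)%:E * (\1_(X @^-1` [set a]) u)%:E)%E.
  rewrite (bigD1 (X u))//= big1 ?adde0 => [|a aX].
    by rewrite indicE mem_set// mule1.
  by rewrite indicE memNset ?mule0//= => Xa; rewrite Xa eqxx in aX.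
have mi a : mu.-integrable setT (fun u => (\1_(X @^-1` [set a]) u)%:E).
  exact: (integrable_label (fun b => \1_[set a] b) lX).
under eq_integral do rewrite E.
rewrite integral_sum//; last by move=> a; exact: integrableZl.
have I a : (\int[mu]_x ((F a)%:E * (\1_(X @^-1` [set a]) x)%:E))%E = (law X a * F a)%:E.
  have J : (\int[mu]_x (\1_(X @^-1` [set a]) x)%:E)%E = mu (X @^-1` [set a]).
    by rewrite integral_indic// ?setIT//; exact: lX.
  rewrite integralZl// J.
  by rewrite EFinM [in RHS]muleC fine_probK.
by under eq_bigr do rewrite I; rewrite sumEFin.
Qed.

(** Reduces integrals of Hölder functions to finite sums over words: [g] lies between [F \o X - e]
    and [F \o X + e]. *)
Lemma Rintegral_close_label A (X : T -> A) (g : T -> R) (F : A -> R) (e : R) :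
  label X -> mu.-integrable setT (EFin \o g) ->
  (forall u, `|g u - F (X u)| <= e) ->
  `|\int[mu]_u g u - \sum_a law X a * F a| <= e.
Proof.
move=> l ig H.
have shiftF e' : \sum_a law X a * (F a + e') = \sum_a law X a * F a + e'.
  under eq_bigr do rewrite mulrDr.
  by rewrite big_split/= -mulr_suml (proj2 (distr_law l)) mul1r.
have h1 : \int[mu]_u g u <= \sum_a law X a * (F a + e).
  rewrite -(Rintegral_label (fun w => F w + e) l); apply: le_Rintegral => //.
    exact: (integrable_label (fun w => F w + e)).
  by move=> u _; have := H u; rewrite ler_norml; lra.
have h2 : \sum_a law X a * (F a + - e) <= \int[mu]_u g u.
  rewrite -(Rintegral_label (fun w => F w + - e) l); apply: le_Rintegral => //.
    exact: (integrable_label (fun w => F w + - e)).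
  by move=> u _; have := H u; rewrite ler_norml; lra.
by move: h1 h2; rewrite !shiftF ler_norml; lra.
Qed.

End Laws.

Definition prefix_tuple N k (u : code_space N) : k.-tuple 'I_N.+1 := [tuple u i | i < k].

Lemma prefix_tupleE N k (u : code_space N) : val (prefix_tuple k u) = mkseq u k.
Proof. by rewrite /= -[RHS]/(map u (iota 0 k)) -val_enum_ord -map_comp. Qed.

Lemma agree_prefix N k (u v : code_space N) : prefix_tuple k u = prefix_tuple k v <-> agree k u v.
Proof.
split=> [uv|uv].
  have e : mkseq u k = mkseq v k by rewrite -!prefix_tupleE uv.
  move=> j jk.
  by rewrite -(nth_mkseq ord0 u jk) e nth_mkseq.
by apply: val_inj; rewrite !prefix_tupleE; apply/eq_in_map => i; rewrite mem_iota => /uv.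
Qed.

Lemma agree_ext_prefix N k (u : code_space N) : agree k (ext (prefix_tuple k u)) u.
Proof. by rewrite prefix_tupleE; exact: agree_ext_mkseq. Qed.

Section CodeMeasurable.
Variables (R : realType) (N : nat) (gamma : R).
Hypothesis gamma01 : 0 < gamma < 1.
Local Notation T := (borel_code N gamma).

Lemma measurable_cylinder (w : seq 'I_N.+1) : measurable (cylinder w : set T).
Proof.
apply: sub_sigma_algebra => u wu; exists (gamma ^+ size w).
  by rewrite exprn_gt0//; case/andP: gamma01.
move=> v /(code_dist_lt gamma01) uv.
by apply: (agree_cylinder _ wu); apply/agree_sym/(agreeS _ uv).
Qed.

Lemma expr_small (e : R) : 0 < e -> exists n, gamma ^+ n < e.
Proof.
move=> e0; have /andP[g0 g1] := gamma01.
have : gamma ^+ n @[n --> \oo] --> 0 by apply: cvg_expr; rewrite ger0_norm ?ltW.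
move=> /cvgrPdist_lt/(_ e e0)[n _ /(_ n (leqnn n))]; rewrite sub0r normrN.
by rewrite ger0_norm ?exprn_ge0 ?ltW// => ?; exists n.
Qed.

Lemma code_openE (B : set T) : code_open gamma B ->
  B = \bigcup_(w in [set w | cylinder w `<=` B]) cylinder w.
Proof.
move=> oB; apply/seteqP; split => [u Bu|u [w wB]]; last exact: wB.
have [e e0 eB] := oB u Bu; have [n ne] := expr_small e0.
exists (mkseq u n); last exact/cylinder_mkseq.
move=> v /cylinder_mkseq vu; apply: eB; apply: le_lt_trans ne.
exact/(agree_code_dist gamma01)/agree_sym.
Qed.

(** The empty set is included so that the family is stable under intersection: two cylinders are
    nested or disjoint. *)
Definition cylinders : set (set T) :=
  [set B | B = set0 \/ exists w, B = cylinder w].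

(** There are only countably many words, so every open set is a countable union of cylinders. *)
Lemma measurable_codeE : @measurable _ T = <<s cylinders >>.
Proof.
apply/seteqP; split => B.
  apply: smallest_sub; first exact: smallest_sigma_algebra.
  move=> {}B /code_openE ->; rewrite bigcup_mkcond.
  pose TT := g_sigma_algebraType cylinders.
  apply: (@countable_bigcupT_measurable _ TT) => [|w]; first exact: countableP.
  case: ifPn => _; last exact: (@measurable0 _ TT).
  by apply: sub_sigma_algebra; right; exists w.
apply: smallest_sub; first exact: sigma_algebra_measurable.
move=> _ [->|[w ->]]; [exact: measurable0|exact: measurable_cylinder].
Qed.

Lemma setI_cylinders : setI_closed cylinders.
Proof.
move=> B B' [->|[w ->]]; first by rewrite set0I; left.
move=> [->|[v ->]]; first by rewrite setI0; left.
wlog wv : w v / (size w <= size v)%N => [H|].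
  by have [/H//|/ltnW/H] := leqP (size w) (size v); rewrite setIC.
have [/cylinderP h|h] := pselect (cylinder w (ext v)).
  right; exists v; apply/seteqP; split => [u []//|u uv]; split=> //.
  apply: (@agree_cylinder _ w u (ext v)); last exact/cylinderP.
  exact/(agreeS wv)/cylinder_agree.
left; apply/seteqP; split => // u [uw uv]; apply: h.
apply: (agree_cylinder _ uw); apply: (agreeS wv).
exact: cylinder_agree.
Qed.

Lemma prob_ext (mu nu : probability T R) :
  (forall w, mu (cylinder w) = nu (cylinder w)) ->
  forall B, measurable B -> mu B = nu B.
Proof.
move=> H; apply: (measure_unique cylinders (fun=> cylinder [::])).
- exact: measurable_codeE.
- exact: setI_cylinders.
- by move=> _; right; exists [::].
- by apply/seteqP; split => // u _; exists 0%N.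
- by move=> _ [->|[w ->]]; [rewrite !measure0|exact: H].
- by move=> _; rewrite (le_lt_trans (probability_le1 _ _)) ?ltry//; exact: measurable_cylinder.
Qed.

Lemma measurable_shift : measurable_fun setT (@shift N : T -> T).
Proof.
apply: (@measurability _ _ T T _ _ (@code_open _ N gamma)) => // _ [B oB <-]; rewrite setTI.
apply: sub_sigma_algebra => u Bu; have [e e0 eB] := oB _ Bu.
have [n ne] := expr_small e0; exists (gamma ^+ n).
  by rewrite exprn_gt0//; case/andP: gamma01.
move=> v /(code_dist_lt gamma01) uv; apply: eB; apply: le_lt_trans ne.
by apply: (agree_code_dist gamma01); apply: (agree_shift (k:=1)).
Qed.

Lemma measurable_iter_shift k : measurable_fun setT (iter k (@shift N) : T -> T).
Proof.
elim: k => [|k IH]; first exact: measurable_id.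
exact: (measurableT_comp measurable_shift IH).
Qed.

Lemma measurable_holder (g : T -> R) : holder_code g -> measurable_fun setT g.
Proof.
move=> [c c0 [rho rho01 H]].
apply: (@measurability _ _ T _ _ _ (@measurable_realfun.RGenOpens.G R)) => [|_ [_ [x [y ->]] <-]].
  exact: measurable_realfun.RGenOpens.measurableE.
rewrite setTI.
apply: sub_sigma_algebra => u /=; rewrite in_itv/= => /andP[xu uy].
have /andP[r0 r1] := rho01.
have : c * rho ^+ n @[n --> \oo] --> 0.
  by rewrite -(mulr0 c); apply: cvgMr; apply: cvg_expr; rewrite ger0_norm ?ltW.
have m0 : 0 < Num.min (g u - x) (y - g u) by rewrite lt_min !subr_gt0 xu.
move=> /cvgrPdist_lt/(_ _ m0)[n _ /(_ n (leqnn n))]; rewrite sub0r normrN /= => h.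
exists (gamma ^+ n); first by rewrite exprn_gt0//; case/andP: gamma01.
move=> v /(code_dist_lt gamma01)/(agreeS (leqnSn n)) uv.
have := le_lt_trans (H _ _ _ uv) (le_lt_trans (ler_norm _) h).
rewrite lt_min => /andP[h1 h2].
by rewrite in_itv/=; move: h1 h2; rewrite !ltr_norml; lra.
Qed.

Lemma integrable_holder (mu : probability T R) (g : T -> R) :
  holder_code g -> mu.-integrable setT (EFin \o g).
Proof.
move=> hg; apply: measurable_bounded_integrable => //.
- exact: le_lt_trans (probability_le1 mu measurableT) (ltry _).
- exact: measurable_holder.
- have [M M0 HM] := holder_bounded hg.
  by exists M; split; [exact: num_real|move=> x Mx u _ /=; exact: le_trans (ltW Mx)].
Qed.

Lemma prefix_tuple_preimage k (w : k.-tuple 'I_N.+1) :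
  @prefix_tuple N k @^-1` [set w] = cylinder w.
Proof.
apply/seteqP; split => u /=.
  by move=> <-; rewrite prefix_tupleE; exact/cylinder_mkseq.
by move=> /cylinderP; rewrite size_tuple -prefix_tupleE => /val_inj.
Qed.

Lemma label_prefix k : label (T := T) (@prefix_tuple N k).
Proof. by move=> w; rewrite prefix_tuple_preimage; exact: measurable_cylinder. Qed.

Lemma law_prefix (mu : probability T R) k (w : k.-tuple 'I_N.+1) :
  law mu (@prefix_tuple N k) w = fine (mu (cylinder w)).
Proof. by rewrite /law prefix_tuple_preimage. Qed.

Lemma Rintegral_holder (mu : probability T R) (g : T -> R) (c rho : R) :
  holder_code g ->
  (forall n u v, agree n u v -> `|g u - g v| <= c * rho ^+ n) ->
  forall k, `|\int[mu]_u g u - \sum_(w : k.-tuple 'I_N.+1) fine (mu (cylinder w)) * g (ext w)|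
    <= c * rho ^+ k.
Proof.
move=> hg H k; under eq_bigr do rewrite -law_prefix.
apply: (Rintegral_close_label (F := fun w : k.-tuple _ => g (ext w))).
- exact: label_prefix.
- exact: integrable_holder.
by move=> u; apply: H; apply/agree_sym; exact: agree_ext_prefix.
Qed.

End CodeMeasurable.

(** * Measures with prescribed cylinder masses *)

Section CodeMeasureOfCylinders.
Variables (R : realType) (N : nat) (gamma : R).
Hypothesis gamma01 : 0 < gamma < 1.
Local Notation T := (borel_code N gamma).
Variable m : seq 'I_N.+1 -> R.
Hypothesis m_nil : m [::] = 1.
Hypothesis m_ge0 : forall w, 0 <= m w.
Hypothesis m_rcons : forall w, m w = \sum_a m (rcons w a).

(* The measure is the image of Lebesgue measure on [0, 1) under the map
   [coder] that reads off the digits of a point with respect to the nested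
   cells [[left_end w, left_end w + m w)]. *)
Fixpoint left_end_from (p w : seq 'I_N.+1) : R :=
  if w is a :: w' then
    \sum_(b < N.+1 | (b < a)%N) m (rcons p b) + left_end_from (rcons p a) w'
  else 0.

Definition left_end w := left_end_from [::] w.

Definition in_cell w (x : R) := left_end w <= x < left_end w + m w.

Lemma left_end_rcons w a :
  left_end (rcons w a) = left_end w + \sum_(b < N.+1 | (b < a)%N) m (rcons w b).
Proof.
rewrite /left_end -{3}[w]cat0s.
elim: w [::] => [|c w IH] p /=; first by rewrite addr0 add0r cats0.
by rewrite IH cat_rcons addrA.
Qed.

Lemma sum_lt_ordS w (a : 'I_N.+1) :
  \sum_(b < N.+1 | (b < a.+1)%N) m (rcons w b) =
  \sum_(b < N.+1 | (b < a)%N) m (rcons w b) + m (rcons w a).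
Proof.
rewrite (bigD1 a)//= addrC; congr (_ + _); apply: eq_bigl => b.
by rewrite ltnS ltn_neqAle andbC.
Qed.

Lemma le_sum_lt_ord w (a b : nat) : (a <= b)%N ->
  \sum_(c < N.+1 | (c < a)%N) m (rcons w c) <= \sum_(c < N.+1 | (c < b)%N) m (rcons w c).
Proof.
move=> ab; rewrite [leRHS](bigID (fun c : 'I_N.+1 => (c < a)%N))/=.
rewrite (eq_bigl (fun c : 'I_N.+1 => (c < b) && (c < a))%N); last first.
  by move=> c; case: (ltnP c a) => // ca; rewrite ?andbF// andbT (leq_trans ca).
by rewrite lerDl sumr_ge0.
Qed.

Lemma sub_in_cell w a x : in_cell (rcons w a) x -> in_cell w x.
Proof.
rewrite /in_cell left_end_rcons -addrA -sum_lt_ordS => /andP[h1 h2].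
have h0 : 0 <= \sum_(b < N.+1 | (b < a)%N) m (rcons w b) by apply: sumr_ge0.
apply/andP; split; first lra.
apply: lt_le_trans h2 _; rewrite lerD2l m_rcons.
rewrite (le_trans (le_sum_lt_ord _ (ltn_ord a)))//.
by rewrite (eq_bigl xpredT)// => b; rewrite ltn_ord.
Qed.

Lemma in_cell_uniq w a b x : in_cell (rcons w a) x -> in_cell (rcons w b) x -> a = b.
Proof.
wlog ab : a b / (a < b)%N => [H ha hb|].
  have [ab|ba|/val_inj//] := ltngtP a b; first exact: H.
  by apply/esym/H.
rewrite /in_cell !left_end_rcons -!addrA -!sum_lt_ordS => /andP[_ h1] /andP[h2 _].
by have := lt_le_trans h1 (le_trans _ h2); rewrite lerD2l le_sum_lt_ord// ltxx => /(_ isT).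
Qed.

Lemma in_cell_ex w x : in_cell w x -> exists a, in_cell (rcons w a) x.
Proof.
move=> /andP[h1 h2].
(* The least [k] whose subcell ends beyond [x] is the next digit; minimality gives the left
   inequality. *)
pose P k := x < left_end w + \sum_(c < N.+1 | (c < k.+1)%N) m (rcons w c).
have exP : exists k, P k.
  exists N; rewrite /P (eq_bigl xpredT) -?m_rcons// => b; exact: ltn_ord.
case: (ex_minnP exP) => k Pk kmin.
have kN : (k < N.+1)%N.
  by apply: kmin; rewrite /P (eq_bigl xpredT) -?m_rcons// => b; exact: ltn_ord.
exists (Ordinal kN); rewrite /in_cell left_end_rcons -addrA -sum_lt_ordS.
rewrite [X in _ && X]Pk andbT/=.
case: k Pk kmin kN => [|k] Pk kmin kN; first by rewrite big_pred0 ?addr0.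
by rewrite leNgt; apply/negP => /kmin; rewrite ltnn.
Qed.

Definition next_letter w x : 'I_N.+1 := odflt ord0 [pick a | in_cell (rcons w a) x].

Fixpoint cell_word x n : seq 'I_N.+1 :=
  if n is n'.+1 then rcons (cell_word x n') (next_letter (cell_word x n') x) else [::].

(** The value outside [[0, 1)] is arbitrary, since Lebesgue measure is restricted to [[0, 1)]. *)
Definition coder (x : R) : T :=
  if (0 <= x < 1) then fun k => next_letter (cell_word x k) x else fun=> ord0.

Lemma in_cell_nil x : in_cell [::] x = (0 <= x < 1).
Proof. by rewrite /in_cell m_nil add0r. Qed.

Lemma in_cell_word x n : 0 <= x < 1 -> in_cell (cell_word x n) x.
Proof.
move=> x01; elim: n => [|n IH]/=; first by rewrite in_cell_nil.
rewrite /next_letter; case: pickP => //= h.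
by have [a] := in_cell_ex IH; rewrite h.
Qed.

Lemma mkseq_coder x n : 0 <= x < 1 -> mkseq (coder x) n = cell_word x n.
Proof.
move=> x01; rewrite /coder x01; elim: n => //= n IH.
by rewrite mkseqS IH.
Qed.

Lemma in_cell_cell_word w x : in_cell w x -> cell_word x (size w) = w.
Proof.
elim/last_ind: w => // w a IH h; rewrite size_rcons/=.
have hw := sub_in_cell h; rewrite (IH hw); congr rcons.
rewrite /next_letter; case: pickP => [b hb|/(_ a)]; last by rewrite h.
exact: in_cell_uniq hb h.
Qed.

Lemma in_cell01 w x : in_cell w x -> 0 <= x < 1.
Proof.
elim/last_ind: w => [|w a IH]; first by rewrite in_cell_nil.
by move=> /sub_in_cell.
Qed.

Lemma coder_cylinder w x : 0 <= x < 1 -> cylinder w (coder x) <-> in_cell w x.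
Proof.
move=> x01; split => [/cylinderP|wx].
  by rewrite mkseq_coder// => <-; exact: in_cell_word.
by apply/cylinderP; rewrite mkseq_coder// in_cell_cell_word.
Qed.

Lemma in_cellE w : [set x | in_cell w x] = `[left_end w, left_end w + m w[%classic.
Proof. by apply/seteqP; split => x /=; rewrite in_itv. Qed.

Lemma coder_preimage w : coder @^-1` cylinder w =
  [set x | in_cell w x] `|`
  (if pselect (cylinder w (fun=> ord0)) then ~` `[0, 1[%classic else set0).
Proof.
apply/seteqP; split => x /=.
  have [x01|x01] := boolP (0 <= x < 1); first by move=> /(coder_cylinder w x01); left.
  rewrite /coder (negbTE x01) => h; right; case: pselect => //= _.
  by rewrite in_itv/=; exact/negP.
move=> [wx|]; first exact/(coder_cylinder w (in_cell01 wx)).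
case: pselect => //= h; rewrite in_itv/= => /negP x01.
by rewrite /coder (negbTE x01).
Qed.

Lemma measurable_coder : measurable_fun setT coder.
Proof.
apply: (measurability _ (measurable_codeE N gamma01)) => _ [_ [->|[w ->]] <-].
  by rewrite preimage_set0 setI0.
rewrite setTI coder_preimage in_cellE.
by apply: measurableU => //; case: (pselect _) => ?; [exact: measurableC|exact: measurable0].
Qed.

(** Kolmogorov extension for the code space, [m_rcons] being the consistency condition. A word of
    mass 0 has an empty cell. *)
Lemma exists_code_measure :
  exists mu : probability T R, forall w, mu (cylinder w) = (m w)%:E.
Proof.
have mD : measurable (`[0, 1[ : set R) by exact: measurable_itv.
pose nu := [the {measure set _ -> \bar R} of mrestr (@lebesgue_measure R) mD].
have nuE w : pushforward nu coder (cylinder w) = (m w)%:E.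
  rewrite /pushforward /nu/= /mrestr coder_preimage setIUl.
  have -> : (if pselect (cylinder w (fun=> ord0)) then ~` `[0, 1[%classic else set0)
      `&` `[0, 1[ = set0 :> set R.
    by case: (pselect _) => ?; rewrite ?set0I// setICl.
  rewrite setU0 setIidl => [|x /= /in_cell01]; last by rewrite in_itv.
  rewrite in_cellE lebesgue_measure_itv/= lte_fin ltrDl -EFinB.
  case: ltP => [_|m0]; first by congr EFin; ring.
  by congr EFin; apply/eqP; rewrite eq_le m_ge0 m0.
pose mu1 := HB.pack_for {measure set T -> \bar R} (pushforward nu coder).
pose mu0 : {measure set T -> \bar R} := mu1 measurable_coder.
have mu01 : mu0 setT = 1%E.
  have -> : setT = cylinder [::] :> set T by apply/seteqP.
  by rewrite -m_nil; exact: nuE.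
pose mu := HB.pack_for (probability T R) (pushforward nu coder)
  (Measure_isProbability.Build _ _ _ mu0 mu01).
by exists (mu measurable_coder).
Qed.

End CodeMeasureOfCylinders.

(** * Entropy of invariant measures *)

Section Fekete.
Variable R : realType.
Variable u : nat -> R.
Hypothesis u_ge0 : forall n, 0 <= u n.
Hypothesis u_sub : forall n m, u (n + m)%N <= u n + u m.

Lemma subadditive_mul k n : u (k * n)%N <= k%:R * u n + u 0%N.
Proof.
elim: k => [|k IH]; first by rewrite mul0n mul0r add0r.
rewrite mulSn (le_trans (u_sub _ _))// -natr1 mulrDl mul1r; lra.
Qed.

(** The limit is the infimum of [u n / n]. The last two clauses say so without division; they are
    the form in which entropy is used. *)
Lemma fekete : exists l : R,
  [/\ n%:R^-1 * u n @[n --> \oo] --> l,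
      forall n, n%:R * l <= u n &
      forall c, (forall n, (0 < n)%N -> n%:R * c <= u n) -> c <= l].
Proof.
pose E := [set n.+1%:R^-1 * u n.+1 | n in setT].
have E0 : E !=set0 by exists (1%:R^-1 * u 1%N), 0%N.
have lbE : lbound E 0 by move=> _ [n _ <-]; rewrite mulr_ge0.
have hE : has_inf E by split=> //; exists 0.
have infE n : n%:R * inf E <= u n.
  case: n => [|n]; first by rewrite mul0r.
  rewrite mulrC -ler_pdivlMr ?ltr0n// mulrC.
  by apply: ge_inf; [exists 0|exists n].
exists (inf E); split => //; last first.
  move=> c H; apply: lb_le_inf => // _ [n _ <-].
  by rewrite mulrC ler_pdivlMr ?ltr0n// mulrC H.
apply/cvgrPdist_le => e e0.
have [_ [n _ <-]] := inf_adherent (ltac:(by rewrite divr_gt0) : 0 < e / 2) hE.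
set m := n.+1 => hm.
(* Bounds the contribution of the remainder [p %% m]; each use of [subadditive_mul] leaves one
   [u 0]. *)
pose M := m%:R * u 1%N + 2 * u 0%N.
have M0 : 0 <= M by rewrite addr_ge0// mulr_ge0.
have [k hk] : exists k : nat, M <= e / 2 * k%:R.
  exists (Num.trunc (M / (e / 2))).+1.
  rewrite mulrC -ler_pdivrMr ?divr_gt0//.
  by apply/ltW; rewrite truncnS_gt.
near=> p.
have p0 : (0 < p)%N by near: p; exists 1%N.
have kp : (k <= p)%N by near: p; exists k.
rewrite distrC ger0_norm; last first.
  by rewrite subr_ge0 mulrC ler_pdivlMr ?ltr0n// mulrC.
rewrite lerBlDr mulrC ler_pdivrMr ?ltr0n//.
have h1 : u p <= (p %/ m)%:R * u m + M.
  rewrite {1}(divn_eq p m) (le_trans (u_sub _ _))//.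
  have := subadditive_mul (p %/ m) m.
  have := subadditive_mul (p %% m) 1; rewrite muln1.
  have : (p %% m)%:R * u 1%N <= m%:R * u 1%N.
    by rewrite ler_wpM2r// ler_nat ltnW// ltn_mod.
  rewrite /M; lra.
have h2 : (p %/ m)%:R * u m <= p%:R * (m%:R^-1 * u m).
  rewrite mulrA ler_wpM2r// ler_pdivlMr ?ltr0n// -natrM ler_nat.
  exact: leq_trunc_div.
have h3 : p%:R * (m%:R^-1 * u m) <= p%:R * (inf E + e / 2).
  by rewrite ler_wpM2l// ltW.
have h4 : M <= p%:R * (e / 2).
  by rewrite (le_trans hk)// mulrC ler_wpM2r ?ler_nat// ltW// divr_gt0.
move: h3; rewrite mulrDr mulrDl => h3.
have -> : e * p%:R = p%:R * (e / 2) + p%:R * (e / 2) by field.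
rewrite [inf E * _]mulrC; lra.
Unshelve. all: by end_near.
Qed.

End Fekete.

Lemma cvg_invn (R : realType) : n%:R^-1 @[n --> \oo] --> (0 : R).
Proof. by rewrite -cvg_shiftS; exact: cvg_harmonic. Qed.

Section KolmogorovSinai.
Variables (R : realType) (N : nat) (gamma : R).
Hypothesis gamma01 : 0 < gamma < 1.
Local Notation T := (borel_code N gamma).
Local Notation shift := (@Defs.shift N).
Variable mu : probability T R.
Hypothesis mu_inv : shift_invariant mu.
Implicit Types A B : finType.

Lemma mu_iter_shift k (E : set T) : measurable E -> mu (iter k shift @^-1` E) = mu E.
Proof.
elim: k E => // k IH E mE.
have -> : iter k.+1 shift @^-1` E = iter k shift @^-1` (shift @^-1` E).
  by apply/seteqP; split => u.
have mE' : measurable (shift @^-1` E : set T).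
  by rewrite -[X in measurable X]setTI; exact: measurable_shift.
by rewrite IH// mu_inv.
Qed.

Lemma label_iter_shift A (X : T -> A) k : label X -> label (X \o iter k shift : T -> A).
Proof.
move=> lX a; rewrite comp_preimage -[X in measurable X]setTI.
by apply: measurable_iter_shift => //; exact: lX.
Qed.

Lemma law_iter_shift A (X : T -> A) k : label X ->
  law mu (X \o iter k shift : T -> A) =1 law mu X.
Proof. by move=> lX a; rewrite /law comp_preimage mu_iter_shift//; exact: lX. Qed.

Definition itinerary A (X : T -> A) n (u : T) : n.-tuple A :=
  [tuple X (iter i shift u) | i < n].

Lemma itineraryD A (X : T -> A) n m u : itinerary X (n + m) u =
  cat_tuple (itinerary X n u) (itinerary X m (iter n shift u)).
Proof.
apply: eq_from_tnth => i; rewrite tnth_mktuple.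
case: (split_ordP i) => j ->; rewrite ?(tnth_lshift, tnth_rshift) !tnth_mktuple//.
by rewrite -iterD (addnC j n).
Qed.

Lemma label_itinerary A (X : T -> A) n : label X -> label (itinerary X n).
Proof.
move=> lX w.
have -> : itinerary X n @^-1` [set w] =
    \bigcap_(i in [set: 'I_n]) (X \o iter i shift) @^-1` [set tnth w i].
  apply/seteqP; split => u /=.
    by move=> <- i _ /=; rewrite tnth_mktuple.
  by move=> H; apply: eq_from_tnth => i; rewrite tnth_mktuple; exact: (H i I).
by apply: fin_bigcap_measurable => // i _; exact: label_iter_shift.
Qed.

Definition join_ent A (X : T -> A) n : R := ent (law mu (itinerary X n)).

Lemma join_ent_ge0 A (X : T -> A) n : label X -> 0 <= join_ent X n.
Proof. by move=> lX; apply: ent_ge0; apply: distr_law; exact: label_itinerary. Qed.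

Lemma join_entD A (X : T -> A) n m : label X ->
  join_ent X (n + m) <= join_ent X n + join_ent X m.
Proof.
move=> lX; have ln := label_itinerary (n := n) lX; have lm := label_itinerary (n := m) lX.
have lm' : label (itinerary X m \o iter n shift : T -> _) by exact: label_iter_shift.
rewrite (le_trans (@ent_law_comp _ _ _ mu _ _
  (fun u => (itinerary X n u, itinerary X m (iter n shift u))) _
  (fun p => cat_tuple p.1 p.2) _ _))//; first exact: label_pair.
  by move=> u; exact: itineraryD.
rewrite (le_trans (ent_law_pair mu ln lm'))//.
by rewrite lerD2l (eq_ent (law_iter_shift n lm)).
Qed.

Lemma join_ent0 A (X : T -> A) : join_ent X 0 = 0.
Proof.
have -> : join_ent X 0 = ent (law mu (fun _ : T => [tuple] : 0.-tuple A)).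
  by apply/eq_ent/eq_law => u; rewrite [LHS]tuple0.
rewrite /ent big1// => w _; rewrite /law.
have -> : (fun=> [tuple]) @^-1` [set w] = [set: T] by apply/seteqP; split => //= u _; rewrite (tuple0 w).
by rewrite probability_setT/= ln1 mulr0 oppr0.
Qed.

Lemma join_ent1 A (X : T -> A) : label X -> join_ent X 1 <= ent (law mu X).
Proof.
move=> lX; apply: (@ent_law_comp _ _ _ mu _ _ X _ (fun a => [tuple a])) => // u.
by apply: eq_from_tnth => i; rewrite tnth_mktuple ord1.
Qed.

Lemma join_ent_mul A (X : T -> A) k n : label X ->
  join_ent X (k * n) <= k%:R * join_ent X n.
Proof.
move=> lX; have := subadditive_mul (fun n m => join_entD n m lX) k n.
by rewrite join_ent0 addr0.
Qed.

Lemma join_entropyE m (xi : T -> 'I_m) n : join_entropy mu xi n = join_ent xi n.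
Proof.
apply: eq_bigr => w _; rewrite /law.
have -> : [set u : T | forall k : 'I_n, xi (iter k shift u) = tnth w k] =
    itinerary xi n @^-1` [set w] => //.
apply/seteqP; split => u /= H.
  by apply: eq_from_tnth => i; rewrite tnth_mktuple H.
by move=> k; rewrite -H tnth_mktuple.
Qed.

Definition letter (u : T) : 'I_N.+1 := u 0%N.

Lemma itinerary_letter n u : itinerary letter n u = prefix_tuple n u.
Proof. by apply: eq_mktuple => i; rewrite /letter iter_shiftE addn0. Qed.

Lemma label_letter : label letter.
Proof.
have -> : letter = (fun w : 1.-tuple _ => tnth w ord0) \o @prefix_tuple N 1.
  by apply/funext => u; rewrite /= tnth_mktuple.
by apply: label_comp; exact: label_prefix.
Qed.

Definition level k (E : set T) : Prop := forall u v, agree k u v -> E u -> E v.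

Lemma measurable_level k (E : set T) : level k E -> measurable E.
Proof.
move=> lE.
have -> : E = @prefix_tuple N k @^-1` [set w | E (ext w)].
  apply/seteqP; split => u /=; apply: lE; last exact: agree_ext_prefix.
  exact/agree_sym/agree_ext_prefix.
by apply: label_preimage; exact: label_prefix.
Qed.

(** Approximation in the pseudometric [mu (E symmetric difference F)] by finite unions of cylinders.
    Such sets form a sigma-algebra containing the cylinders, hence they are all the Borel sets. *)
Definition clopen_approx (E : set T) : Prop := measurable E /\
  forall e : R, 0 < e -> exists k F, level k F /\
    (mu (E `\` F `|` F `\` E) < e%:E)%E.

Lemma clopen_approxC E : clopen_approx E -> clopen_approx (~` E).
Proof.
move=> [mE H]; split; first exact: measurableC.
move=> e e0; have [k [F [lF h]]] := H e e0; exists k, (~` F); split.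
  by move=> u v uv nFu Fv; apply: nFu; apply: lF Fv; exact: agree_sym.
by rewrite !setDE !setCK [~` E `&` F]setIC [~` F `&` E]setIC setUC -!setDE.
Qed.

Lemma clopen_approxU E E' : clopen_approx E -> clopen_approx E' ->
  clopen_approx (E `|` E').
Proof.
move=> [mE H] [mE' H']; split; first exact: measurableU.
move=> e e0; have e2 : 0 < e / 2 by rewrite divr_gt0.
have [k [F [lF h]]] := H _ e2; have [k' [F' [lF' h']]] := H' _ e2.
exists (maxn k k'), (F `|` F'); split.
  move=> u v uv [Fu|Fu]; [left; apply: lF Fu|right; apply: lF' Fu];
    by apply: agreeS uv; rewrite ?leq_maxl ?leq_maxr.
have mF := measurable_level lF; have mF' := measurable_level lF'.
have m1 : measurable (E `\` F `|` F `\` E).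
  by apply: measurableU; exact: measurableD.
have m2 : measurable (E' `\` F' `|` F' `\` E').
  by apply: measurableU; exact: measurableD.
rewrite [e]splitr EFinD; apply: le_lt_trans (lteD h h').
apply: le_trans (measureU2 _ m1 m2); apply: le_measure.
- by rewrite inE; apply: measurableU; apply: measurableD; apply: measurableU.
- by rewrite inE; exact: measurableU.
- move=> u [[[Eu|Eu] nF]|[[Fu|Fu] nE]].
  + by left; left; split => // Fu; apply: nF; left.
  + by right; left; split => // Fu; apply: nF; right.
  + by left; right; split => // Eu; apply: nE; left.
  + by right; right; split => // Eu; apply: nE; right.
Qed.

Lemma clopen_approx0 : clopen_approx set0.
Proof.
split; first exact: measurable0.
by move=> e e0; exists 0%N, set0; split=> //; rewrite set0D setU0 measure0 lte_fin.
Qed.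

(** Continuity from below leaves all but [e / 2] of the mass in a finite union, to which stability
    under finite unions applies. *)
Lemma clopen_approx_bigcup (F : (set T)^nat) :
  (forall n, clopen_approx (F n)) -> clopen_approx (\bigcup_n F n).
Proof.
move=> H; have mF n : measurable (F n) := proj1 (H n).
have mU : measurable (\bigcup_n F n) by apply: bigcupT_measurable.
split=> // e e0; have e2 : 0 < e / 2 by rewrite divr_gt0.
pose G n := \big[setU/set0]_(i < n.+1) F i.
have aG n : clopen_approx (G n).
  rewrite /G; elim/big_rec: _ => [|i x _ ax]; first exact: clopen_approx0.
  exact: clopen_approxU.
have mG n : measurable (G n) := proj1 (aG n).
have UG : \bigcup_n G n = \bigcup_n F n by rewrite /G bigcup_bigsetU_bigcup.
have cG : mu \o G @ \oo --> mu (\bigcup_n G n).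
  apply: nondecreasing_cvg_mu => //; first by rewrite UG.
  by move=> n m nm; apply/subsetPset; exact: subset_bigsetU.
have [n hn] : exists n, fine (mu (\bigcup_n F n)) < fine (mu (G n)) + e / 2.
  move: cG; rewrite UG -(fine_probK mu mU) => /fine_cvgP[_ /cvgrPdist_lt/(_ _ e2)].
  move=> [n _ /(_ n (leqnn n))] /= h; exists n.
  by rewrite addrC -ltrBlDr (le_lt_trans (ler_norm _) h).
have [k [C [lC hC]]] := proj2 (aG n) _ e2.
have mC := measurable_level lC.
have GU : G n `<=` \bigcup_n F n by rewrite -UG; exact: bigcup_sup.
have mGC : measurable (G n `\` C `|` C `\` G n).
  by apply: measurableU; exact: measurableD.
have mUG : measurable (\bigcup_n F n `\` G n) by exact: measurableD.
have key : (mu (\bigcup_n F n `\` G n) < (e / 2)%:E)%E.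
  have -> : mu (\bigcup_n F n `\` G n) = (mu (\bigcup_n F n) - mu (G n))%E.
    rewrite measureD//; last exact: le_lt_trans (probability_le1 mu mU) (ltry _).
    by rewrite (setIidr GU).
  rewrite -(fine_probK mu mU) -(fine_probK mu (mG n)) -EFinB lte_fin; lra.
exists k, C; split=> //.
apply: (@le_lt_trans _ _ (mu ((\bigcup_n F n `\` G n) `|` (G n `\` C `|` C `\` G n)))).
  apply: le_measure.
  - by rewrite inE; apply: measurableU; exact: measurableD.
  - by rewrite inE; exact: measurableU.
  - move=> u [[Uu nC]|[Cu nU]]; last by right; right; split => // /GU.
    by have [Gu|nG] := pselect (G n u); [right; left|left].
rewrite [e]splitr EFinD; apply: le_lt_trans (measureU2 _ mUG mGC) _.
exact: (lteD key hC).
Qed.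

Lemma clopen_approx_measurable E : measurable E -> clopen_approx E.
Proof.
suff: <<s @cylinders R N gamma >> `<=` clopen_approx.
  by move=> H mE; apply: H; rewrite -measurable_codeE.
apply: smallest_sub => [|_ [->|[w ->]]].
- split; first exact: clopen_approx0.
  + by move=> A aA; rewrite setTD; exact: clopen_approxC.
  + exact: clopen_approx_bigcup.
- exact: clopen_approx0.
- split; first exact: measurable_cylinder.
  move=> e e0; exists (size w), (cylinder w); split.
    by move=> u v /agree_sym uv; exact: agree_cylinder.
  by rewrite setDv setU0 measure0 lte_fin.
Qed.


(** Approximate each of the [m] classes up to [e / m]. Outside the symmetric differences [D a] a
    point lies in [F a] exactly for [a = xi u], so that the labels agree there. *)
Lemma close_level_label m (xi : T -> 'I_m) (e : R) : finite_partition xi -> 0 < e ->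
  exists k, exists2 xi' : T -> 'I_m,
    (forall u v, agree k u v -> xi' u = xi' v) &
    1 - e <= fine (mu [set u | xi u = xi' u]).
Proof.
move=> pxi e0; have m0 : (0 < m)%N by exact: leq_ltn_trans (ltn_ord (xi (fun=> ord0))).
have em : 0 < e / m%:R by rewrite divr_gt0// ltr0n.
have H a := proj2 (clopen_approx_measurable (pxi a)) _ em.
have [k Hk] := choice H; have [F HF] := choice Hk.
pose K := \max_a k a.
have lF a : level K (F a).
  by move=> u v uv; apply: (proj1 (HF a)); apply: agreeS uv; exact: leq_bigmax.
(* The sets [F a] need neither cover nor be disjoint; where they fail to, the point lies in some
   [D a]. *)
pose xi' (u : T) := odflt (Ordinal m0) [pick a | `[< F a u >]].
exists K, xi'.
  move=> u v uv; rewrite /xi'; congr odflt; apply: eq_pick => a.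
  by apply/asboolP/asboolP; apply: lF => //; exact: agree_sym.
have lxi' : label xi'.
  move=> a; apply: (@measurable_level K) => u v uv /= <-.
  rewrite /xi'; congr odflt; apply: eq_pick => b.
  by apply/asboolP/asboolP; apply: lF => //; exact: agree_sym.
pose D a := xi @^-1` [set a] `\` F a `|` F a `\` xi @^-1` [set a].
have mD a : measurable (D a).
  have := measurable_level (lF a) => mFa; have := pxi a => mxa.
  by apply: measurableU; exact: measurableD.
have mE : measurable [set u | xi u = xi' u].
  have -> : [set u | xi u = xi' u] =
      (fun u => (xi u, xi' u)) @^-1` [set p | p.1 = p.2] by [].
  by apply: label_preimage; exact: label_pair.
suff h : (mu (~` [set u | xi u = xi' u]) <= e%:E)%E.
  move: h; rewrite probability_setC// -(fine_probK mu mE) -EFinB lee_fin; lra.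
have sub : ~` [set u | xi u = xi' u] `<=` \big[setU/set0]_(a : 'I_m) D a.
  move=> u /= neq; apply: contrapT => nD.
  have {}nD a : ~ D a u by move=> Da; apply: nD; rewrite (bigD1 a)//=; left.
  have xiF a : F a u <-> xi u = a.
    split=> h; apply: contrapT => h'; apply: (nD a); [right|left]; split => //.
  apply: neq; rewrite /xi'; case: pickP => [a /asboolP/xiF//|/(_ (xi u))/asboolP[]].
  exact/xiF.
have [mU leU] : measurable (\big[setU/set0]_(a : 'I_m) D a) /\
    (mu (\big[setU/set0]_(a : 'I_m) D a) <= \sum_(a : 'I_m) (e / m%:R)%:E)%E.
  apply: (big_rec2 (fun s x => measurable s /\ (mu s <= x)%E)).
    by split; [exact: measurable0|rewrite measure0].
  move=> a x B _ [mB hB]; split; first exact: measurableU.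
  apply: le_trans (measureU2 _ (mD a) mB) _; apply: leeD => //.
  exact: ltW (proj2 (HF a)).
apply: le_trans (le_measure _ _ _ sub) _; rewrite ?inE//; first exact: measurableC.
apply: le_trans leU _; rewrite sumEFin lee_fin sumr_const card_ord -[X in X <= _]mulr_natr.
by rewrite divfK// pnatr_eq0 -lt0n.
Qed.

(* [xi] is a function of [xi'] and [mismatch xi xi']; the latter has small
   entropy when [xi] and [xi'] mostly agree, which replaces the usual
   conditional entropy estimate. *)
Definition mismatch m (xi xi' : T -> 'I_m) (u : T) : option 'I_m :=
  if xi u == xi' u then None else Some (xi u).

(** The Kolmogorov-Sinai theorem for the generating partition into first letters: [n] steps of [xi']
    are read off from [n + k] letters, and the mismatch labels add at most [e] per step. *)
Lemma partition_entropy_le m (xi : T -> 'I_m) (l : R) : finite_partition xi ->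
  n%:R^-1 * join_ent letter n @[n --> \oo] --> l ->
  partition_entropy mu xi <= l.
Proof.
move=> pxi cl; rewrite /partition_entropy.
have [h [ch _ _]] := fekete (fun n => join_ent_ge0 n pxi) (fun n m => join_entD n m pxi).
have -> : (fun n => n%:R^-1 * join_entropy mu xi n) =
    (fun n => n%:R^-1 * join_ent xi n) by apply/funext => n; rewrite join_entropyE.
rewrite (cvg_lim _ ch)//; apply/ler_addgt0Pr => e e0.
(* Take [e'] to be the square of [s <= 1]: then [e' <= s] and the whole expression is at most
   [s * c <= e]. *)
have [e' e'0 he'] : exists2 e', 0 < e' & e' + #|{: option 'I_m}|%:R * (2 * Num.sqrt e') <= e.
  pose c : R := 1 + #|{: option 'I_m}|%:R * 2.
  have c0 : 0 < c by rewrite ltr_wpDr// mulr_ge0.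
  pose s := Num.min 1 (e / c).
  have s0 : 0 < s by rewrite lt_min ltr01 divr_gt0.
  exists (s ^+ 2); first by rewrite exprn_gt0.
  rewrite sqrtr_sqr gtr0_norm// mulrA.
  have h1 : s ^+ 2 <= s by rewrite expr2 ger_pMr// ge_min lexx.
  have h2 : s * c <= e by rewrite -ler_pdivlMr// ge_min lexx orbT.
  move: h2; rewrite /c mulrDr mulr1 [s * _]mulrC; lra.
have [k [xi' lxi' pe]] := close_level_label pxi e'0.
have labxi' : label xi'.
  by move=> a; apply: (@measurable_level k) => u v /lxi' /= ->.
pose E := mismatch xi xi'.
have labE : label E.
  exact: (label_comp (fun p => if p.1 == p.2 then None else Some p.1) (label_pair pxi labxi')).
have entE : ent (law mu E) <= e.
  apply: le_trans he'; apply: ent_option_le; first exact: distr_law.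
  apply: le_trans pe _; rewrite /law le_eqVlt; apply/orP; left; apply/eqP.
  congr (fine (mu _)); apply/seteqP; split => u /=; rewrite /E /mismatch.
    by move=> ->; rewrite eqxx.
  by case: eqP.
have H n : join_ent xi n <= join_ent letter n + join_ent letter k + n%:R * e.
  pose Y u := (itinerary xi' n u, itinerary E n u).
  have lY : label Y by apply: label_pair; exact: label_itinerary.
  pose dec (p : n.-tuple 'I_m * n.-tuple (option 'I_m)) : n.-tuple 'I_m :=
    [tuple odflt (tnth p.1 i) (tnth p.2 i) | i < n].
  have h1 : join_ent xi n <= ent (law mu Y).
    apply: (@ent_law_comp _ _ _ mu _ _ _ _ dec) => // u.
    apply: eq_from_tnth => i; rewrite !tnth_mktuple /E /mismatch.
    by case: eqP.
  have h2 := ent_law_pair mu (label_itinerary (n := n) labxi') (label_itinerary (n := n) labE).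
  have h3 : ent (law mu (itinerary xi' n)) <= join_ent letter (n + k).
    apply: (@ent_law_comp _ _ _ mu _ _ _ _
      (fun w : (n + k).-tuple 'I_N.+1 => itinerary xi' n (ext w))).
      by apply: label_itinerary; exact: label_letter.
    move=> u; rewrite itinerary_letter; apply: eq_from_tnth => i; rewrite !tnth_mktuple.
    apply: lxi'; apply: agree_shift; apply: (@agreeS _ _ (n + k)).
      by rewrite leq_add2r ltnW.
    exact/agree_sym/agree_ext_prefix.
  have h4 := join_entD n k label_letter.
  have h5 := join_ent_mul n 1 labE; rewrite muln1 in h5.
  have h6 : n%:R * join_ent E 1 <= n%:R * e.
    by rewrite ler_wpM2l// (le_trans (join_ent1 _)).
  rewrite /join_ent in h1 h2 h3 h4 h5 h6 *; rewrite /Y in h1; lra.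
have c2 : n%:R^-1 * join_ent letter n + n%:R^-1 * join_ent letter k + e @[n --> \oo] --> l + 0 + e.
  apply: cvgD; last exact: cvg_cst.
  apply: cvgD => //; rewrite -[0](mul0r (join_ent letter k)); apply: cvgMl.
  exact: cvg_invn.
rewrite addr0 in c2; apply: ler_cvg_to ch c2 _; near=> n.
have n0 : 0 < n%:R :> R by rewrite ltr0n; near: n; exists 1%N.
have := ler_wpM2l (ltW (ltac:(by rewrite invr_gt0) : 0 < n%:R^-1 :> R)) (H n).
by rewrite !mulrDr mulrA mulVf ?gt_eqF// mul1r.
Unshelve. all: by end_near.
Qed.

(** The interface to entropy. The lower bound on block entropies feeds the construction of typical
    words, and the maximality clause bounds the entropy of a limit measure from below by means of
    blocks of fixed length. *)
Lemma entropy_spec : exists h : R, [/\ entropy mu = h%:E, 0 <= h,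
  forall n, n%:R * h <= ent (law mu (@prefix_tuple N n)) &
  forall c, (forall n, (0 < n)%N -> n%:R * c <= ent (law mu (@prefix_tuple N n))) -> c <= h].
Proof.
have ll := label_letter.
have [h [ch hle hge]] := fekete (fun n => join_ent_ge0 n ll) (fun n m => join_entD n m ll).
have E n : join_ent letter n = ent (law mu (@prefix_tuple N n)).
  by apply/eq_ent/eq_law => u; exact: itinerary_letter.
exists h; split.
- apply/eqP; rewrite eq_le; apply/andP; split.
    by apply: ge_ereal_sup => _ [m [xi [pxi ->]]]; rewrite lee_fin; exact: partition_entropy_le.
  apply: ereal_sup_ubound; exists N.+1, letter; split => //.
  congr EFin; apply/esym; apply: cvg_lim => //.
  by under eq_fun do rewrite join_entropyE.
- by apply: hge => n _; rewrite mulr0; exact: join_ent_ge0.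
- by move=> n; rewrite -E.
- by move=> c H; apply: hge => n n0; rewrite E H.
Qed.

End KolmogorovSinai.

(** * Typical words *)

Section ProductChebyshev.
Variables (R : realType) (B : finType) (p : B -> R) (dp : distr p).
Variable m : nat.
Implicit Types (w : {ffun 'I_m -> B}) (Y Z : B -> R).

Definition prod_weight w : R := \prod_i p (w i).

Lemma prod_weight_ge0 w : 0 <= prod_weight w.
Proof. by apply: prodr_ge0 => i _; exact: (proj1 dp). Qed.

Lemma sum_prod_weight : \sum_w prod_weight w = 1.
Proof.
rewrite /prod_weight -(bigA_distr_bigA (fun (_ : 'I_m) b => p b)) big1// => i _.
exact: (proj2 dp).
Qed.

Lemma prod_weight_cov Z i j : \sum_b p b * Z b = 0 ->
  \sum_w prod_weight w * (Z (w i) * Z (w j)) =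
  (i == j)%:R * \sum_b p b * Z b ^+ 2.
Proof.
move=> Z0.
(* Factors [Z] at the coordinates [i] and [j] and 1 elsewhere turn the sum into a product of sums;
   for [i != j] the factor at [i] is the mean 0. *)
pose F k b := p b * ((if k == i then Z b else 1) * (if k == j then Z b else 1)).
transitivity (\sum_(w : {ffun 'I_m -> B}) \prod_k F k (w k)).
  apply: eq_bigr => w _; rewrite /F !big_split/=; congr (_ * (_ * _)).
    by rewrite -big_mkcond big_pred1_eq.
  by rewrite -big_mkcond big_pred1_eq.
rewrite -(bigA_distr_bigA F) (bigD1 i)//=; under eq_bigr do rewrite /F eqxx.
have [ij|ij] := eqVneq i j.
  rewrite [X in _ * X]big1 ?mulr1 ?mul1r => [|k ki].
    by apply: eq_bigr => b _; rewrite expr2.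
  rewrite -[RHS](proj2 dp); apply: eq_bigr => b _.
  by rewrite /F -ij (negbTE ki) !mulr1.
by under eq_bigr do rewrite mulr1; rewrite Z0 !mul0r.
Qed.

Lemma prod_weight_var Z : \sum_b p b * Z b = 0 ->
  \sum_w prod_weight w * (\sum_i Z (w i)) ^+ 2 = m%:R * \sum_b p b * Z b ^+ 2.
Proof.
move=> Z0.
under eq_bigr do rewrite expr2 big_distrlr/= mulr_sumr.
rewrite exchange_big/= -[in RHS](card_ord m) mulr_natl -sumr_const; apply: eq_bigr => i _.
under eq_bigr do rewrite mulr_sumr.
rewrite exchange_big/= (bigD1 i)//= prod_weight_cov// eqxx mul1r.
rewrite [X in _ + X]big1 ?addr0// => j ji.
by rewrite prod_weight_cov// eq_sym (negbTE ji) mul0r.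
Qed.

(** The variance of the sum is [m] times that of one block. One factor [m] has been cancelled, and
    the rest is left multiplied out. *)
Lemma prod_weight_chebyshev Y (dl : R) : 0 < dl -> (0 < m)%N ->
  forall e, e = \sum_b p b * Y b ->
  \sum_(w : {ffun 'I_m -> B} | m%:R * dl < `|\sum_i Y (w i) - m%:R * e|) prod_weight w * (m%:R * dl ^+ 2)
    <= \sum_b p b * (Y b - e) ^+ 2.
Proof.
move=> d0 m0 e eE; pose Z b := Y b - e.
have Z0 : \sum_b p b * Z b = 0.
  under eq_bigr do rewrite mulrBr.
  by rewrite sumrB -mulr_suml (proj2 dp) mul1r eE subrr.
have ZY w : \sum_i Z (w i) = \sum_i Y (w i) - m%:R * e.
  by rewrite sumrB sumr_const card_ord mulr_natl.
have mR : 0 < m%:R :> R by rewrite ltr0n.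
rewrite -(ler_pM2l mR) -(prod_weight_var Z0) mulr_sumr [leRHS](bigID (fun w : {ffun 'I_m -> B} => m%:R * dl < `|\sum_i Y (w i) - m%:R * e|))/=.
rewrite ler_wpDr//.
  by apply: sumr_ge0 => w _; rewrite mulr_ge0 ?prod_weight_ge0 ?sqr_ge0.
apply: ler_sum => w hw; rewrite mulrCA ler_wpM2l ?prod_weight_ge0//.
rewrite mulrA -expr2 -exprMn ZY -[leRHS]real_normK ?num_real//.
by rewrite ler_pXn2r ?nnegrE ?mulr_ge0 ?(ltW d0)// ltW.
Qed.

End ProductChebyshev.

Section TypicalWords.
Variables (R : realType) (N : nat) (gamma : R).
Hypothesis gamma01 : 0 < gamma < 1.
Local Notation T := (borel_code N gamma).
Local Notation shift := (@Defs.shift N).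
Local Notation letters := 'I_N.+1.

Lemma holder_comp_shift (g : code_space N -> R) : holder_code g -> holder_code (g \o shift).
Proof.
move=> [c c0 [rho /andP[r0 r1] H]].
have c0' : 0 <= c / rho by rewrite divr_ge0// ltW.
exists (c / rho) => //; exists rho; first by rewrite r0.
move=> [|n] u v uv.
  rewrite expr0 mulr1; apply: (le_trans (H 0%N _ _ _)) => //.
  by rewrite expr0 mulr1 ler_pdivlMr// ler_piMr// ltW.
rewrite exprS mulrA divfK ?gt_eqF//; apply: H.
exact: (agree_shift (k:=1)).
Qed.

Lemma holder_add (g g' : code_space N -> R) : holder_code g -> holder_code g' ->
  holder_code (fun u => g u + g' u).
Proof.
move=> [c c0 [rho /andP[r0 r1] H]] [c' c'0 [rho' /andP[r'0 r'1] H']].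
exists (c + c'); first by rewrite addr_ge0.
exists (Num.max rho rho'); first by rewrite lt_max r0 gt_max r1.
move=> n u v uv; rewrite opprD addrACA (le_trans (ler_normD _ _))// mulrDl.
apply: lerD; [apply: le_trans (H _ _ _ uv) _|apply: le_trans (H' _ _ _ uv) _];
  rewrite ler_wpM2l// lerXn2r ?nnegrE ?le_max ?lexx ?orbT ?(ltW r0) ?(ltW r'0)//.
Qed.

Lemma holder_iter_shift (g : code_space N -> R) k : holder_code g -> holder_code (g \o iter k shift).
Proof.
elim: k g => // k IH g hg.
have -> : g \o iter k.+1 shift = (g \o shift) \o iter k shift.
  by apply/funext => u; rewrite /= -iterS.
exact/IH/holder_comp_shift.
Qed.

Lemma holder_birkhoff (g : code_space N -> R) n : holder_code g -> holder_code (birkhoff_sum g n).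
Proof.
move=> hg; elim: n => [|n IH].
  exists 0 => //; exists (1/2); first lra.
  by move=> n u v _; rewrite !birkhoff0 subrr normr0 mul0r.
have -> : birkhoff_sum g n.+1 = fun u => birkhoff_sum g n u + (g \o iter n shift) u.
  by apply/funext => u; rewrite birkhoffSr.
by apply: holder_add => //; exact: holder_iter_shift.
Qed.

Variable mu : probability T R.
Hypothesis mu_inv : shift_invariant mu.

(** Both integrals are close to the same finite sum, because a prefix and the shifted prefix have
    the same law. *)
Lemma Rintegral_iter_shift (g : T -> R) k : holder_code g ->
  \int[mu]_u g (iter k shift u) = \int[mu]_u g u.
Proof.
move=> hg; have [c c0 [rho rho01 H]] := hg.
have hgk := holder_iter_shift k hg.
have key n : `|\int[mu]_u g (iter k shift u) - \int[mu]_u g u| <= 2 * (c * rho ^+ n).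
  pose s := \sum_w law mu (@prefix_tuple N n) w * g (ext w).
  have h1 := Rintegral_holder gamma01 mu hg H n.
  have lp := label_prefix (gamma := gamma) gamma01 (k := n).
  have h2 : `|\int[mu]_u g (iter k shift u) - s| <= c * rho ^+ n.
    have -> : s = \sum_w law mu (@prefix_tuple N n \o iter k shift) w * g (ext w).
      by apply: eq_bigr => w _; rewrite law_iter_shift.
    apply: (Rintegral_close_label (F := fun w : n.-tuple _ => g (ext w))).
    - exact: label_iter_shift.
    - exact: (integrable_holder gamma01 mu hgk).
    - by move=> u; apply: H; apply/agree_sym; exact: agree_ext_prefix.
  have h3 : `|\int[mu]_u g u - s| <= c * rho ^+ n.
    by rewrite /s; under eq_bigr do rewrite law_prefix.
  move: h2 h3; rewrite !ler_norml; lra.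
apply/eqP; rewrite -subr_eq0 -normr_eq0 eq_le normr_ge0 andbT.
apply/ler_addgt0Pr => e e0; rewrite add0r.
have [n hn] := expr_small rho01 (ltac:(rewrite divr_gt0 ?ltr_wpDl ?mulr_ge0//) : 0 < e / (2 * c + 1)).
apply: le_trans (key n) _; rewrite mulrA.
have r0 : 0 <= rho ^+ n by case/andP: rho01 => ? ?; rewrite exprn_ge0// ltW.
move: hn; rewrite ltr_pdivlMr ?ltr_wpDl ?mulr_ge0//; nra.
Qed.

Lemma Rintegral_birkhoff (g : T -> R) n : holder_code g ->
  \int[mu]_u birkhoff_sum g n u = n%:R * \int[mu]_u g u.
Proof.
move=> hg; elim: n => [|n IH].
  rewrite mul0r (@eq_Rintegral _ _ _ _ _ (cst 0)) ?Rintegral_cst ?mul0r//.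
  by move=> u _; rewrite birkhoff0.
rewrite (@eq_Rintegral _ _ _ _ _ (fun u : T => birkhoff_sum g n u + g (iter n shift u))); last first.
  by move=> u _; rewrite birkhoffSr.
rewrite RintegralD//; first by rewrite IH Rintegral_iter_shift// -natr1 mulrDl mul1r.
  exact/integrable_holder/holder_birkhoff.
exact: (integrable_holder gamma01 mu (holder_iter_shift n hg)).
Qed.

(** The error does not grow with [n], so that it is negligible per letter for long blocks. *)
Lemma block_mean (g : T -> R) (D : R) n : holder_code g ->
  (forall u v, agree n u v -> `|birkhoff_sum g n u - birkhoff_sum g n v| <= D) ->
  `|n%:R * \int[mu]_u g u -
    \sum_w law mu (@prefix_tuple N n) w * birkhoff_sum g n (ext w)| <= D.
Proof.
move=> hg H; rewrite -Rintegral_birkhoff//.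
apply: (Rintegral_close_label (F := fun w : n.-tuple _ => birkhoff_sum g n (ext w))).
- exact: label_prefix.
- exact/integrable_holder/holder_birkhoff.
- by move=> u; apply: H; apply/agree_sym; exact: agree_ext_prefix.
Qed.

Section Blocks.
Variables (n : nat) (n0 : (0 < n)%N).
Local Notation block := (n.-tuple letters).

(** Positions after the last block carry [ord0]; they fill up lengths that are not multiples of
    [n]. *)
Definition glue_blocks m (w : {ffun 'I_m -> block}) : code_space N := fun k =>
  if insub (k %/ n)%N is Some i then nth ord0 (w i) (k %% n)%N else ord0.

Lemma agree_glue_blocks m (w : {ffun 'I_m -> block}) (i : 'I_m) :
  agree n (iter (i * n) shift (glue_blocks w)) (ext (w i)).
Proof.
move=> k kn; rewrite iter_shiftE /glue_blocks divnMDl// divn_small// addn0 modnMDl modn_small//.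
by rewrite valK.
Qed.

Lemma glue_blocks_inj m L (w w' : {ffun 'I_m -> block}) : (m * n <= L)%N ->
  agree L (glue_blocks w) (glue_blocks w') -> w = w'.
Proof.
move=> mL ag; apply/ffunP => i; apply: val_inj; apply: (@eq_from_nth _ ord0).
  by rewrite !size_tuple.
move=> k; rewrite size_tuple => kn.
rewrite -[LHS](agree_glue_blocks w i)// -[RHS](agree_glue_blocks w' i)// !iter_shiftE ag//.
apply: leq_trans mL; apply: (@leq_trans (i * n + n)); first by rewrite ltn_add2l.
by rewrite -mulSnr leq_mul2r ltn_ord orbT.
Qed.

Lemma birkhoff_glue_blocks (g : T -> R) (D : R) m (w : {ffun 'I_m -> block}) :
  (forall u v, agree n u v -> `|birkhoff_sum g n u - birkhoff_sum g n v| <= D) ->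
  `|birkhoff_sum g (m * n) (glue_blocks w) - \sum_i birkhoff_sum g n (ext (w i))| <= m%:R * D.
Proof.
move=> H.
have -> : birkhoff_sum g (m * n) (glue_blocks w) =
    \sum_(i < m) birkhoff_sum g n (iter (i * n) shift (glue_blocks w)).
  elim: m {w} (glue_blocks w) => [|m IH] u; first by rewrite mul0n birkhoff0 big_ord0.
  by rewrite mulSnr birkhoffD IH big_ord_recr.
rewrite -sumrB (le_trans (ler_norm_sum _ _ _))//.
rewrite (@le_trans _ _ (\sum_(i < m) D))//; last by rewrite sumr_const card_ord mulr_natl.
by apply: ler_sum => i _; apply: H; exact: agree_glue_blocks.
Qed.

End Blocks.

End TypicalWords.

(* Cut words of length [L] into [m] blocks of length [n]. Chebyshev's inequality
   for [m] independent blocks with law [p] makes the block sums of [f], of [g]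
   and of [- ln p] concentrate simultaneously. *)
Lemma typical_words (R : realType) (N : nat) (gamma : R) (gamma01 : 0 < gamma < 1)
  (mu : probability (borel_code N gamma) R) (mu_inv : shift_invariant mu)
  (f g : code_space N -> R) (h e : R) :
  holder_code f -> holder_code g -> 0 <= h ->
  (forall n, n%:R * h <= ent (law mu (@prefix_tuple N n))) -> 0 < e ->
  exists L0, forall L, (L0 <= L)%N -> exists W : {set L.-tuple 'I_N.+1},
    (forall (w : L.-tuple 'I_N.+1) u, w \in W -> cylinder w u ->
      `|birkhoff_sum f L u - L%:R * \int[mu]_u f u| <= L%:R * e /\
      `|birkhoff_sum g L u - L%:R * \int[mu]_u g u| <= L%:R * e) /\
    expR (L%:R * (h - e)) <= #|W|%:R.
Proof.
move=> hf hg h0 hent e0.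
have [Df Df0 HDf] := holder_distortion hf; have [Dg Dg0 HDg] := holder_distortion hg.
have [Mf Mf0 HMf] := holder_bounded hf; have [Mg Mg0 HMg] := holder_bounded hg.
pose D := Df + Dg; pose M := Mf + Mg.
(* Blocks so long that [m] block distortions amount to at most [L * e / 12]. *)
pose n := (Num.trunc (12 * D / e)).+1.
have n0 : (0 < n)%N by [].
have nD : 12 * D <= n%:R * e by rewrite -ler_pdivrMr// ltW// truncnS_gt.
have nR : 0 < n%:R :> R by rewrite ltr0n.
pose dl := n%:R * e / 4.
have dl0 : 0 < dl by rewrite !mulr_gt0.
pose p := law mu (@prefix_tuple N n).
have dp : distr p by apply: distr_law; exact: label_prefix.
pose Y1 (b : n.-tuple 'I_N.+1) := birkhoff_sum f n (ext b).
pose Y2 (b : n.-tuple 'I_N.+1) := birkhoff_sum g n (ext b).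
pose Y3 (b : n.-tuple 'I_N.+1) := - ln (p b).
pose mean (Y : n.-tuple 'I_N.+1 -> R) := \sum_b p b * Y b.
pose V Y := \sum_b p b * (Y b - mean Y) ^+ 2.
have V0 Y : 0 <= V Y by apply: sumr_ge0 => b _; rewrite mulr_ge0 ?sqr_ge0// (proj1 dp).
(* Enough blocks for the three exceptional events to have total weight at most 1/2. *)
pose m0 := (Num.trunc ((2 * (V Y1 + V Y2 + V Y3) + 1) / dl ^+ 2)).+1.
(* The first summand absorbs the incomplete last block in the Birkhoff sums. The second absorbs the
   entropy [n * h] of that block and the loss of half the weight in the count. *)
pose L1 := (Num.trunc ((8 * (n%:R * M) + 2 * (1 + n%:R * h)) / e)).+1.
exists (m0 * n + L1)%N => L hL; pose m := (L %/ n)%N.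
have mm0 : (m0 <= m)%N by rewrite leq_divRL// (leq_trans _ hL)// leq_addr.
have m1 : (0 < m)%N by exact: leq_trans mm0.
have mR : 0 < m%:R :> R by rewrite ltr0n.
have hV : 2 * (V Y1 + V Y2 + V Y3) < m%:R * dl ^+ 2.
  have : (2 * (V Y1 + V Y2 + V Y3) + 1) / dl ^+ 2 < m%:R.
    by rewrite (lt_le_trans (truncnS_gt _))// ler_nat.
  rewrite ltr_pdivrMr ?exprn_gt0//; lra.
have Le : 8 * (n%:R * M) + 2 * (1 + n%:R * h) <= L%:R * e.
  rewrite -ler_pdivrMr// ltW// (lt_le_trans (truncnS_gt _))// ler_nat.
  by rewrite (leq_trans _ hL)// leq_addl.
have mnL : (m * n <= L)%N by rewrite leq_trunc_div.
have mnLR : m%:R * n%:R <= L%:R :> R by rewrite -natrM ler_nat.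
have Lmn : L%:R <= m%:R * n%:R + n%:R :> R.
  by rewrite -natrM -natrD ler_nat -mulSnr ltnW// ltn_ceil.
have M0 : 0 <= M by rewrite addr_ge0 ?ltW.
pose q := prod_weight (B := n.-tuple 'I_N.+1) p (m := m).
have q0 w : 0 <= q w by exact: prod_weight_ge0.
pose bad Y (w : {ffun 'I_m -> n.-tuple 'I_N.+1}) := m%:R * dl < `|\sum_i Y (w i) - m%:R * mean Y|.
(* Positive weight is required because [ln 0 = 0] makes [Y3] meaningless on blocks of mass 0. *)
pose G := [set w | [&& ~~ bad Y1 w, ~~ bad Y2 w, ~~ bad Y3 w & 0 < q w]]%SET.
have qG : 1 / 2 <= \sum_(w in G) q w.
  have hb Y : \sum_(w | bad Y w) q w * (m%:R * dl ^+ 2) <= V Y by exact: prod_weight_chebyshev.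
  have hs : 1 <= \sum_(w in G) q w + \sum_(w | bad Y1 w) q w +
      \sum_(w | bad Y2 w) q w + \sum_(w | bad Y3 w) q w.
    rewrite -(sum_prod_weight dp m) !(big_mkcond (fun w => bad _ w)) (big_mkcond (mem G))/=.
    rewrite -!big_split/=; apply: ler_sum => w _; rewrite -/(q w) inE.
    have := q0 w; move: (q w) (bad Y1 w) (bad Y2 w) (bad Y3 w) => z b1 b2 b3 z0; clear - z0.
    by case: b1; case: b2; case: b3 => /=; try lra; case: ltP => ?; lra.
  have c0 : 0 < m%:R * dl ^+ 2 by rewrite mulr_gt0 ?exprn_gt0.
  have hb1 := hb Y1; have hb2 := hb Y2; have hb3 := hb Y3.
  rewrite -mulr_suml in hb1; rewrite -mulr_suml in hb2; rewrite -mulr_suml in hb3.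
  rewrite leNgt; apply/negP => lt.
  have : 1 / 2 < \sum_(w | bad Y1 w) q w + \sum_(w | bad Y2 w) q w + \sum_(w | bad Y3 w) q w.
    by clear - hs lt; lra.
  rewrite -(ltr_pM2r c0) !mulrDl; lra.
(* The mean of [Y3] is the block entropy, so a good word has weight at most about
   [expR (- (m * n * h))]; total weight at least 1/2 then forces many words. *)
have qle w : w \in G -> q w <= expR (- (m%:R * (mean Y3 - dl))).
  rewrite inE => /and4P[_ _ nb qw].
  have -> : q w = expR (- \sum_i Y3 (w i)).
    rewrite -sumrN expR_sum /q /prod_weight; apply: eq_bigr => i _.
    rewrite /Y3 opprK lnK// posrE lt_neqAle (proj1 dp) andbT eq_sym.
    apply/eqP => pw; move: qw; rewrite /q /prod_weight (bigD1 i)//= pw mul0r ltxx//.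
  rewrite ler_expR lerN2; move: nb; rewrite /bad -leNgt ler_norml mulrBr; lra.
have mean3 : n%:R * h <= mean Y3.
  rewrite (le_trans (hent n))// le_eqVlt; apply/orP; left; apply/eqP.
  by apply: eq_bigr => b _; rewrite /Y3 mulrN.
pose enc (w : {ffun 'I_m -> n.-tuple 'I_N.+1}) := @prefix_tuple N L (@glue_blocks N n m w).
have enc_inj : injective enc.
  by move=> w w' /agree_prefix/(glue_blocks_inj n0 mnL).
exists (enc @: G); split; last first.
  rewrite card_imset//.
  have : 1 / 2 <= #|G|%:R * expR (- (m%:R * (mean Y3 - dl))).
    rewrite (le_trans qG)// (le_trans (ler_sum _ qle))//.
    by rewrite sumr_const -[leLHS]mulr_natl.
  rewrite expRN ler_pdivlMr ?expR_gt0// => hG; apply: le_trans hG.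
  rewrite (@le_trans _ _ (expR (- 1) * expR (m%:R * (mean Y3 - dl))))//; last first.
    rewrite ler_wpM2r ?expR_ge0// expRN div1r lef_pV2 ?posrE ?expR_gt0//.
    by have := expR_ge1Dx (1 : R).
  rewrite -expRD ler_expR.
  have h1 : m%:R * (n%:R * h) <= m%:R * mean Y3 by rewrite ler_wpM2l// ltW.
  have h2 : L%:R * h <= m%:R * (n%:R * h) + n%:R * h by rewrite mulrA -mulrDl ler_wpM2r.
  have h3 : m%:R * dl <= L%:R * e / 4.
    by rewrite /dl !mulrA ler_wpM2r// ler_wpM2r// ltW.
  have h4 : 0 <= n%:R * M by rewrite mulr_ge0.
have h5 : 0 <= n%:R * h by rewrite mulr_ge0.
  move: h1 h2 h3 h4 h5 Le; rewrite !mulrBr.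
  move: (m%:R * mean Y3) (m%:R * (n%:R * h)) (n%:R * h) (m%:R * dl) (n%:R * M)
    (L%:R * h) (L%:R * e) => x1 x2 x3 x4 x5 x6 x7; clear; lra.
(* Error budget in units of [L * e]: three distortion terms of 1/12, two terms of 1/8 for the
   incomplete block and 1/4 from Chebyshev, in total 3/4. *)
have main (g' : borel_code N gamma -> R) (D' M' : R) : holder_code g' -> 0 < D' -> D' <= D -> 0 < M' -> M' <= M ->
    (forall n u v, agree n u v -> `|birkhoff_sum g' n u - birkhoff_sum g' n v| <= D') ->
    (forall u, `|g' u| <= M') ->
    let Y (b : n.-tuple 'I_N.+1) := birkhoff_sum g' n (ext b) in
    forall w u, ~~ bad Y w -> cylinder (enc w) u ->
    `|birkhoff_sum g' L u - L%:R * \int[mu]_u g' u| <= L%:R * e.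
  move=> hg' D'0 D'D M'0 M'M HD HM Y w u nb cu.
  have a1 : `|birkhoff_sum g' L u - birkhoff_sum g' L (@glue_blocks N n m w)| <= D'.
    apply: HD; apply: (agree_trans (v := ext (enc w))).
      by have := @cylinder_agree _ _ u _ cu (@cylinder_ext _ (enc w)); rewrite size_tuple.
    exact: agree_ext_prefix.
  have a2 : `|birkhoff_sum g' L (@glue_blocks N n m w) - birkhoff_sum g' (m * n) (@glue_blocks N n m w)| <= n%:R * M'.
    rewrite {1}(divn_eq L n) birkhoffD [X in `|X|]addrC addKr.
    rewrite (le_trans (birkhoff_bound _ _ HM))// mulrC ler_wpM2r ?(ltW M'0)//.
    by rewrite ler_nat ltnW// ltn_mod.
  have a3 := birkhoff_glue_blocks n0 (m := m) (g := g') w (HD n).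
  have a4 : `|\sum_i Y (w i) - m%:R * mean Y| <= m%:R * dl by rewrite leNgt.
  have a5 := block_mean gamma01 mu_inv (n := n) hg' (HD n).
  rewrite -/p -/(mean Y) in a5.
  have a6 : `|\int[mu]_u g' u| <= M'.
    have := Rintegral_close_label (X := (@prefix_tuple N 0 : borel_code N gamma -> _)) (F := fun=> 0) (e := M')
      (label_prefix (k := 0) gamma01) (integrable_holder gamma01 mu hg').
    rewrite big1 ?subr0 => [|? _]; last by rewrite mulr0.
    by apply=> v; rewrite subr0.
  have a5' : `|m%:R * (n%:R * \int[mu]_u g' u) - m%:R * mean Y| <= m%:R * D'.
    by rewrite -mulrBr normrM gtr0_norm// ler_wpM2l// ltW.
  have a7 : `|m%:R * (n%:R * \int[mu]_u g' u) - L%:R * \int[mu]_u g' u| <= n%:R * M'.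
    rewrite mulrA -mulrBl normrM ler_pM// distrC ger0_norm ?subr_ge0//.
    by clear - Lmn; lra.
  have b1 : m%:R * D' <= L%:R * e / 12.
    have : m%:R * D' <= m%:R * (n%:R * e / 12) by rewrite ler_wpM2l ?(ltW mR)//; clear - D'D nD; lra.
    have : m%:R * n%:R * e <= L%:R * e by rewrite ler_wpM2r// ltW.
    by clear; lra.
  have b2 : m%:R * dl <= L%:R * e / 4.
    by rewrite /dl !mulrA ler_wpM2r// ler_wpM2r// ltW.
  have b3 : n%:R * M' <= L%:R * e / 8.
    have : n%:R * M' <= n%:R * M by rewrite ler_wpM2l// ltW.
    have : 0 <= n%:R * h by rewrite mulr_ge0.
    by clear - Le; lra.
  have b4 : D' <= m%:R * D' by rewrite ler_peMl ?ler1n// ltW.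
  rewrite -/Y in a3.
  set I := \int[mu]_u g' u in a5' a7 *; set A := birkhoff_sum g' L u in a1 *.
  set B := birkhoff_sum g' L _ in a1 a2; set C := birkhoff_sum g' (m * n) _ in a2 a3.
  have Ledeco : 0 < L%:R * e / 12 by apply: lt_le_trans b1; rewrite mulr_gt0.
  move: a1 a2 a3 a4 a5' a7 b1 b2 b3 b4 Ledeco; rewrite !ler_norml.
  move: (m%:R * (n%:R * I)) (L%:R * I) (m%:R * dl) (m%:R * D') (n%:R * M') (L%:R * e)
    (m%:R * mean Y) (\sum_i Y (w i)) A B C => x1 x2 x3 x4 x5 x6 x7 x8 x9 x10 x11.
  by clear; lra.
move=> w' u /imsetP[w + ->]; rewrite inE => /and4P[n1 n2 _ _] cu; split.
- by apply: (main f Df Mf) cu => //; rewrite ?/D ?/M lerDl ltW.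
- by apply: (main g Dg Mg) cu => //; rewrite ?/D ?/M lerDr ltW.
Qed.

(** * Invariant measures from growing orbit sums *)

Lemma cvg_fin_sum (R : realType) (F : set_system nat) {FF : Filter F} (I : finType)
    (x : I -> nat -> R) (l : I -> R) : (forall i, x i j @[j --> F] --> l i) ->
  \sum_i x i j @[j --> F] --> \sum_i l i.
Proof.
move=> H.
have -> : (fun j => \sum_i x i j) = \sum_i x i by apply/funext => j; rewrite fct_sumE.
elim/big_ind2: _ => [|u a v b cu cv|i _]; [exact: cvg_cst|exact: cvgD|exact: H].
Qed.

Section UltraLimit.
Variables (R : realType) (U : set_system nat).
Context {UU : UltraFilter U}.

(** Along an ultrafilter all cylinder masses and all integrals converge at once, without a diagonal
    argument. *)
Lemma ultra_bounded_cvg (x : nat -> R) (M : R) : (forall n, `|x n| <= M) ->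
  exists l : R, x @ U --> l.
Proof.
move=> xM.
have cM : compact `[- M, M]%classic by exact: segment_compact.
have [|l [_ cl]] := cM (x @ U) _.
  have : U (x @^-1` `[- M, M]%classic).
    by apply: (@filterS _ U _ setT) filterT => n _ /=; rewrite in_itv/= -ler_norml.
  by [].
exists l => B nB.
have [//|nU] := in_ultra_setVsetC (x @^-1` B) UU.
by have [y []] := cl (~` B) B nU nB.
Qed.

End UltraLimit.

Section InvariantMeasureConstruction.
Variables (R : realType) (N : nat) (gamma : R).
Hypothesis gamma01 : 0 < gamma < 1.
Local Notation T := (borel_code N gamma).
Local Notation shift := (@Defs.shift N).
Local Notation letters := 'I_N.+1.
Implicit Types (phi psi : code_space N -> R).

Definition cyl_ind (v : seq letters) (u : code_space N) : R := (`[< cylinder v u >])%:R.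

Lemma cyl_ind_rcons v u : cyl_ind v u = \sum_a cyl_ind (rcons v a) u.
Proof.
rewrite /cyl_ind; case: asboolP => [vu|vu].
  rewrite (bigD1 (u (size v)))//= asboolT; last exact/cylinder_rcons.
  rewrite big1 ?addr0// => a ua; rewrite asboolF// => /cylinder_rcons[_ e].
  by rewrite e eqxx in ua.
by rewrite big1// => a _; rewrite asboolF// => /cylinder_rcons[].
Qed.

Lemma cylinder_cons v a u : cylinder (a :: v) u <-> u 0%N = a /\ cylinder v (shift u).
Proof.
split=> [H|[ua H] [|k] kv//=]; last exact: H.
by split => [|k kv]; [exact: (H 0%N)|exact: (H k.+1)].
Qed.

Lemma cyl_ind_cons v u : cyl_ind v (shift u) = \sum_a cyl_ind (a :: v) u.
Proof.
rewrite /cyl_ind; case: asboolP => [vu|vu].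
  rewrite (bigD1 (u 0%N))//= asboolT; last exact/cylinder_cons.
  rewrite big1 ?addr0// => a ua; rewrite asboolF// => /cylinder_cons[e _].
  by rewrite e eqxx in ua.
by rewrite big1// => a _; rewrite asboolF// => /cylinder_cons[].
Qed.

Lemma cyl_ind_prefix k (v : k.-tuple letters) u :
  cyl_ind v u = (prefix_tuple k u == v)%:R.
Proof.
rewrite /cyl_ind; congr (nat_of_bool _)%:R; apply/asboolP/eqP => [/cylinderP|<-].
  by rewrite size_tuple => e; apply: val_inj; rewrite prefix_tupleE.
by apply/cylinderP; rewrite size_tuple prefix_tupleE.
Qed.

Lemma sum_cyl_ind k (F : k.-tuple letters -> R) u :
  \sum_(v : k.-tuple letters) F v * cyl_ind v u = F (prefix_tuple k u).
Proof.
rewrite (bigD1 (prefix_tuple k u))// cyl_ind_prefix eqxx mulr1 big1 => [|v]; first exact: addr0.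
by rewrite cyl_ind_prefix eq_sym => /negbTE ->; rewrite mulr0.
Qed.

(* Invariant means on all functions: averages over periodic orbits are of this
   kind, so that a measure on the Borel sets is only built in the limit. *)
Definition mean_functional (E : (code_space N -> R) -> R) : Prop :=
  [/\ forall (I : finType) (a : I -> R) (phi : I -> code_space N -> R),
        E (fun u => \sum_i a i * phi i u) = \sum_i a i * E (phi i),
      forall phi psi, (forall u, phi u <= psi u) -> E phi <= E psi,
      forall c : R, E (fun=> c) = c &
      forall phi, E (phi \o shift) = E phi].

Section MeanFunctional.
Variables (E : (code_space N -> R) -> R) (mE : mean_functional E).

Lemma mean_functional_sum (I : finType) (phi : I -> code_space N -> R) :
  E (fun u => \sum_i phi i u) = \sum_i E (phi i).
Proof.
have [l _ _ _] := mE.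
transitivity (E (fun u => \sum_i 1 * phi i u)).
  by congr E; apply/funext => u; apply: eq_bigr => i _; rewrite mul1r.
by rewrite l; apply: eq_bigr => i _; rewrite mul1r.
Qed.

Lemma mean_functional_close phi psi (e : R) :
  (forall u, `|phi u - psi u| <= e) -> `|E phi - E psi| <= e.
Proof.
have [l m c _] := mE.
have aux phi' psi' : (forall u, phi' u <= psi' u + e) -> E phi' <= E psi' + e.
  move=> H; apply: le_trans (m _ _ H) _.
  have := l bool (fun=> 1) (fun b => if b then psi' else fun=> e).
  rewrite big_bool/= !mul1r c => <-.
  by apply: m => u; rewrite big_bool/= !mul1r.
move=> H; rewrite ler_norml; apply/andP; split.
  by have := aux psi phi (fun u => ltac:(have := H u; rewrite ler_norml; lra)); lra.
by have := aux phi psi (fun u => ltac:(have := H u; rewrite ler_norml; lra)); lra.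
Qed.

Lemma mean_functional_bound phi (M : R) : (forall u, `|phi u| <= M) -> `|E phi| <= M.
Proof.
move=> H; have := @mean_functional_close phi (fun=> 0) M.
by have [_ _ -> _] := mE; rewrite subr0; apply=> u; rewrite subr0.
Qed.

Lemma mean_functional_holder (g : code_space N -> R) (c rho : R) :
  (forall n u v, agree n u v -> `|g u - g v| <= c * rho ^+ n) ->
  forall k, `|E g - \sum_(v : k.-tuple letters) g (ext v) * E (cyl_ind v)| <= c * rho ^+ k.
Proof.
move=> H k; have [l _ _ _] := mE.
rewrite -(l _ (fun v : k.-tuple letters => g (ext v)) (fun v => cyl_ind v)).
apply: mean_functional_close => u; rewrite (sum_cyl_ind (fun v => g (ext v))).
by apply: H; apply/agree_sym; exact: agree_ext_prefix.
Qed.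

Lemma mean_functional_cyl_ge0 v : 0 <= E (cyl_ind v).
Proof. by have [_ m c _] := mE; rewrite -[0]c; apply: m => u; rewrite ler0n. Qed.

Lemma mean_functional_cyl_le1 v : E (cyl_ind v) <= 1.
Proof. by have [_ m c _] := mE; rewrite -[leRHS]c; apply: m => u; rewrite lern1 leq_b1. Qed.

End MeanFunctional.

(** The limits of the cylinder masses are consistent and thus define a measure. Integrals converge
    since a Hölder function is a combination of cylinder indicators up to an error uniform in
    [j]. *)
Lemma limit_of_mean_functionals (U : set_system nat) {UU : UltraFilter U}
    (E : nat -> (code_space N -> R) -> R) : (forall j, mean_functional (E j)) ->
  exists mu : probability T R, [/\ shift_invariant mu,
    forall v, E j (cyl_ind v) @[j --> U] --> fine (mu (cylinder v)) &
    forall g, holder_code g -> E j g @[j --> U] --> \int[mu]_u g u].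
Proof.
move=> mE.
have cv v : exists l : R, E j (cyl_ind v) @[j --> U] --> l.
  apply: (ultra_bounded_cvg (M := 1)) => j.
  by rewrite ger0_norm ?mean_functional_cyl_le1 ?mean_functional_cyl_ge0.
have [m hm] := choice cv.
have m0 v : 0 <= m v.
  apply: (@closed_cvg _ _ U _ (fun j => E j (cyl_ind v)) [set y : R | 0 <= y]) (hm v).
    exact: closed_ge.
  by apply: nearW => j; exact: mean_functional_cyl_ge0.
have m1 : m [::] = 1.
  apply: (cvg_unique _ (hm [::])) => //.
  have -> : (fun j => E j (cyl_ind [::])) = fun=> 1 by
    apply/funext => j; have [_ _ c _] := mE j; rewrite -[RHS]c; congr (E j); apply/funext => u;
    rewrite /cyl_ind asboolT.
  exact: cvg_cst.
have mr v : m v = \sum_a m (rcons v a).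
  apply: (cvg_unique _ (hm v)) => //.
  have -> : (fun j => E j (cyl_ind v)) = fun j => \sum_a E j (cyl_ind (rcons v a)).
    apply/funext => j; rewrite -(mean_functional_sum (mE j)); congr (E j).
    by apply/funext => u; exact: cyl_ind_rcons.
  exact: (cvg_fin_sum (fun a => hm (rcons v a))).
have [mu hmu] := exists_code_measure gamma01 m1 m0 mr.
have hmu' v : fine (mu (cylinder v)) = m v by rewrite hmu.
exists mu; split; last 2 first.
- by move=> v; rewrite hmu'; exact: hm.
- move=> g hg; have [M M0 HM] := holder_bounded hg.
  have [l hl] := ultra_bounded_cvg (fun j => mean_functional_bound (mE j) HM).
  suff -> : \int[mu]_u g u = l by [].
  have [c c0 [rho rho01 H]] := hg.
  have key k : `|\int[mu]_u g u - l| <= 2 * (c * rho ^+ k).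
    pose s := \sum_(v : k.-tuple letters) g (ext v) * m v.
    have h1 : `|\int[mu]_u g u - s| <= c * rho ^+ k.
      have := Rintegral_holder gamma01 mu hg H k; congr (`|_ - _| <= _).
      by apply: eq_bigr => v _; rewrite hmu' mulrC.
    have h2 : `|l - s| <= c * rho ^+ k.
      have cs : E j g - \sum_(v : k.-tuple letters) g (ext v) * E j (cyl_ind v) @[j --> U] --> l - s.
        apply: cvgB => //.
        have cv' (v : k.-tuple letters) : g (ext v) * E j (cyl_ind v) @[j --> U] --> g (ext v) * m v.
          by apply: cvgMr; exact: hm.
        exact: (cvg_fin_sum cv').
      apply: (@closed_cvg _ _ U _ _ [set y : R | y <= c * rho ^+ k]) (cvg_norm cs).
        exact: closed_le.
      by apply: nearW => j; exact: mean_functional_holder.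
    move: h1 h2; rewrite !ler_norml; lra.
  apply/eqP; rewrite -subr_eq0 -normr_eq0 eq_le normr_ge0 andbT.
  apply/ler_addgt0Pr => e e0; rewrite add0r.
  have [k hk] := expr_small rho01 (ltac:(rewrite divr_gt0 ?ltr_wpDl ?mulr_ge0//) : 0 < e / (2 * c + 1)).
  apply: le_trans (key k) _; rewrite mulrA.
  have r0 : 0 <= rho ^+ k by case/andP: rho01 => ? ?; rewrite exprn_ge0// ltW.
  move: hk; rewrite ltr_pdivlMr ?ltr_wpDl ?mulr_ge0//; nra.
(* Invariance is tested on cylinders: the preimage of the cylinder of [v] is the disjoint union of
   those of [a :: v], and the functionals are invariant. *)
have mS := @measurable_shift R N gamma gamma01.
pose mu1 := HB.pack_for {measure set T -> \bar R} (pushforward mu (shift : T -> T)).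
pose mu2 : {measure set T -> \bar R} := mu1 mS.
have mu21 : mu2 setT = 1%E by rewrite -(probability_setT mu).
pose mu3 := HB.pack_for (probability T R) (pushforward mu (shift : T -> T))
  (Measure_isProbability.Build _ _ _ mu2 mu21).
apply: (prob_ext gamma01 (mu := mu3 mS)) => v.
rewrite -[LHS]/(mu (shift @^-1` cylinder v)) hmu.
have -> : shift @^-1` cylinder v = \bigcup_(a in [set: letters]) cylinder (a :: v).
  apply/seteqP; split => [u vu|u [a _ /cylinder_cons[]//]].
  by exists (u 0%N) => //; exact/cylinder_cons.
rewrite measure_fin_bigcup; last 3 first.
- exact: finite_finset.
- apply/trivIsetP => a b _ _ /eqP ab; apply/seteqP; split => // u.
  by move=> [/cylinder_cons[ua _] /cylinder_cons[ub _]]; apply: ab; rewrite -ua -ub.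
- by move=> a _; exact: measurable_cylinder.
rewrite (fsbigE (index_enum letters)) ?index_enum_uniq//=; last first.
  by move=> a _; rewrite mem_index_enum.
rewrite (eq_big xpredT (fun a => (m (a :: v))%:E)) => [|a|a _]; last 2 first.
- by rewrite in_setT.
- exact: hmu.
rewrite sumEFin; congr EFin.
apply: (cvg_unique _ _ (hm v)) => //.
have -> : (fun j => E j (cyl_ind v)) = fun j => \sum_a E j (cyl_ind (a :: v)).
  apply/funext => j; have [_ _ _ inv] := mE j.
  rewrite -(mean_functional_sum (mE j)) -inv; congr (E j).
  by apply/funext => u; exact: cyl_ind_cons.
exact: (cvg_fin_sum (fun a => hm (a :: v))).
Qed.

Section Windows.
Variables (n : nat) (n0 : (0 < n)%N) (sg : n.-tuple letters -> R) (dsg : distr sg).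
Variable k : nat.
Hypothesis k0 : (0 < k)%N.

Definition orbit_mean phi : R := \sum_w sg w * birkhoff_avg phi n (periodic w).

Lemma periodic_iter (w : n.-tuple letters) : iter n shift (periodic w) = periodic w.
Proof.
by apply/funext => j; rewrite iter_shiftE /periodic size_tuple addnC modnDr.
Qed.

Lemma orbit_mean_functional : mean_functional orbit_mean.
Proof.
split.
- move=> I a phi; rewrite /orbit_mean.
  under [RHS]eq_bigr do rewrite mulr_sumr.
  rewrite exchange_big/=; apply: eq_bigr => w _.
  rewrite /birkhoff_avg /birkhoff_sum exchange_big/= mulr_sumr mulr_sumr.
  apply: eq_bigr => i _; rewrite -mulr_sumr; ring.
- move=> phi psi H; apply: ler_sum => w _; rewrite ler_wpM2l ?(proj1 dsg)//.
  by rewrite ler_wpM2l// /birkhoff_sum; apply: ler_sum => i _.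
- move=> c; rewrite /orbit_mean /birkhoff_avg /birkhoff_sum.
  under eq_bigr do rewrite big_const_nat subn0 iter_addr_0 -[c *+ n]mulr_natl mulKf ?pnatr_eq0 -?lt0n//.
  by rewrite -mulr_suml (proj2 dsg) mul1r.
- move=> phi; apply: eq_bigr => w _; congr (_ * (_ * _)).
  have : phi (periodic w) + birkhoff_sum phi n (shift (periodic w)) =
      birkhoff_sum phi n (periodic w) + phi (iter n shift (periodic w)).
    by rewrite -birkhoffSl birkhoffSr.
  rewrite periodic_iter addrC => /addIr <-.
  by apply: eq_bigr => i _; rewrite /= -iterSr.
Qed.

Definition window l (w : n.-tuple letters) : k.-tuple letters :=
  @prefix_tuple N k (iter l shift (periodic w)).

Lemma orbit_mean_cyl (v : k.-tuple letters) :
  orbit_mean (cyl_ind v) = \sum_(l < n) n%:R^-1 * push (window l) sg v.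
Proof.
rewrite /orbit_mean /birkhoff_avg /birkhoff_sum.
under eq_bigr do rewrite big_mkord mulr_sumr mulr_sumr.
rewrite exchange_big/=; apply: eq_bigr => l _.
rewrite /push [X in _ * X]big_mkcond/= mulr_sumr; apply: eq_bigr => w _.
rewrite cyl_ind_prefix -/(window l w); case: eqP => _; rewrite ?mulr0 ?mulr1//.
by rewrite mulrC.
Qed.

Lemma ent_prefix_mul (X : n.-tuple letters -> code_space N) Q :
  ent (push (fun w => @prefix_tuple N (Q * k) (X w)) sg) <=
  \sum_(q < Q) ent (push (fun w => @prefix_tuple N k (iter (q * k) shift (X w))) sg).
Proof.
elim: Q => [|Q IH].
  rewrite big_ord0 mul0n (le_trans (ent_le_card (distr_push _ dsg)))//.
  by rewrite card_tuple expn0 ln1.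
rewrite big_ord_recr/=.
pose Y w := (@prefix_tuple N (Q * k) (X w),
  @prefix_tuple N k (iter (Q * k) shift (X w))).
pose dec (p : (Q * k).-tuple letters * k.-tuple letters) : (Q.+1 * k).-tuple letters :=
  @prefix_tuple N _ (ext (p.1 ++ p.2)).
have e : (fun w => @prefix_tuple N (Q.+1 * k) (X w)) =1 dec \o Y.
  move=> w; apply/agree_prefix => i ik.
  rewrite -[RHS]/(nth ord0 (val (prefix_tuple (Q * k) (X w)) ++
    val (prefix_tuple k (iter (Q * k) shift (X w)))) i).
  rewrite !prefix_tupleE nth_cat size_mkseq.
  case: ltnP => iQ; first by rewrite nth_mkseq.
  rewrite nth_mkseq ?iter_shiftE ?subnKC//.
  by rewrite ltn_subLR// -mulSnr.
rewrite (eq_ent (eq_push sg e)) -(eq_ent (push_comp dec Y sg)).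
rewrite (le_trans (ent_push_le _ _))//; first exact: (proj1 (distr_push Y dsg)).
rewrite (le_trans (ent_pair_le (distr_push Y dsg)))//.
by rewrite (eq_ent (push_comp _ Y sg)) (eq_ent (push_comp snd Y sg)) lerD2r.
Qed.

(** Any [n] consecutive letters of a periodic point, starting at any offset [i], determine [w]. *)
Lemma ent_le_windows i Q : (n <= Q * k)%N ->
  ent sg <= \sum_(q < Q) ent (push (window (i + q * k)) sg).
Proof.
move=> nQ; pose X (w : n.-tuple letters) := iter i shift (periodic w).
(* The index is [r - i] modulo [n]; adding [n * i >= i] keeps the truncated subtraction exact. *)
pose dec (y : (Q * k).-tuple letters) : n.-tuple letters :=
  [tuple nth ord0 y ((r + n * i - i) %% n) | r < n].
have e : id =1 dec \o (fun w => @prefix_tuple N (Q * k) (X w)).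
  move=> w; apply: eq_from_tnth => r; rewrite tnth_mktuple.
  rewrite -[tval (prefix_tuple _ (X w))]/(val (prefix_tuple _ (X w))) prefix_tupleE.
  have ri : (i <= r + n * i)%N by rewrite (leq_trans _ (leq_addl _ _))// leq_pmull.
  rewrite nth_mkseq; last by rewrite (leq_trans _ nQ)// ltn_mod.
  rewrite /X iter_shiftE /periodic size_tuple modnDmr subnKC// addnC mulnC modnMDl.
  by rewrite modn_small// -tnth_nth.
have sgE : sg =1 push id sg by move=> w; rewrite /push big_pred1_eq.
rewrite (eq_ent sgE) (eq_ent (eq_push sg e)) -(eq_ent (push_comp dec _ sg)).
rewrite (le_trans (ent_push_le _ _))//; first exact: (proj1 (distr_push _ dsg)).
rewrite (le_trans (ent_prefix_mul _ _))// le_eqVlt; apply/orP; left; apply/eqP.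
apply: eq_bigr => q _; apply/eq_ent/eq_push => w.
by rewrite /X /window -iterD addnC.
Qed.

(* Misiurewicz' argument: for each of [k] offsets the orbit of length [n] splits
   into about [n / k] windows; average over the offsets. *)
Lemma orbit_mean_ent : k%:R * ent sg <=
  n%:R * ent (fun v : k.-tuple letters => orbit_mean (cyl_ind v)) +
  k%:R * ln #|{: k.-tuple letters}|%:R.
Proof.
pose Q := (n %/ k).+1; pose H l := ent (push (window l) sg).
have HK l : H l <= ln #|{: k.-tuple letters}|%:R by exact/ent_le_card/distr_push.
have c0 : 0 <= ln #|{: k.-tuple letters}|%:R :> R.
  by rewrite (le_trans _ (HK 0%N))// ent_ge0//; exact: distr_push.
have nQ : (n <= Q * k)%N by rewrite ltnW// ltn_ceil.
have Qn : (Q * k - n <= k)%N by rewrite leq_subLR mulSnr leq_add2r leq_trunc_div.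
have nR : 0 < n%:R :> R by rewrite ltr0n.
have h1 : k%:R * ent sg <= \sum_(0 <= l < Q * k) H l.
  have -> : \sum_(0 <= l < Q * k) H l = \sum_(i < k) \sum_(q < Q) H (i + q * k)%N.
    rewrite [RHS]exchange_big/=; move: (Q) => q; elim: q => [|q IH].
      by rewrite mul0n big_ord0 big_nil.
    rewrite mulSnr (big_cat_nat (n := q * k)) ?leq_addr//= IH big_ord_recr/=; congr (_ + _).
    by rewrite -{1}[(q * k)%N]add0n big_addn addKn big_mkord.
  rewrite -[X in X%:R](card_ord k) mulr_natl -sumr_const; apply: ler_sum => i _.
  exact: ent_le_windows.
(* The windows overshoot the orbit by at most [k], each with entropy at most the logarithm of the
   number of words. *)
have h2 : \sum_(0 <= l < Q * k) H l <= \sum_(0 <= l < n) H l + k%:R * ln #|{: k.-tuple letters}|%:R.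
  rewrite (big_cat_nat (n := n))//= lerD2l.
  rewrite (le_trans (ler_sum _ (fun i _ => HK i)))// big_const_nat iter_addr_0 -[leLHS]mulr_natl.
  by rewrite ler_wpM2r// ler_nat.
(* [orbit_mean] is the average of the window laws over [l < n], so concavity applies. *)
have h3 : \sum_(0 <= l < n) H l <= n%:R * ent (fun v : k.-tuple letters => orbit_mean (cyl_ind v)).
  rewrite (eq_ent orbit_mean_cyl) -ler_pdivrMl// mulr_sumr big_mkord.
  apply: (@ent_concave _ 'I_n _ (fun=> n%:R^-1) (fun l => push (window l) sg)).
    split=> [l|]; first by rewrite invr_ge0.
    by rewrite sumr_const card_ord -[_ *+ n]mulr_natl mulfV// gt_eqF.
  by move=> l; exact: distr_push.
lra.
Qed.

End Windows.


(** Selects the bin of averages of [f]. The number of bins does not depend on the word length, so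
    the exponential growth rate survives. *)
Lemma pigeonhole_sum (I : finType) (P : pred I) (F : I -> R) B (b : I -> 'I_B.+1) :
  exists j, \sum_(i | P i) F i <= B.+1%:R * \sum_(i | P i && (b i == j)) F i.
Proof.
apply: contrapT => H.
have {}H j : B.+1%:R * \sum_(i | P i && (b i == j)) F i < \sum_(i | P i) F i.
  by rewrite ltNge; apply/negP => h; apply: H; exists j.
have : \sum_(j < B.+1) B.+1%:R * \sum_(i | P i && (b i == j)) F i <
    \sum_(j < B.+1) \sum_(i | P i) F i.
  by apply: ltr_sum => //; apply/hasP; exists ord0; rewrite ?mem_index_enum.
rewrite -mulr_sumr -(partition_big b xpredT)//= sumr_const card_ord -[ltRHS]mulr_natl.
by rewrite ltxx.
Qed.

Variables (f g : code_space N -> R) (C : set R) (t e : R).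
Hypotheses (hf : holder_code f) (hg : holder_code g) (cC : closed C).
Hypothesis growth : forall r e', 0 < r -> e' < e -> forall n0, exists2 n, (n0 <= n)%N &
  expR (n%:R * e') <=
    \sum_(w : n.-tuple letters | `[< set_nbhd C r (birkhoff_avg f n (periodic w)) >])
      expR (t * birkhoff_sum g n (periodic w)).

Lemma set_nbhdP (r x : R) : set_nbhd C r x -> exists2 c, C c & `|x - c| < r.
Proof. by move=> /ereal_inf_lt[_ [c Cc <-]]; rewrite lte_fin; exists c. Qed.

(** Within one bin of width [r] all averages of [f] lie within [2 * r = dl] of a single point of
    [C], hence so does their weighted mean; without the bins the mean could leave a non-convex
    [C]. *)
Lemma growth_stage (dl : R) : 0 < dl -> exists E, exists2 c,
  C c & [/\ mean_functional E, `|E f - c| <= dl &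
   forall k, (0 < k)%N -> (k%:R <= dl^-1) -> k%:R * (e - dl - t * E g) <=
     ent (fun v : k.-tuple letters => E (cyl_ind v)) +
     dl].
Proof.
move=> dl0.
have [M M0 HM] := holder_bounded hf.
pose r := dl / 2; have r0 : 0 < r by rewrite divr_gt0.
pose B := Num.trunc (2 * M / r).
(* All [k] in question are at most [K], so [cK] bounds the additive error of [orbit_mean_ent]
   uniformly in [k]. *)
pose K := (Num.trunc dl^-1).+1.
pose cK : R := K%:R * ln #|{: K.-tuple letters}|%:R.
have cK0 : 0 <= cK by rewrite mulr_ge0// ln_ge0// ler1n card_tuple expn_gt0 card_ord.
pose n0 := maxn (Num.trunc (ln B.+1%:R / r)).+1 (Num.trunc (cK / dl)).+1.
have er : e - r < e by rewrite ltrBlDr ltrDl.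
have [n n0n hn] := growth r0 er n0.
have np : (0 < n)%N by apply: leq_trans n0n; rewrite leq_max.
have nR : 0 < n%:R :> R by rewrite ltr0n.
have n1 : ln B.+1%:R <= n%:R * r.
  rewrite -ler_pdivrMr// ltW// (lt_le_trans (truncnS_gt _))// ler_nat.
  by apply: leq_trans n0n; rewrite leq_max leqnn.
have n2 : cK <= n%:R * dl.
  rewrite -ler_pdivrMr// ltW// (lt_le_trans (truncnS_gt _))// ler_nat.
  by apply: leq_trans n0n; rewrite leq_max leqnn orbT.
pose P (w : n.-tuple letters) := `[< set_nbhd C r (birkhoff_avg f n (periodic w)) >].
have avgM w : `|birkhoff_avg f n (periodic w)| <= M.
  rewrite /birkhoff_avg normrM ger0_norm ?invr_ge0// ler_pdivrMl// mulrC.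
  exact: birkhoff_bound.
pose bin (w : n.-tuple letters) : 'I_B.+1 := inord (Num.trunc ((birkhoff_avg f n (periodic w) + M) / r)).
have [j hj] := pigeonhole_sum P (fun w => expR (t * birkhoff_sum g n (periodic w))) bin.
pose P' w := P w && (bin w == j).
pose Z := \sum_(w | P' w) expR (t * birkhoff_sum g n (periodic w)).
have hZ : expR (n%:R * (e - dl)) <= Z.
  have := le_trans hn hj; rewrite -/Z => h.
  have B0 : 0 < B.+1%:R :> R by rewrite ltr0n.
  rewrite -(ler_pM2l B0) (le_trans _ h)// -{1}(lnK (x := B.+1%:R)) ?posrE// -expRD ler_expR.
  have -> : n%:R * (e - r) = n%:R * r + n%:R * (e - dl) by rewrite /r; field.
  by rewrite lerD2r.
have Z0 : 0 < Z by rewrite (lt_le_trans _ hZ)// expR_gt0.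
have [w0 Pw0] : exists w, P' w.
  apply: contrapT => H; move: Z0; rewrite /Z big1 ?ltxx// => w Pw.
  by exfalso; apply: H; exists w.
have [c Cc hc] : exists2 c, C c & `|birkhoff_avg f n (periodic w0) - c| < r.
  by apply: set_nbhdP; case/andP: Pw0 => /asboolP.
(* Gibbs weights on the chosen bin. *)
pose sg w := if P' w then expR (t * birkhoff_sum g n (periodic w)) / Z else 0.
have dsg : distr sg.
  split=> [w|]; first by rewrite /sg; case: ifP => // _; rewrite divr_ge0 ?expR_ge0 ?ltW.
  by rewrite -big_mkcond -mulr_suml divff// gt_eqF.
have mE := orbit_mean_functional np dsg.
exists (orbit_mean sg); exists c => //; split => //.
  have -> : orbit_mean sg f - c = \sum_w sg w * (birkhoff_avg f n (periodic w) - c).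
    under eq_bigr do rewrite mulrBr.
    by rewrite sumrB -mulr_suml (proj2 dsg) mul1r.
  rewrite (le_trans (ler_norm_sum _ _ _))//.
  rewrite (@le_trans _ _ (\sum_w sg w * dl))//; last by rewrite -mulr_suml (proj2 dsg) mul1r.
  apply: ler_sum => w _; rewrite normrM ger0_norm ?(proj1 dsg)//.
  rewrite /sg; case: ifPn => [Pw|_]; last by rewrite !mul0r.
  rewrite ler_wpM2l ?divr_ge0 ?expR_ge0 ?(ltW Z0)//.
  have bE w' : P' w' -> nat_of_ord j = Num.trunc ((birkhoff_avg f n (periodic w') + M) / r).
    move=> /andP[_ /eqP <-]; rewrite inordK// ltnS.
    have := avgM w'; rewrite ler_norml => /andP[h1 h2].
    apply: le_truncn; rewrite ler_wpM2r ?invr_ge0 ?(ltW r0)//; lra.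
  have tr (x : R) : 0 <= x -> (Num.trunc x)%:R <= x < (Num.trunc x)%:R + 1.
    by move=> x0; rewrite natr1; exact: truncn_itv.
  have pos w' : 0 <= (birkhoff_avg f n (periodic w') + M) / r.
    by rewrite divr_ge0 ?(ltW r0)//; have := avgM w'; rewrite ler_norml; lra.
  have := tr _ (pos w); have := tr _ (pos w0); rewrite -(bE _ Pw) -(bE _ Pw0).
  rewrite !ler_pdivlMr// !ltr_pdivrMr// mulrDl mul1r => h1 h2.
  move: hc; rewrite ltr_norml ler_norml; have -> : dl = r + r by rewrite /r; field.
  lra.
move=> k k0 kdl.
(* The variational identity for Gibbs weights: entropy plus mean energy equals [ln Z]. *)
have entsg : ent sg = ln Z - t * (n%:R * orbit_mean sg g).
  have lz : ln Z = \sum_w sg w * ln Z by rewrite -mulr_suml (proj2 dsg) mul1r.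
  rewrite [X in X - _]lz /ent /orbit_mean !mulr_sumr -sumrB.
  apply: eq_bigr => w _; rewrite /sg; case: ifP => _; last by rewrite !mul0r !mulr0 subr0 oppr0.
  rewrite ln_div ?posrE ?expR_gt0// expRK /birkhoff_avg.
  by field; rewrite !gt_eqF.
have lnZ : n%:R * (e - dl) <= ln Z by rewrite -[leLHS]expRK ler_ln ?posrE ?expR_gt0.
have kK : k%:R * ln #|{: k.-tuple letters}|%:R <= cK.
  have kK : (k <= K)%N.
    by rewrite -(ler_nat R) (le_trans kdl)// ltW// truncnS_gt.
  rewrite /cK !card_tuple card_ord ler_pM ?ler_nat ?ln_ge0 ?ler1n ?expn_gt0//.
  by rewrite ler_ln ?posrE ?ltr0n ?expn_gt0// ler_nat leq_pexp2l.
have := orbit_mean_ent np dsg k0; rewrite entsg => h.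
rewrite -(ler_pM2l nR).
have h2 : k%:R * (n%:R * (e - dl)) <= k%:R * ln Z by rewrite ler_wpM2l.
set A := ent _ in h *.
rewrite !mulrBr in h h2 *; rewrite mulrDr; set Og := orbit_mean sg g in h *.
have -> : n%:R * (k%:R * (t * Og)) = k%:R * (t * (n%:R * Og)) by ring.
have -> : n%:R * (k%:R * e) = k%:R * (n%:R * e) by ring.
have -> : n%:R * (k%:R * dl) = k%:R * (n%:R * dl) by ring.
lra.
Qed.

(** With tolerance [1 / (j + 1)] each fixed [k] is eventually allowed. Block entropies of fixed
    length are continuous along the ultrafilter, and maximality in [entropy_spec] converts their
    bounds into one for [h]. Closedness of [C] keeps the limit of the points of [C] inside it. *)
Lemma invariant_measure_of_growth : exists mu : probability T R, exists h : R,
  [/\ shift_invariant mu, C (\int[mu]_u f u), entropy mu = h%:E &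
      e <= h + t * \int[mu]_u g u].
Proof.
have H j : exists Ec : ((code_space N -> R) -> R) * R,
  C Ec.2 /\ [/\ mean_functional Ec.1, `|Ec.1 f - Ec.2| <= j.+1%:R^-1 &
   forall k, (0 < k)%N -> (k%:R <= j.+1%:R^-1^-1 :> R) -> k%:R * (e - j.+1%:R^-1 - t * Ec.1 g) <=
     ent (fun v : k.-tuple letters => Ec.1 (cyl_ind v)) + j.+1%:R^-1].
  by have [E [c Cc h]] := @growth_stage j.+1%:R^-1 ltac:(by rewrite invr_gt0); exists (E, c).
have [Ec hE] := choice H.
have [U [UU Uoo]] := @ultraFilterLemma nat \oo _.
have [mu [inv mucyl muint]] := @limit_of_mean_functionals U UU (fun j => (Ec j).1)
  (fun j => let: And3 h _ _ := proj2 (hE j) in h).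
have [h [eh h0 _ hmax]] := entropy_spec gamma01 inv.
have c0 : j.+1%:R^-1 @[j --> U] --> (0 : R).
  by apply: cvg_trans (@cvg_harmonic R); exact: cvg_app.
have cvgc : (Ec j).2 @[j --> U] --> \int[mu]_u f u.
  rewrite -[X in _ --> X]subr0.
  have -> : (fun j => (Ec j).2) = fun j => (Ec j).1 f - ((Ec j).1 f - (Ec j).2).
    by apply/funext => j; rewrite subKr.
  apply: cvgB; first exact: muint.
  apply/norm_cvg0P; apply: (squeeze_cvgr _ (cvg_cst 0) c0).
  by apply: nearW => j; rewrite normr_ge0; have [_ [_ ->]] := hE j.
exists mu, h; split=> //.
  apply: (@closed_cvg _ _ U _ _ C cC) cvgc.
  by apply: nearW => j; have [] := hE j.
rewrite -lerBlDr; apply: hmax => k k0.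
have cg := muint g hg.
have c1 : k%:R * (e - j.+1%:R^-1 - t * (Ec j).1 g) @[j --> U] --> k%:R * (e - 0 - t * \int[mu]_u g u).
  apply: cvgMr; apply: cvgB; last exact: cvgMr.
  by apply: cvgB => //; exact: cvg_cst.
have c2 : ent (fun v : k.-tuple letters => (Ec j).1 (cyl_ind v)) + j.+1%:R^-1 @[j --> U] -->
    ent (law mu (@prefix_tuple N k)) + 0.
  apply: cvgD => //.
  have cv (v : k.-tuple letters) :
      - ((Ec j).1 (cyl_ind v) * ln ((Ec j).1 (cyl_ind v))) @[j --> U] -->
      - (law mu (@prefix_tuple N k) v * ln (law mu (@prefix_tuple N k) v)).
    apply: cvg_eta => [j|]; last by rewrite law_prefix//; exact: mucyl.
    have [_ [mE _ _]] := hE j.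
    by rewrite mean_functional_cyl_ge0 ?mean_functional_cyl_le1.
  exact: (cvg_fin_sum cv).
rewrite subr0 in c1; rewrite addr0 in c2.
apply: ler_cvg_to c1 c2 _; apply: Uoo; exists k => // j /= kj.
have [_ [_ _ ->]] := hE j => //.
by rewrite invrK ler_nat ltnW.
Qed.

End InvariantMeasureConstruction.

(** * The Euclidean norm and its comparison with the maximum norm *)

Section EuclideanNorm.
Variables (R : realType) (d : nat).
Implicit Types x y : 'rV[R]_d.

(** Lagrange's identity writes twice the defect as a sum of squares. *)
Lemma cauchy_schwarz (I : finType) (a b : I -> R) :
  (\sum_i a i * b i) ^+ 2 <= (\sum_i a i ^+ 2) * (\sum_i b i ^+ 2).
Proof.
have : 0 <= \sum_i \sum_j (a i * b j - a j * b i) ^+ 2.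
  by apply: sumr_ge0 => i _; apply: sumr_ge0 => j _; exact: sqr_ge0.
have -> : \sum_i \sum_j (a i * b j - a j * b i) ^+ 2 =
  (\sum_i a i ^+ 2) * (\sum_i b i ^+ 2) + (\sum_i b i ^+ 2) * (\sum_i a i ^+ 2)
   - 2 * ((\sum_i a i * b i) * (\sum_i a i * b i)).
  rewrite !big_distrlr/= mulr_sumr -big_split -sumrB/=; apply: eq_bigr => i _.
  rewrite mulr_sumr -big_split -sumrB/=; apply: eq_bigr => j _.
  ring.
rewrite expr2; lra.
Qed.

Lemma enorm_ge0 x : 0 <= enorm x.
Proof. exact: sqrtr_ge0. Qed.

Lemma enorm_sqr x : enorm x ^+ 2 = \sum_i x ord0 i ^+ 2.
Proof. by rewrite sqr_sqrtr// sumr_ge0// => i _; exact: sqr_ge0. Qed.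

Lemma enorm0 : enorm (0 : 'rV[R]_d) = 0.
Proof. by rewrite /enorm big1 ?sqrtr0// => i _; rewrite mxE expr0n. Qed.

Lemma enormZ (c : R) x : enorm (c *: x) = `|c| * enorm x.
Proof.
rewrite /enorm; under eq_bigr do rewrite mxE exprMn.
by rewrite -mulr_sumr sqrtrM ?sqr_ge0// sqrtr_sqr.
Qed.

Lemma enormN x : enorm (- x) = enorm x.
Proof. by rewrite -scaleN1r enormZ normrN1 mul1r. Qed.

Lemma enormB x y : enorm (x - y) = enorm (y - x).
Proof. by rewrite -enormN opprB. Qed.

Lemma enormD x y : enorm (x + y) <= enorm x + enorm y.
Proof.
rewrite -(ler_pXn2r (n:=2)) ?nnegrE ?enorm_ge0 ?addr_ge0 ?enorm_ge0//.
have -> : enorm (x + y) ^+ 2 =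
    enorm x ^+ 2 + enorm y ^+ 2 + 2 * \sum_i x ord0 i * y ord0 i.
  rewrite !enorm_sqr mulr_sumr -!big_split/=; apply: eq_bigr => i _.
  by rewrite mxE; ring.
rewrite sqrrD -addrA [X in _ + X]addrC addrA lerD2r lerD2l.
suff: \sum_i x ord0 i * y ord0 i <= enorm x * enorm y by rewrite mulr2n; lra.
have := cauchy_schwarz (fun i => x ord0 i) (fun i => y ord0 i).
rewrite -!enorm_sqr -exprMn => h.
rewrite (le_trans (ler_norm _))// -(ler_pXn2r (n:=2)) ?nnegrE ?mulr_ge0 ?enorm_ge0//.
by rewrite real_normK ?num_real.
Qed.

Lemma enorm_triangle z x y : enorm (x - y) <= enorm (x - z) + enorm (z - y).
Proof. by rewrite -[x - y](subrKA z) enormD. Qed.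

Lemma coord_le_enorm x i : `|x ord0 i| <= enorm x.
Proof.
rewrite -sqrtr_sqr ler_wsqrtr// (bigD1 i)//= lerDl.
by apply: sumr_ge0 => j _; exact: sqr_ge0.
Qed.

Lemma enorm_le_sum x : enorm x <= \sum_i `|x ord0 i|.
Proof.
have s0 : 0 <= \sum_i `|x ord0 i| by apply: sumr_ge0.
rewrite -(ler_pXn2r (n:=2)) ?nnegrE ?enorm_ge0// enorm_sqr.
rewrite expr2 big_distrlr/=; apply: ler_sum => i _.
rewrite (bigD1 i)//= -normrM -expr2 (ger0_norm (sqr_ge0 _)) lerDl.
by apply: sumr_ge0 => j _; rewrite -normrM.
Qed.

Lemma mxnorm_le_enorm x : `|x| <= enorm x.
Proof.
rewrite /Num.norm/= mx_normrE; apply: bigmax_le; first exact: enorm_ge0.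
by move=> [i j] _ /=; rewrite (ord1 i) coord_le_enorm.
Qed.

Lemma coord_le_mxnorm x i : `|x ord0 i| <= `|x|.
Proof.
rewrite [X in _ <= X]/Num.norm/= mx_normrE.
exact: (le_bigmax _ (fun ij => `|x ij.1 ij.2|) (ord0, i)).
Qed.

Lemma enorm_le_mxnorm x : enorm x <= d%:R * `|x|.
Proof.
rewrite (le_trans (enorm_le_sum x))//.
rewrite (le_trans (ler_sum _ (fun i _ => coord_le_mxnorm x i)))//.
by rewrite sumr_const card_ord mulr_natl.
Qed.

Lemma enorm_eq0 x : enorm x = 0 -> x = 0.
Proof.
by move=> x0; apply/eqP; rewrite -normr_eq0 eq_le normr_ge0 andbT -x0 mxnorm_le_enorm.
Qed.

Lemma enorm_gt0 x : x != 0 -> 0 < enorm x.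
Proof.
move=> x0; rewrite lt_neqAle enorm_ge0 andbT eq_sym.
by apply: contra_neq x0 => /enorm_eq0.
Qed.

End EuclideanNorm.

(** * Zeta-functions and the variational formula *)

Lemma ler_sum_sub (R : numDomainType) (I : finType) (P Q : pred I) (F : I -> R) :
  (forall i, Q i -> 0 <= F i) -> (forall i, P i -> Q i) ->
  \sum_(i | P i) F i <= \sum_(i | Q i) F i.
Proof.
move=> F0 PQ; rewrite big_mkcond [leRHS]big_mkcond; apply: ler_sum => i _.
by case: ifP => [/PQ ->//|_]; case: ifP => // /F0.
Qed.

Section RadiusOfConvergence.
Variable R : realType.
Implicit Types (a b : nat -> R) (e : R).

Lemma sigma_rad_gt a e : (forall n, 0 <= a n) -> ((expR (- e))%:E < sigma_rad a)%E ->
  exists n0, forall n, (n0 <= n)%N -> a n <= expR (n%:R * e).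
Proof.
move=> a0 /ereal_sup_gt[_ [z cz <-]]; rewrite lte_fin => ez.
have := cvg_series_cvg_0 cz => /cvgrPdist_le/(_ _ ltr01)[n0 _ H].
exists n0 => n n0n; have := H n n0n.
rewrite sub0r normrN normrM normrX (ger0_norm (a0 n)) => h.
have z0 : 0 < `|z| by rewrite (lt_trans _ ez)// expR_gt0.
have zn : 0 < `|z| ^+ n by rewrite exprn_gt0.
rewrite -(ler_pM2r zn) (le_trans h)// expRM_natl -exprMn exprn_ege1//.
by rewrite -[e]opprK expRN ler_pdivlMl ?expR_gt0// mulr1 ltW.
Qed.

Lemma cvg_coef_geometric a e z n0 : (forall n, 0 <= a n) ->
  (forall n, (n0 <= n)%N -> a n <= expR (n%:R * e)) -> 0 <= z -> z < expR (- e) ->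
  cvgn (series (fun n => a n * z ^+ n)).
Proof.
(* The maximum keeps [q] positive even for [z = 0], since the constant [M], which absorbs the first
   [n0] terms, divides by powers of [q]. *)
move=> a0 H z0 ze; pose q := Num.max (z * expR e) (1 / 2).
have q0 : 0 < q by rewrite lt_max orbC divr_gt0.
have q1 : q < 1.
  rewrite gt_max; apply/andP; split; last lra.
  by rewrite -ltr_pdivlMr ?expR_gt0// div1r -expRN.
pose M := 1 + \sum_(k < n0) a k * z ^+ k / q ^+ k.
have M1 : 1 <= M.
  rewrite lerDl sumr_ge0// => k _.
  by rewrite mulr_ge0 ?invr_ge0 ?mulr_ge0 ?exprn_ge0 ?(ltW q0).
apply: (@series_le_cvg _ _ (fun n => M * q ^+ n)).
- by move=> n; rewrite mulr_ge0 ?exprn_ge0.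
- by move=> n; rewrite mulr_ge0 ?exprn_ge0 ?(ltW q0)// (le_trans ler01).
- move=> n; have [n0n|nn0] := leqP n0 n.
    rewrite (@le_trans _ _ (q ^+ n))//; last by rewrite ler_peMl// exprn_ge0// ltW.
    rewrite (@le_trans _ _ ((z * expR e) ^+ n))//.
      by rewrite exprMn mulrC -expRM_natl ler_wpM2l ?exprn_ge0// H.
    by rewrite lerXn2r ?nnegrE ?mulr_ge0 ?expR_ge0 ?(ltW q0)// le_max lexx.
  rewrite -ler_pdivrMr ?exprn_gt0// /M (bigD1 (Ordinal nn0))//= addrCA lerDl addr_ge0//.
  by rewrite sumr_ge0// => k _; rewrite mulr_ge0 ?invr_ge0 ?mulr_ge0 ?exprn_ge0 ?(ltW q0).
- by apply: is_cvg_geometric_series; rewrite ger0_norm ?ltW.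
Qed.

Lemma sigma_rad_ge a e n0 : (forall n, 0 <= a n) ->
  (forall n, (n0 <= n)%N -> a n <= expR (n%:R * e)) -> ((expR (- e))%:E <= sigma_rad a)%E.
Proof.
move=> a0 H; rewrite leNgt; apply/negP => lt.
have ub z : 0 <= z -> z < expR (- e) -> (z%:E <= sigma_rad a)%E.
  move=> z0 ze; apply: ereal_sup_ubound; exists z; last by rewrite ger0_norm.
  exact: cvg_coef_geometric H z0 ze.
have s0 := ub 0 (lexx _) (expR_gt0 _).
case: (sigma_rad a) lt ub s0 => [s| |]; rewrite ?ltNge ?leey ?leNye//.
rewrite -ltNge lte_fin => se ub; rewrite lee_fin => s0.
have := ub ((s + expR (- e)) / 2); rewrite lee_fin.
have h1 : 0 <= (s + expR (- e)) / 2 by rewrite divr_ge0 ?addr_ge0 ?expR_ge0.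
have h2 : (s + expR (- e)) / 2 < expR (- e) by lra.
move=> /(_ h1 h2); lra.
Qed.

End RadiusOfConvergence.

Section ZetaRoot.
Variables (R : realType) (N : nat) (gamma : R).
Hypothesis gamma01 : 0 < gamma < 1.
Local Notation T := (borel_code N gamma).
Local Notation letters := 'I_N.+1.
Variables (f g : code_space N -> R) (l0 : R).
Hypotheses (hf : holder_code f) (hg : holder_code g).
Hypotheses (l0_gt0 : 0 < l0) (g_le : forall u, g u <= - l0).

Definition orbit_sum (C : set R) (t : R) n : R :=
  \sum_(w : n.-tuple letters | `[< C (birkhoff_avg f n (periodic w)) >])
    expR (t * birkhoff_sum g n (periodic w)).

Lemma orbit_sum_ge0 C t n : 0 <= orbit_sum C t n.
Proof. by apply: sumr_ge0 => w _; exact: expR_ge0. Qed.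

Local Notation zeta C t := (zeta_dyn_erg C f (fun u => t * g u)).

(** By bounded distortion the supremum may be replaced by the value at the periodic point, up to a
    factor independent of [n]; growth rates are unaffected. *)
Lemma sup_cylinder_bounds (t : R) : exists2 K : R, 0 < K & forall n (w : n.-tuple letters),
  expR (t * birkhoff_sum g n (periodic w)) <=
    sup [set expR (birkhoff_sum (fun u => t * g u) n u) | u in cylinder w] <=
    K * expR (t * birkhoff_sum g n (periodic w)).
Proof.
have [D D0 HD] := holder_distortion hg.
exists (expR (`|t| * D)); first exact: expR_gt0.
move=> n w.
have bnd u : cylinder w u ->
    expR (birkhoff_sum (fun u => t * g u) n u) <=
    expR (`|t| * D) * expR (t * birkhoff_sum g n (periodic w)).
  move=> wu; rewrite birkhoffZ -expRD ler_expR -lerBlDr -mulrBr.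
  rewrite (le_trans (ler_norm _))// normrM ler_wpM2l// HD//.
  by have := @cylinder_agree _ _ u _ wu (@cylinder_periodic _ w); rewrite size_tuple.
have nonempty : [set expR (birkhoff_sum (fun u => t * g u) n u) | u in cylinder w]
      (expR (t * birkhoff_sum g n (periodic w))).
  by exists (periodic w); [exact: cylinder_periodic|rewrite birkhoffZ].
apply/andP; split.
  apply: sup_upper_bound => //; split; first by eexists; exact: nonempty.
  by eexists => _ [u wu <-]; exact: bnd wu.
apply: ge_sup => [|_ [u wu <-]]; last exact: bnd.
by eexists; exact: nonempty.
Qed.

Lemma zeta_bounds (t : R) : exists2 K : R, 0 < K & forall C n,
  n%:R^-1 * orbit_sum C t n <= zeta C t n <= K * (n%:R^-1 * orbit_sum C t n).
Proof.
have [K K0 HK] := sup_cylinder_bounds t; exists K => // C n; apply/andP; split.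
  by rewrite ler_wpM2l ?invr_ge0//; apply: ler_sum => w _; case/andP: (HK n w).
rewrite mulrCA ler_wpM2l ?invr_ge0// mulr_sumr; apply: ler_sum => w _.
by case/andP: (HK n w).
Qed.

Lemma zeta_ge0 C t n : 0 <= zeta C t n.
Proof.
have [K _ /(_ C n)/andP[h _]] := zeta_bounds t; apply: le_trans h.
by rewrite mulr_ge0 ?invr_ge0 ?orbit_sum_ge0.
Qed.

Lemma set_nbhdS (C : set R) r r' : r <= r' -> set_nbhd C r `<=` set_nbhd C r'.
Proof. by move=> rr' x /= /lt_le_trans; apply; rewrite lee_fin. Qed.

Lemma zetaS C C' t n : C `<=` C' -> zeta C t n <= zeta C' t n.
Proof.
move=> CC'; rewrite /zeta_dyn_erg ler_wpM2l ?invr_ge0//; apply: ler_sum_sub => w.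
  have [K _ /(_ n w)/andP[h _]] := sup_cylinder_bounds t => _.
  exact: le_trans (expR_ge0 _) h.
by move=> /asboolP Cw; apply/asboolP/CC'.
Qed.

Lemma orbit_sum_le_of_zeta C t e n0 :
  (forall n, (n0 <= n)%N -> zeta C t n <= expR (n%:R * e)) ->
  forall n, (n0 <= n)%N -> (0 < n)%N -> orbit_sum C t n <= n%:R * expR (n%:R * e).
Proof.
move=> H n n0n np; have [K _ /(_ C n)/andP[h _]] := zeta_bounds t.
by rewrite -ler_pdivrMl ?ltr0n//; exact: le_trans h (H _ n0n).
Qed.

Lemma zeta_le_of_orbit_sum C t e e' n0 : e < e' ->
  (forall n, (n0 <= n)%N -> orbit_sum C t n <= expR (n%:R * e)) ->
  exists n1, forall n, (n1 <= n)%N -> zeta C t n <= expR (n%:R * e').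
Proof.
move=> ee' H; have [K K0 HK] := zeta_bounds t.
have e0 : 0 < e' - e by rewrite subr_gt0.
exists (maxn n0 (maxn 1 (Num.trunc (ln K / (e' - e))).+1)) => n.
rewrite !geq_max => /and3P[n0n n1 nK].
have /andP[_ h] := HK C n; apply: le_trans h _.
have nR : 0 < n%:R :> R by rewrite ltr0n.
have h1 : ln K <= n%:R * (e' - e).
  by rewrite -ler_pdivrMr// ltW// (lt_le_trans (truncnS_gt _))// ler_nat.
rewrite -{1}(lnK (x := K)) ?posrE//.
rewrite (@le_trans _ _ (expR (ln K) * expR (n%:R * e)))//.
  rewrite ler_wpM2l ?expR_ge0// ler_pdivrMl// (le_trans (H _ n0n))//.
  by rewrite ler_peMl ?expR_ge0// ler1n.
by rewrite -expRD ler_expR; lra.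
Qed.

Local Notation rad C t r := (sigma_rad (zeta (set_nbhd C r) t)).

(** Smaller neighbourhoods have smaller coefficients, so the radius grows as [r] decreases; this
    weak form suffices and follows from growth rates alone. *)
Lemma sigma_rad_nbhdS C t (e r r' : R) : r <= r' ->
  ((expR (- e))%:E < rad C t r')%E -> ((expR (- e))%:E <= rad C t r)%E.
Proof.
move=> rr' /(sigma_rad_gt (zeta_ge0 _ _))[n0 H].
apply: (sigma_rad_ge (n0 := n0)) => [n|n n0n]; first exact: zeta_ge0.
by apply: le_trans (H n n0n); apply: zetaS; exact: set_nbhdS.
Qed.

Lemma set_nbhd_near C (r x c : R) : C c -> `|x - c| < r -> set_nbhd C r x.
Proof.
move=> Cc xc; rewrite /set_nbhd/=; apply: le_lt_trans (_ : (`|x - c|%:E < r%:E)%E) => //.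
by apply: ereal_inf_lbound; exists c.
Qed.

(** Typical words of [mu] are counted in every neighbourhood of [C]: about [expR (L * h)] of them,
    each of weight about [expR (L * t * \int g)]. *)
Lemma sigma_rad_le_of_measure C t (mu : probability T R) (h eta : R) :
  shift_invariant mu -> C (\int[mu]_u f u) -> entropy mu = h%:E ->
  eta < h + t * \int[mu]_u g u -> forall r, 0 < r -> (rad C t r <= (expR (- eta))%:E)%E.
Proof.
move=> inv Cf eh hlt r r0; rewrite leNgt; apply/negP => /(sigma_rad_gt (zeta_ge0 _ _))[n0 H].
have := orbit_sum_le_of_zeta H => {}H.
have [h' [eh' h0 hent _]] := entropy_spec gamma01 inv.
have hh : h = h' by move: eh; rewrite eh' => -[].
subst h'.
pose e1 := h + t * \int[mu]_u g u - eta; have e10 : 0 < e1 by rewrite subr_gt0.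
(* [ep < r] puts the averages of [f] into the neighbourhood; the other bound spends at most half of
   the gap [e1]. *)
pose ep := Num.min (r / 2) (e1 / 2 / (1 + `|t|)).
have t1 : 0 < 1 + `|t| by rewrite ltr_pwDl.
have ep0 : 0 < ep by rewrite lt_min !divr_gt0.
have epr : ep < r by rewrite gt_min; apply/orP; left; lra.
have epe : ep * (1 + `|t|) <= e1 / 2 by rewrite -ler_pdivlMr// ge_min lexx orbT.
have [L0 HL] := typical_words gamma01 inv hf hg h0 hent ep0.
(* The coefficient [1 / L] of the zeta-function leaves a factor [L], which [expR x > x ^+ 2 / 2] at
   [x = L * (e1 / 2)] beats for this [L]. *)
pose L := maxn (maxn n0 L0) (Num.trunc (32 / (2 * e1) ^+ 2 * 4)).+1.
have Ln0 : (n0 <= L)%N by rewrite /L !leq_max leqnn.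
have LL0 : (L0 <= L)%N by rewrite /L !leq_max leqnn orbT.
have Lp : (0 < L)%N by rewrite /L leq_max orbT.
have LR : 0 < L%:R :> R by rewrite ltr0n.
have Lbig : 32 / (2 * e1) ^+ 2 * 4 < L%:R.
  by rewrite (lt_le_trans (truncnS_gt _))// ler_nat /L leq_max leqnn orbT.
have [W [HW cW]] := HL L LL0.
have low : expR (L%:R * (eta + e1 / 2)) <= orbit_sum (set_nbhd C r) t L.
  rewrite (@le_trans _ _ (\sum_(w in W) expR (t * birkhoff_sum g L (periodic w))))//; last first.
    apply: ler_sum_sub => w; first by move=> _; exact: expR_ge0.
    move=> wW; apply/asboolP; apply: (set_nbhd_near Cf).
    have [h1 _] := HW w _ wW (@cylinder_periodic _ w).
    apply: le_lt_trans epr; rewrite /birkhoff_avg -(ler_pM2l LR).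
    by rewrite -{1}(gtr0_norm LR) -normrM mulrBr mulVKf ?gt_eqF.
  rewrite (@le_trans _ _ (\sum_(w in W) expR (L%:R * (t * \int[mu]_u g u - `|t| * ep))))//; last first.
    apply: ler_sum => w wW; rewrite ler_expR.
    have [_ h2] := HW w _ wW (@cylinder_periodic _ w).
    rewrite mulrBr lerBlDl -lerBlDr.
    have -> : L%:R * (t * \int[mu]_u g u) - t * birkhoff_sum g L (periodic w) =
       - (t * (birkhoff_sum g L (periodic w) - L%:R * \int[mu]_u g u)) by ring.
    rewrite (le_trans (ler_norm _))// normrN normrM mulrCA ler_wpM2l//.
  rewrite sumr_const -[leRHS]mulr_natl (@le_trans _ _ (expR (L%:R * (h - ep)) * expR (L%:R * (t * \int[mu]_u g u - `|t| * ep))))//.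
    rewrite -expRD ler_expR -mulrDr ler_wpM2l//.
    move: epe; rewrite /e1 mulrDr mulr1 [ep * _]mulrC; lra.
  by rewrite ler_wpM2r ?expR_ge0.
have := le_trans low (H L Ln0 Lp).
rewrite mulrDr expRD mulrC ler_pM2r ?expR_gt0// => hL.
have := expR_ge1Dxn 1 (ltac:(rewrite mulr_ge0 ?divr_ge0 ?ltW//) : 0 <= L%:R * (e1 / 2)).
move=> /le_trans/(_ hL); rewrite leNgt => /negP; apply.
rewrite (@lt_le_trans _ _ ((L%:R * (e1 / 2)) ^+ 2 / 2))//; last by rewrite (_ : 2`! = 2)%N// lerDr.
have Lb : 128 < L%:R * (2 * e1) ^+ 2.
  by rewrite -ltr_pdivrMr ?exprn_gt0 ?mulr_gt0//; move: Lbig; rewrite mulrAC -natrM.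
have -> : (L%:R * (e1 / 2)) ^+ 2 / 2 = L%:R * ((L%:R * (2 * e1) ^+ 2) / 32) by field.
rewrite ltr_pMr//; move: Lb; move: (_ * (2 * e1) ^+ 2) => x; lra.
Qed.

(** If the orbit sums did not grow at rate [e'], the radius would be too large. The midpoint of [e']
    and [e] leaves room for the distortion factor. *)
Lemma measure_of_sigma_rad C t (e : R) : closed C ->
  (forall r e', 0 < r -> e' < e -> (rad C t r < (expR (- e'))%:E)%E) ->
  exists mu : probability T R, exists h : R,
    [/\ shift_invariant mu, C (\int[mu]_u f u), entropy mu = h%:E &
        e <= h + t * \int[mu]_u g u].
Proof.
move=> cC H; apply: (invariant_measure_of_growth gamma01 hf hg cC) => r e' r0 e'e n0.
apply: contrapT => nH.
have [||n1 H1] := @zeta_le_of_orbit_sum (set_nbhd C r) t e' ((e' + e) / 2) n0.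
- lra.
- move=> n n0n; rewrite leNgt; apply/negP => lt; apply: nH; exists n => //.
  exact: ltW.
have := sigma_rad_ge (fun n => zeta_ge0 _ _ n) H1; rewrite leNgt => /negP; apply.
by apply: H => //; lra.
Qed.


Definition admissible (C : set R) (mu : probability T R) : Prop :=
  shift_invariant mu /\ C (\int[mu]_u f u).

Lemma entropyE (mu : probability T R) : shift_invariant mu ->
  exists2 h : R, entropy mu = h%:E & 0 <= h <= ln (N.+1)%:R.
Proof.
move=> inv; have [h [eh h0 hent _]] := entropy_spec gamma01 inv; exists h => //.
rewrite h0 -[h]mul1r (le_trans (hent 1%N))// (le_trans (ent_le_card _))//.
  by apply: distr_law; exact: label_prefix.
by rewrite card_tuple card_ord expn1.
Qed.

Lemma Rintegral_le_neg (mu : probability T R) : \int[mu]_u g u <= - l0.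
Proof.
apply: (@le_trans _ _ (\int[mu]_u (cst (- l0) u))).
  apply: le_Rintegral => //; first exact: integrable_holder.
    exact: finite_measure_integrable_cst.
rewrite Rintegral_cst// [fine _](_ : _ = 1) ?mulr1//.
exact: (congr1 fine (probability_setT mu)).
Qed.

Lemma root_lt C t e : zeta_root C f g t -> 0 < e ->
  exists2 r0, 0 < r0 & forall r, 0 < r -> r < r0 ->
    ((expR (- e))%:E < rad C t r)%E /\ (rad C t r < (expR e)%:E)%E.
Proof.
move=> root e0.
have oo : open [set x : \bar R | (expR (- e))%:E < x /\ x < (expR e)%:E]%E.
  by apply: openI; [exact: open_ereal_gt_ereal|exact: open_ereal_lt_ereal].
have := root _ (open_nbhs_nbhs (conj oo _)).
rewrite /= !lte_fin expR_lt1 expR_gt1 oppr_lt0 => /(_ (conj e0 e0)).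
rewrite /nbhs/= /at_right/within/= => /nbhs_ballP[r0 /= r00 H]; exists r0 => // r rp rr0.
apply: H => //=; rewrite /ball/= sub0r normrN gtr0_norm//.
Qed.

(** At a root the radius is below [expR e] for small [r], for every [e > 0]; monotonicity in [r]
    carries the bound to all [r], so the growth rate is at least 0 in every neighbourhood. *)
Lemma root_measure C t : closed C -> zeta_root C f g t ->
  exists mu, exists2 h : R, admissible C mu /\ entropy mu = h%:E & 0 <= h + t * \int[mu]_u g u.
Proof.
move=> cC root.
suff H : forall r e', 0 < r -> e' < 0 -> (rad C t r < (expR (- e'))%:E)%E.
  by have [mu [h [inv Cf eh le]]] := measure_of_sigma_rad cC H; exists mu, h.
move=> r e' r0 e'0; rewrite ltNge; apply/negP => le.
have e2 : 0 < - (e' / 2) by lra.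
have [r1 r10 H] := root_lt root e2.
have [_ ] := H (Num.min r (r1 / 2)) (ltac:(by rewrite lt_min r0 divr_gt0))
   (ltac:(rewrite gt_min; apply/orP; right; lra)).
rewrite ltNge => /negP; apply.
apply: (sigma_rad_nbhdS (r' := r)); first by rewrite ge_min lexx.
by rewrite (lt_le_trans _ le)// lte_fin ltr_expR; lra.
Qed.

Lemma root_measure_le C t mu h : zeta_root C f g t -> admissible C mu ->
  entropy mu = h%:E -> h + t * \int[mu]_u g u <= 0.
Proof.
move=> root [inv Cf] eh; rewrite leNgt; apply/negP => pos.
set e := h + _ in pos; have e2 : 0 < e / 2 by lra.
have [r1 r10 H] := root_lt root e2.
have [lt _] := H (r1 / 2) (ltac:(by rewrite divr_gt0)) (ltac:(lra)).
have := @sigma_rad_le_of_measure C t mu h (e / 2) inv Cf eh (ltac:(rewrite -/e; lra)) (r1 / 2).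
by rewrite leNgt lt; move=> /(_ (ltac:(by rewrite divr_gt0))).
Qed.

(** With [root_measure] and [root_measure_le] this characterises roots by
    [sup (h + t * \int g) = 0]. The value 0 has only to be approached, so that existence of a root
    can start from a supremum not yet known to be attained. *)
Lemma root_of_measures C t : closed C ->
  (forall eta, eta < 0 -> exists mu, exists2 h : R, admissible C mu /\ entropy mu = h%:E &
     eta < h + t * \int[mu]_u g u) ->
  (forall mu h, admissible C mu -> entropy mu = h%:E -> h + t * \int[mu]_u g u <= 0) ->
  zeta_root C f g t.
Proof.
move=> cC lo up.
have upper e r : 0 < e -> 0 < r -> (rad C t r <= (expR e)%:E)%E.
  move=> e0 r0; have [mu [h [[inv Cf] eh] he]] := lo (- e) (ltac:(lra)).
  by have := sigma_rad_le_of_measure inv Cf eh he r0; rewrite opprK.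
have lower e : 0 < e -> exists2 r0, 0 < r0 & forall r, r <= r0 -> ((expR (- e))%:E <= rad C t r)%E.
  move=> e0; apply: contrapT => nH.
  have [|mu [h [inv Cf eh le]]] := @measure_of_sigma_rad C t e cC.
    move=> r e' r0 e'e; rewrite ltNge; apply/negP => le; apply: nH.
    exists r; first exact: r0.
    move=> r' r'r; apply: (@sigma_rad_nbhdS C t e r' r r'r).
    by rewrite (lt_le_trans _ le)// lte_fin ltr_expR; lra.
  have := up mu h (conj inv Cf) eh; lra.
have both e : 0 < e -> \forall r \near 0^'+, ((expR (- e))%:E <= rad C t r)%E /\ (rad C t r <= (expR e)%:E)%E.
  move=> e0; have [r0 r00 H] := lower e e0.
  near=> r; split; first by apply: H; near: r; exact: nbhs_right_le.
  by apply: upper.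
apply/fine_cvgP; split.
  apply: filterS (both 1 ltr01) => r [h1 h2].
  by rewrite fin_numE -ltey -ltNye (lt_le_trans (ltNyr _) h1) (le_lt_trans h2 (ltry _)).
apply/cvgrPdist_le => /= e e0.
have e1 : 0 < 1 + e by rewrite addr_gt0.
have le0 : 0 < ln (1 + e) by rewrite ln_gt0// ltrDl.
apply: filterS (both _ le0) => r [h1 h2].
have fin : rad C t r \is a fin_num.
  by rewrite fin_numE -ltey -ltNye (lt_le_trans (ltNyr _) h1) (le_lt_trans h2 (ltry _)).
move: h1 h2; rewrite -{1 2}(fineK fin) !lee_fin expRN lnK ?posrE// => h1 h2.
have h3 : 1 - e <= (1 + e)^-1.
  rewrite -[leRHS]mul1r ler_pdivlMr// -subr_ge0.
  have -> : 1 - (1 - e) * (1 + e) = e ^+ 2 by ring.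
  exact: sqr_ge0.
rewrite ler_norml; lra.
Unshelve. all: by end_near.
Qed.

Lemma zeta_root_exists C : closed C -> (exists mu, admissible C mu) ->
  exists t, zeta_root C f g t.
Proof.
move=> cC [mu0 adm0].
pose E := [set x : R | exists mu, exists2 h : R, admissible C mu /\ entropy mu = h%:E &
   x = - (h / \int[mu]_u g u)].
have neg (mu : probability T R) : \int[mu]_u g u < 0 by rewrite (le_lt_trans (Rintegral_le_neg mu))// oppr_lt0.
have hE : has_sup E.
  split.
    have [h eh _] := entropyE (proj1 adm0).
    by exists (- (h / \int[mu0]_u g u)), mu0, h.
  exists (ln (N.+1)%:R / l0) => _ [mu [h [[inv Cf] eh] ->]].
  have [h' eh' /andP[h0 h1]] := entropyE inv.
  have hh : h = h' by move: eh; rewrite eh' => -[].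
  rewrite -mulrN -invrN ler_pM ?invr_ge0 ?oppr_ge0 ?(ltW (neg _)) ?hh//.
  by rewrite lef_pV2 ?posrE ?oppr_gt0// lerNr Rintegral_le_neg.
exists (sup E); apply: root_of_measures => //.
  move=> eta eta0.
  have [M M0 HM] := holder_bounded hg.
  (* Multiplying a defect of [- eta / M] in the quotient by [- \int g <= M] costs at most
     [- eta]. *)
  have [_ [mu [h [adm eh] ->]] lt] := sup_adherent (ltac:(by rewrite divr_gt0// oppr_gt0) : 0 < - eta / M) hE.
  exists mu, h => //; have ng := neg mu.
  have gM : - (\int[mu]_u g u) <= M.
    have := @le_Rintegral _ _ _ mu setT (cst (- M)) g measurableT _ (integrable_holder gamma01 mu hg) _.
    rewrite Rintegral_cst// [fine _](_ : _ = 1) ?mulr1; last exact: (congr1 fine (probability_setT mu)).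
    move=> H; rewrite lerNl; apply: H; first exact: finite_measure_integrable_cst.
    by move=> u _; have := HM u; rewrite ler_norml => /andP[].
  move: lt; rewrite -[X in _ < X]mulrN -invrN ltr_pdivlMr ?oppr_gt0// => lt.
  have h1 : - eta / M * - (\int[mu]_u g u) <= - eta.
    by rewrite -mulrA ger_pMr ?oppr_gt0// mulrC ler_pdivrMr// mul1r.
  move: lt; rewrite mulrBl; lra.
move=> mu h adm eh; have ng := neg mu.
have : - (h / \int[mu]_u g u) <= sup E by apply: sup_upper_bound => //; exists mu, h.
rewrite -mulrN -invrN ler_pdivrMr ?oppr_gt0//; lra.
Qed.

(** A measure realising the larger root [t'] would have a positive value of [h + t * \int g] at the
    smaller root, as [\int g < 0]. *)
Lemma zeta_root_unique C t t' : closed C -> zeta_root C f g t -> zeta_root C f g t' -> t = t'.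
Proof.
move=> cC; wlog lt : t t' / t < t' => [H rt rt'|rt rt'].
  have [lt|lt|//] := ltgtP t t'; first exact: H.
  exact/esym/H.
have [mu [h [adm eh] le]] := root_measure cC rt'.
have h1 := root_measure_le rt adm eh; have h2 := Rintegral_le_neg mu.
have : (t' - t) * \int[mu]_u g u < 0.
  by rewrite pmulr_rlt0 ?subr_gt0// (le_lt_trans h2)// oppr_lt0.
rewrite mulrBl; lra.
Qed.

Definition variational_sup C : \bar R :=
  ereal_sup [set
    ereal_sup [set (- (entropy mu / (\int[mu]_u g u)%:E))%E |
      mu in [set mu : probability T R | shift_invariant mu /\ \int[mu]_u f u = alpha]] |
    alpha in C].

Lemma frakf_root C t : closed C -> zeta_root C f g t -> frakf C f g = t%:E.
Proof.
move=> cC rt; apply: xget_unique; first by exists t.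
by move=> _ [t' rt' <-]; rewrite (zeta_root_unique cC rt rt').
Qed.

Lemma frakf_variational C : closed C -> frakf C f g = variational_sup C.
Proof.
move=> cC; have [adm|nadm] := pselect (exists mu, admissible C mu); last first.
  rewrite /frakf xgetPN.
    apply/esym/eqP; rewrite -leeNy_eq; apply: ge_ereal_sup => _ [al Cal <-].
    apply: ge_ereal_sup => _ [mu [inv fal] <-]; exfalso; apply: nadm.
    by exists mu; split => //; rewrite fal.
  move=> x [t rt _]; apply: nadm; have [mu [h [adm _] _]] := root_measure cC rt.
  by exists mu.
have [t rt] := zeta_root_exists cC adm; rewrite (frakf_root cC rt).
have ratioE (mu : probability T R) h : entropy mu = h%:E ->
    (- (entropy mu / (\int[mu]_u g u)%:E))%E = (- (h / \int[mu]_u g u))%:E.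
  move=> ->; rewrite inver; case: eqP => [e|_]; last by rewrite -EFinM -EFinN.
  by have := Rintegral_le_neg mu; rewrite e lerNr oppr0 leNgt l0_gt0.
have neg (mu : probability T R) : \int[mu]_u g u < 0 by rewrite (le_lt_trans (Rintegral_le_neg mu))// oppr_lt0.
apply/eqP; rewrite eq_le; apply/andP; split.
  have [mu [h [[inv Cf] eh] le]] := root_measure cC rt.
  apply: (@le_trans _ _ (- (entropy mu / (\int[mu]_u g u)%:E))%E).
    rewrite (ratioE _ _ eh) lee_fin -mulrN -invrN ler_pdivlMr ?oppr_gt0//; lra.
  apply: le_trans; last first.
    by apply: ereal_sup_ubound; exists (\int[mu]_u f u); [exact: Cf|reflexivity].
  by apply: ereal_sup_ubound; exists mu.
apply: ge_ereal_sup => _ [al Cal <-]; apply: ge_ereal_sup => _ [mu [inv fal] <-].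
have [h eh _] := entropyE inv.
have adm' : admissible C mu by split => //; rewrite fal.
have := root_measure_le rt adm' eh.
rewrite (ratioE _ _ eh) lee_fin -mulrN -invrN ler_pdivrMr ?oppr_gt0//; lra.
Qed.

End ZetaRoot.

(** * Conformal maps *)

Section DifferentialEstimates.
Variables (R : realType) (d : nat).
Local Notation E := 'rV[R]_d.
Implicit Types (x y u v : E) (X V Q : set E) (g : E -> E).

Lemma opnorm_bound (L : E -> E) M : (forall a u, L (a *: u) = a *: L u) ->
  (forall u, enorm (L u) <= M * enorm u) -> forall u, enorm (L u) <= opnorm L * enorm u.
Proof.
move=> Ls LM u; have [->|u0] := eqVneq u 0.
  by rewrite enorm0 mulr0 (le_trans (LM 0))// enorm0 mulr0.
have un := enorm_gt0 u0.
rewrite -ler_pdivrMr//.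
have -> : enorm (L u) / enorm u = enorm (L ((enorm u)^-1 *: u)).
  by rewrite Ls enormZ ger0_norm ?invr_ge0 ?enorm_ge0// mulrC.
apply: ub_le_sup.
  exists `|M| => _ [v v1 <-]; apply: le_trans (LM v) _.
  rewrite (@le_trans _ _ (`|M| * enorm v)) ?ler_wpM2r ?enorm_ge0 ?ler_norm//.
  by rewrite ler_piMr.
exists ((enorm u)^-1 *: u) => //=.
by rewrite enormZ ger0_norm ?invr_ge0 ?enorm_ge0// mulVf ?gt_eqF.
Qed.

(** Positive dimension supplies a unit vector, so that the ratio is determined and equals the
    operator norm. *)
Lemma similarity_opnorm (L : {linear E -> E}) : (0 < d)%N -> contractive_similarity L ->
  0 < opnorm L < 1 /\ forall u, enorm (L u) = opnorm L * enorm u.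
Proof.
move=> d0 [r r01 Lr].
have Lu u : enorm (L u) = r * enorm u by have := Lr u 0; rewrite linear0 !subr0.
suff -> : opnorm L = r by [].
pose e : E := delta_mx ord0 (Ordinal d0).
have e1 : enorm e = 1.
  rewrite /enorm (bigD1 (Ordinal d0))//= big1 ?addr0 => [|i ne].
    by rewrite !mxE !eqxx expr1n sqrtr1.
  by rewrite !mxE eqxx (negbTE ne) expr0n.
case/andP: r01 => r0 r1; apply/eqP; rewrite eq_le; apply/andP; split.
  apply: ge_sup; first by exists (enorm (L e)), e => //=; rewrite e1.
  by move=> _ [u u1 <-]; rewrite Lu ler_piMr// ltW.
apply: ub_le_sup.
  by exists r => _ [u u1 <-]; rewrite Lu ler_piMr// ltW.
by exists e; rewrite /= ?e1 ?Lu ?e1 ?mulr1.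
Qed.

(** [X] need not be convex, and segments between its points may leave it. Short ones stay in the
    compact set [Q] inside [V], where the Hölder bound on the differential holds. *)
Lemma compact_fattening X V : compact X -> open V -> X `<=` V ->
  exists2 delta : R, 0 < delta & exists Q, [/\ compact Q, Q `<=` V &
    forall x y, X x -> enorm (x - y) <= delta -> Q y].
Proof.
move=> cX oV XV.
have [delta d0 dV] : exists2 delta : R, 0 < delta &
    forall x y, X x -> `|x - y| <= delta -> V y.
  have /compact_near_coveringP := cX.
  move=> /(_ R (0^'+)%R (fun e x => forall y, `|x - y| <= e -> V y) _)[|r /= r0 H].
    move=> x /XV Vx.
    have /nbhs_ballP[e /= e0 eV] : nbhs x V by exact: open_nbhs_nbhs.
    have e2 : 0 < e / 2 by rewrite divr_gt0.
    exists (ball x (e / 2), [set t | t < e / 2]).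
      split => /=; first exact: nbhsx_ballx.
      exact: nbhs_right_lt.
    move=> [x' t] [/= bx' te] y ty; apply: eV.
    rewrite -ball_normE/= -[x](subrK x') -addrA.
    apply: le_lt_trans (ler_normD _ _) _.
    move: bx'; rewrite -ball_normE/= => bx'; move: te ty bx'.
    set p := `|_|; set q := `|_|; rewrite /=; lra.
  exists (r / 2); first by rewrite divr_gt0.
  move=> x y Xx; apply: (H (r / 2)) => //=; last by rewrite divr_gt0.
  by rewrite sub0r normrN gtr0_norm ?divr_gt0// ltr_pdivrMr// mulr2n mulrDr mulr1 ltrDl.
exists delta => //; exists ((fun p => p.1 + p.2) @` (X `*` [set z : E | `|z| <= delta])); split.
- apply: continuous_compact.
    apply: continuous_subspaceT => p; exact: add_continuous.
  apply: compact_setX => //; apply: bounded_closed_compact.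
    exists delta; split; first exact: num_real.
    by move=> M dM z /= zd; rewrite (le_trans zd)// ltW.
  apply: (@closed_comp _ _ (fun z : E => `|z|) [set t : R | t <= delta]).
    by move=> z _; exact: norm_continuous.
  exact: closed_le.
- move=> _ [[x z] /= [Xx zd] <-]; apply: (dV x) => //.
  by rewrite opprD addNKr normrN.
- move=> x y Xx xy; exists (x, y - x); last by rewrite /= subrKC.
  by split => //=; rewrite -normrN opprB (le_trans _ xy)// mxnorm_le_enorm.
Qed.

Lemma holder_within_continuous X (f : E -> R) (H eta : R) : 0 < eta ->
  (forall x y, X x -> X y -> `|f x - f y| <= H * enorm (x - y) `^ eta) ->
  {within X, continuous f}.
Proof.
move=> eta0 fH; apply/subspace_continuousP => x Xx.
have H0 : 0 < `|H| + 1 by rewrite ltr_wpDl.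
apply/cvgrPdist_le => e e0.
pose t := (e / (`|H| + 1)) `^ eta^-1 / d.+1%:R.
have t0 : 0 < t by rewrite divr_gt0// powR_gt0// divr_gt0.
suff near_x y : X y -> `|x - y| <= t -> `|f x - f y| <= e.
  rewrite near_withinE; apply/nbhs_ballP; exists t => //= y.
  by rewrite -ball_normE/= => /ltW xy Xy; exact: near_x.
move=> Xy xyt; apply: le_trans (fH x y Xx Xy) _.
have xy : enorm (x - y) <= (e / (`|H| + 1)) `^ eta^-1.
  apply: le_trans (enorm_le_mxnorm _) _.
  rewrite (@le_trans _ _ (d%:R * t))// ?ler_wpM2l//.
  by rewrite /t mulrCA ler_piMr ?powR_ge0// ler_pdivrMr// mul1r ler_nat.
have {xy} : enorm (x - y) `^ eta <= e / (`|H| + 1).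
  rewrite (le_trans (ge0_ler_powR _ _ _ xy)) ?nnegrE ?enorm_ge0 ?powR_ge0 ?(ltW eta0)//.
  by rewrite -powRrM mulVf ?gt_eqF// powRr1// ltW// divr_gt0.
rewrite ler_pdivlMr// => h.
apply: le_trans (ler_wpM2r (powR_ge0 _ _) (ler_norm H)) _.
by apply: le_trans h; rewrite mulrDr mulr1 mulrC lerDl powR_ge0.
Qed.

Lemma compact_lower_bound X (f : E -> R) (H eta : R) : compact X -> 0 < eta ->
  (forall x, X x -> 0 < f x) ->
  (forall x y, X x -> X y -> `|f x - f y| <= H * enorm (x - y) `^ eta) ->
  exists2 m, 0 < m & forall x, X x -> m <= f x.
Proof.
move=> cX eta0 f0 fH.
have [X0|/set0P/negP/negPn/eqP X0] := pselect (X !=set0); last by exists 1; rewrite // X0.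
have fc := holder_within_continuous eta0 fH.
have [c cX' cm] := compact_EVT_min X0 cX fc.
exists (f c); first by apply: f0; exact: set_mem.
by move=> x Xx; apply: cm; exact: mem_set.
Qed.

Lemma line_derivative g y v (j : 'I_d) (t : R) : differentiable g (y + t *: v) ->
  is_derive t 1 (fun s : R => (g (y + s *: v)) ord0 j) (('d g (y + t *: v) v) ord0 j).
Proof.
move=> dg.
have dl : is_diff t (cst y + *:%R ^~ v) (0 + *:%R ^~ v).
  exact: (@is_diffD _ _ _ _ _ _ _ _ (is_diff_cst y t) (is_diff_scalel t v)).
pose h : E -> R := fun z => z ord0 j.
have dc : is_diff (g (y + t *: v)) h h.
  have @c : {linear E -> R}.
    by exists h; do 2![eexists]; do ?[constructor];
       rewrite /h ?mxE// => ? *; rewrite ?mxE//; move=> ?; rewrite !mxE.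
  have cc : continuous c by exact: coord_continuous.
  have ch : h = c by [].
  split; rewrite ch; last exact: diff_lin.
  exact: linear_differentiable.
have dgi : is_diff ((cst y + *:%R ^~ v) t) g ('d g (y + t *: v)) by split.
have h1 := @is_diff_comp _ _ _ _ _ _ _ _ _ dl dgi.
have h2 := @is_diff_comp _ _ _ _ _ _ _ _ _ h1 dc.
have dh : differentiable (h \o (g \o (cst y + *:%R ^~ v))) t by case: h2.
apply: DeriveDef; first exact: diff_derivable.
transitivity ('d (h \o (g \o (cst y + *:%R ^~ v))) t 1); first exact: deriveE.
by case: h2 => _ ->; rewrite /= /h add0r scale1r.
Qed.

(* The mean value theorem is applied to each coordinate separately, whence the
   factor d. *)
Lemma differential_taylor g y v (M : R) :
  (forall t : R, 0 <= t <= 1 -> differentiable g (y + t *: v)) ->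
  (forall t : R, 0 <= t <= 1 -> enorm ('d g (y + v) v - 'd g (y + t *: v) v) <= M) ->
  enorm (g (y + v) - g y - 'd g (y + v) v) <= d%:R * M.
Proof.
move=> dg dM; apply: le_trans (enorm_le_sum _) _.
rewrite mulr_natl -[X in _ *+ X]card_ord -sumr_const; apply: ler_sum => j _.
have der (t : R) : 0 <= t <= 1 ->
    is_derive t 1 (fun s : R => (g (y + s *: v)) ord0 j) (('d g (y + t *: v) v) ord0 j).
  by move=> t01; apply: line_derivative; exact: dg.
have [|c|c c01] := MVT (f := fun s : R => (g (y + s *: v)) ord0 j)
    (df := fun t => ('d g (y + t *: v) v) ord0 j) (a := 0) (b := 1) ltr01.
- by move=> t /[!in_itv]/= /andP[t0 t1]; apply: der; rewrite !ltW.
- apply: derivable_within_continuous => t /[!in_itv]/= t01.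
  by have [] := der t t01.
rewrite scale1r scale0r addr0 subr0 mulr1 => e.
rewrite 4!mxE e.
have /andP[c0 c1] : 0 < c < 1 by move: c01; rewrite in_itv.
apply: le_trans (dM c _); last by rewrite !ltW.
rewrite -enormN opprB; apply: le_trans (coord_le_enorm _ j).
suff -> : forall a b : E, a ord0 j - b ord0 j = (a - b) ord0 j by [].
by move=> a b; rewrite !mxE.
Qed.

End DifferentialEstimates.

Section ConformalMaps.
Variables (R : realType) (d : nat).
Local Notation E := 'rV[R]_d.
Implicit Types (x y u v : E) (X V Q : set E) (g : E -> E) (r : E -> R).

Lemma common_constant (I : finType) (P : I -> R -> Prop) :
  (forall i e e', 0 < e' -> e' <= e -> P i e -> P i e') ->
  (forall i, exists2 e, 0 < e & P i e) -> exists2 e, 0 < e < 1 & forall i, P i e.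
Proof.
move=> mono /(_ _)/cid2 ex; pose f i := sval (ex i).
exists (\big[Num.min/2^-1]_i f i) => [|i].
  apply/andP; split.
    apply: lt_bigmin => [|i _]; first by rewrite invr_gt0.
    by rewrite /f; case: (ex i).
  by apply: le_lt_trans (bigmin_le_id _ _ _ _) _; rewrite invf_lt1// ltr1n.
apply: (mono i (f i)); [|exact: bigmin_le_cond|by rewrite /f; case: (ex i)].
by apply: lt_bigmin => [|j _]; rewrite ?invr_gt0// /f; case: (ex j).
Qed.

Lemma linear_subZ (L L' : {linear E -> E}) (a : R) z :
  L (a *: z) - L' (a *: z) = a *: (L z - L' z).
Proof. by have := linearZ_LR L a z; have := linearZ_LR L' a z => -> ->; rewrite scalerBr. Qed.

Lemma enorm_dist (u v : E) : `|enorm u - enorm v| <= enorm (u - v).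
Proof.
rewrite ler_norml; apply/andP; split.
  by have := enormD u (v - u); rewrite subrKC [enorm (v - u)]enormB; lra.
by have := enormD v (u - v); rewrite subrKC; lra.
Qed.

Lemma similarity_ratio_diff (L L' : {linear E -> E}) (r r' M : R) : (0 < d)%N ->
  (forall u, enorm (L u) = r * enorm u) -> (forall u, enorm (L' u) = r' * enorm u) ->
  opnorm (fun u => L u - L' u) <= M ->
  `|r - r'| <= M /\ forall u, enorm (L u - L' u) <= M * enorm u.
Proof.
move=> d0 Lr Lr' LM.
have H u : enorm (L u - L' u) <= M * enorm u.
  apply: le_trans (_ : _ <= opnorm (fun u => L u - L' u) * enorm u) _.
    apply: (opnorm_bound (L := fun u => L u - L' u) (M := r + r')) => [a z|z].
      exact: linear_subZ.
    rewrite mulrDl -Lr -Lr'; apply: le_trans (enormD _ _) _.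
    by rewrite enormN.
  by rewrite ler_wpM2r ?enorm_ge0.
split => //; pose e : E := delta_mx ord0 (Ordinal d0).
have e0 : 0 < enorm e.
  apply: enorm_gt0; apply/eqP => /matrixP/(_ ord0 (Ordinal d0))/eqP.
  by rewrite !mxE !eqxx oner_eq0.
rewrite -(ler_pM2r e0); apply: le_trans (H e).
rewrite -[X in _ * X]ger0_norm ?enorm_ge0// -normrM mulrBl -Lr -Lr'.
exact: enorm_dist.
Qed.

(** The single constant [e] bounds the ratios away from 0 and 1, gives the contraction margin, and
    its inverse is the Hölder constant. Since the estimates persist when [e] shrinks, one [e] serves
    all maps. The last two hold for distant points as well, where they become trivial. *)
Record conformal_estimates X (eta : R) g r (e : R) : Prop := {
  ratio_bounds : forall x, X x -> e <= r x <= 1 - e ;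
  ratio_holder : forall x y, X x -> X y -> `|r x - r y| <= e^-1 * enorm (x - y) `^ eta ;
  estimates_contract : forall x y, X x -> X y ->
    enorm (g x - g y) <= (1 - e) * enorm (x - y) ;
  estimates_upper : forall x y, X x -> X y ->
    enorm (g x - g y) <= r x * enorm (x - y) * (1 + e^-1 * enorm (x - y) `^ eta) ;
  estimates_lower : forall x y, X x -> X y ->
    r x * enorm (x - y) * (1 - e^-1 * enorm (x - y) `^ eta) <= enorm (g x - g y) }.

Lemma conformal_estimates_le X eta g r e e' : 0 < e' -> e' <= e ->
  conformal_estimates X eta g r e -> conformal_estimates X eta g r e'.
Proof.
move=> e'0 e'e [h1 h2 h3 h4 h5]; have e0 := lt_le_trans e'0 e'e.
have ie : e^-1 <= e'^-1 by rewrite lef_pV2.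
have r0 x : X x -> 0 <= r x by move=> /h1/andP[h _]; rewrite (le_trans _ h)// ltW.
have iH x y : e^-1 * enorm (x - y) `^ eta <= e'^-1 * enorm (x - y) `^ eta.
  by rewrite ler_wpM2r ?powR_ge0.
split.
- by move=> x /h1/andP[? ?]; apply/andP; split; lra.
- by move=> x y Xx Xy; rewrite (le_trans (h2 x y Xx Xy)).
- move=> x y Xx Xy; rewrite (le_trans (h3 x y Xx Xy))// ler_wpM2r ?enorm_ge0//; lra.
- move=> x y Xx Xy; rewrite (le_trans (h4 x y Xx Xy))//.
  by rewrite ler_wpM2l ?mulr_ge0 ?enorm_ge0 ?r0// lerD2l.
- move=> x y Xx Xy; rewrite (le_trans _ (h5 x y Xx Xy))//.
  by rewrite ler_wpM2l ?mulr_ge0 ?enorm_ge0 ?r0// lerD2l lerN2.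
Qed.

Lemma conformal_estimates_exist X V eta g : (0 < d)%N -> compact X -> open V -> X `<=` V ->
  0 < eta -> C1plus eta V g -> contractive V g ->
  (forall x, V x -> contractive_similarity ('d g x)) ->
  exists2 e, 0 < e & conformal_estimates X eta g (fun x => opnorm ('d g x)) e.
Proof.
move=> d0 cX oV XV eta0 [dg gH] [c /andP[c0 c1] gc] sim.
have [delta dl0 [Q [cQ QV QX]]] := compact_fattening cX oV XV.
have [H0 H0Q] := gH Q cQ QV; pose H : R := `|H0|.
have HH : 0 <= H by exact: normr_ge0.
have HQ x y : Q x -> Q y ->
    opnorm (fun u => 'd g x u - 'd g y u) <= H * enorm (x - y) `^ eta.
  by move=> Qx Qy; rewrite (le_trans (H0Q x y Qx Qy))// ler_wpM2r ?powR_ge0// ler_norm.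
have XQ x : X x -> Q x by move=> Xx; apply: (QX x) => //; rewrite subrr enorm0 ltW.
set r := fun x => opnorm ('d g x).
have r01 x : V x -> 0 < r x < 1 by move=> /sim/(similarity_opnorm d0)[].
have rE x u : V x -> enorm ('d g x u) = r x * enorm u.
  by move=> /sim/(similarity_opnorm d0)[].
have rDH x y : Q x -> Q y -> `|r x - r y| <= H * enorm (x - y) `^ eta /\
    forall u, enorm ('d g x u - 'd g y u) <= H * enorm (x - y) `^ eta * enorm u.
  move=> Qx Qy; apply: similarity_ratio_diff d0 _ _ (HQ x y Qx Qy) => u.
    by apply: rE; exact: QV.
  by apply: rE; exact: QV.
have rH x y : Q x -> Q y -> `|r x - r y| <= H * enorm (x - y) `^ eta.
  by move=> Qx Qy; case: (rDH x y Qx Qy).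
have DH x y u : Q x -> Q y ->
    enorm ('d g x u - 'd g y u) <= H * enorm (x - y) `^ eta * enorm u.
  by move=> Qx Qy; case: (rDH x y Qx Qy).
have [m1 m10 m1r] : exists2 m, 0 < m & forall x, X x -> m <= r x.
  apply: (compact_lower_bound cX eta0 (H := H)) => [x /XV/r01/andP[]//|x y /XQ Qx /XQ Qy].
  exact: rH.
have [m2 m20 m2r] : exists2 m, 0 < m & forall x, X x -> m <= 1 - r x.
  apply: (compact_lower_bound cX eta0 (H := H)) => [x /XV/r01/andP[_]|x y /XQ Qx /XQ Qy].
    by rewrite subr_gt0.
  by rewrite opprB addrC addrA subrK distrC; exact: rH.
(* The whole segment from [y] to [x] lies within [delta] of [x], hence in [Q]. *)
have taylor x y : X x -> enorm (x - y) <= delta ->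
    enorm (g x - g y - 'd g x (x - y)) <= d%:R * (H * enorm (x - y) `^ eta * enorm (x - y)).
  move=> Xx xy.
  have xz t : 0 <= t <= 1 -> enorm (x - (y + t *: (x - y))) <= enorm (x - y).
    move=> /andP[t0 t1].
    have -> : x - (y + t *: (x - y)) = (1 - t) *: (x - y).
      by rewrite scalerBl scale1r opprD addrA.
    rewrite enormZ ger0_norm ?subr_ge0// ler_piMl ?enorm_ge0//.
    by rewrite gerBl.
  have Qz t : 0 <= t <= 1 -> Q (y + t *: (x - y)).
    by move=> t01; apply: (QX x) => //; rewrite (le_trans (xz t t01)).
  have := @differential_taylor _ _ g y (x - y) (H * enorm (x - y) `^ eta * enorm (x - y)).
  rewrite subrKC; apply => t t01; first by apply: dg; exact/QV/Qz.
  apply: le_trans (DH _ _ _ (XQ _ Xx) (Qz t t01)) _.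
  apply: ler_wpM2r (enorm_ge0 _) _ _ _; apply: ler_wpM2l HH _ _ _.
  apply: ge0_ler_powR (ltW eta0) _ _ (enorm_ge0 _) (enorm_ge0 _) (xz t t01).
(* The summands serve the Hölder bound on the ratio, the Taylor error relative to a ratio of at
   least [m1], and the pairs farther apart than [delta]. *)
pose L := H + d%:R * H / m1 + (m1 * delta `^ eta)^-1 + 1.
have dp : 0 < delta `^ eta by rewrite powR_gt0.
have md0 : 0 < m1 * delta `^ eta by rewrite mulr_gt0.
have L2 : 0 <= d%:R * H / m1 by rewrite !mulr_ge0 ?invr_ge0 ?(ltW m10).
have L3 : 0 < (m1 * delta `^ eta)^-1 by rewrite invr_gt0.
have L0 : 0 < L by rewrite /L; lra.
have c'0 : 0 < 1 - c by lra.
exists (Num.min (Num.min m1 m2) (Num.min (1 - c) L^-1)).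
  by rewrite !lt_min m10 m20 c'0 invr_gt0 L0.
set e := Num.min _ _.
have e0 : 0 < e by rewrite !lt_min m10 m20 c'0 invr_gt0 L0.
have : e <= e by []; rewrite {2}/e !le_min => /andP[/andP[em1 em2] /andP[ec eL]].
have Le : L <= e^-1 by rewrite -[L]invrK lef_pV2 ?posrE ?invr_gt0.
have near_lin x y : X x -> enorm (x - y) <= delta ->
    `|enorm (g x - g y) - r x * enorm (x - y)| <=
    r x * enorm (x - y) * (e^-1 * enorm (x - y) `^ eta).
  move=> Xx xy; have T := taylor x y Xx xy.
  have {}T := le_trans (enorm_dist _ _) T.
  have er : enorm ('d g x (x - y)) = r x * enorm (x - y) by apply: rE; exact: XV.
  rewrite er in T; apply: le_trans T _.
  have -> : d%:R * (H * enorm (x - y) `^ eta * enorm (x - y)) =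
     (d%:R * H / m1) * m1 * enorm (x - y) * enorm (x - y) `^ eta.
    by rewrite divfK ?gt_eqF//; ring.
  rewrite mulrA ler_wpM2r ?powR_ge0// [leRHS]mulrAC ler_wpM2r ?enorm_ge0//.
  rewrite mulrC ler_pM ?(ltW m10)//; first exact: m1r.
  by apply: le_trans Le; rewrite /L; lra.
(* For distant points the upper estimate exceeds the distance of [x] and [y], and the lower one is
   not positive. *)
have far x y : X x -> delta < enorm (x - y) -> 1 <= m1 * (e^-1 * enorm (x - y) `^ eta).
  move=> Xx xy.
  have h1 : (m1 * delta `^ eta)^-1 <= e^-1 by apply: le_trans Le; rewrite /L; lra.
  have h2 : delta `^ eta <= enorm (x - y) `^ eta.
    by apply: ge0_ler_powR; rewrite ?nnegrE ?enorm_ge0 ?(ltW eta0) ?(ltW dl0) ?(ltW xy).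
  rewrite -(mulVf (lt0r_neq0 md0)) mulrCA ler_wpM2l ?(ltW m10)//.
  by rewrite ler_pM ?(ltW L3) ?(ltW dp).
split.
- move=> x Xx; have h1 := m1r x Xx; have h2 := m2r x Xx; clear - h1 h2 em1 em2.
  by apply/andP; split; lra.
- move=> x y /XQ Qx /XQ Qy; apply: le_trans (rH x y Qx Qy) _.
  by rewrite ler_wpM2r ?powR_ge0// (le_trans _ Le)// /L; lra.
- move=> x y /XV Vx /XV Vy; apply: le_trans (gc x y Vx Vy) _.
  rewrite ler_wpM2r ?enorm_ge0//; lra.
- move=> x y Xx Xy; have [xy|xy] := leP (enorm (x - y)) delta.
    have := near_lin x y Xx xy; rewrite ler_norml => /andP[_]; rewrite mulrDr mulr1; lra.
  have h := far x y Xx xy.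
  have h2 : enorm (g x - g y) <= enorm (x - y).
    by rewrite (le_trans (gc x y (XV _ Xx) (XV _ Xy)))// ler_piMl ?enorm_ge0// ltW.
  rewrite (le_trans h2)// mulrAC ler_peMl ?enorm_ge0// (le_trans h)//.
  rewrite ler_pM ?(ltW m10) ?mulr_ge0 ?powR_ge0 ?invr_ge0 ?(ltW e0)//; first exact: m1r.
  by rewrite lerDr.
- move=> x y Xx Xy; have [xy|xy] := leP (enorm (x - y)) delta.
    have := near_lin x y Xx xy; rewrite ler_norml => /andP[+ _]; rewrite mulrDr mulr1 mulrN; lra.
  have h := far x y Xx xy.
  apply: le_trans (enorm_ge0 _); rewrite mulr_ge0_le0 ?mulr_ge0 ?enorm_ge0//.
    by case/andP: (r01 x (XV _ Xx)) => /ltW.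
  rewrite subr_le0 (le_trans h)// ler_piMl//.
    by rewrite mulr_ge0 ?powR_ge0 ?invr_ge0 ?(ltW e0).
  by have h1 := m1r x Xx; have h2 := m2r x Xx; clear - h1 h2 m20; lra.
Qed.

End ConformalMaps.

(** * Word maps and the coding map *)

Lemma mkseq_shift N (u : code_space N) n : mkseq u n.+1 = u 0%N :: mkseq (shift u) n.
Proof.
by rewrite /mkseq/= -[in iota 1 n](addn0 1%N) iotaDl -map_comp.
Qed.

Lemma mkseq_addn N (u : code_space N) m n :
  mkseq u (m + n) = mkseq u m ++ mkseq (iter m (@shift N) u) n.
Proof.
elim: m u => // m IH u.
by rewrite addSn !mkseq_shift IH iterSr.
Qed.

Lemma ler_of_eq (R : numDomainType) (x y : R) : x = y -> x <= y.
Proof. by move=> ->. Qed.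

Section WordMaps.
Variables (R : realType) (d N : nat).
Local Notation E := 'rV[R]_d.
Local Notation letters := 'I_N.+1.
Variables (X K : set E) (S : letters -> E -> E) (r : letters -> E -> R) (eta e Delta : R).
Hypotheses (e01 : 0 < e < 1) (eta0 : 0 < eta) (cX : compact X).
Hypothesis SX : forall i, S i @` X `<=` X.
Hypothesis est : forall i, conformal_estimates X eta (S i) (r i) e.
Hypotheses (Delta0 : 0 < Delta) (XDelta : forall x y, X x -> X y -> enorm (x - y) <= Delta).
Implicit Types (w : seq letters) (u v : code_space N) (x y : E).

Let e0 : 0 < e. Proof. by case/andP: e01. Qed.
Let e1 : 0 < 1 - e. Proof. by case/andP: e01; rewrite subr_gt0. Qed.
(** Behind a word of length [n] distances have shrunk by [(1 - e) ^+ n], so Hölder errors shrink by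
    [q ^+ n]. The partial sums [s n] are carried through the inductions on words. *)
Let q := (1 - e) `^ eta.
Let q01 : 0 < q < 1.
Proof.
have h1 : 1 `^ eta = 1 :> R by rewrite powR1.
rewrite /q powR_gt0//= -[ltRHS]h1 gt0_ltr_powR ?nnegrE ?ler01 ?(ltW e1)//.
by rewrite ltrBlDr ltrDl.
Qed.
Let q_pow n : ((1 - e) ^+ n) `^ eta = q ^+ n.
Proof.
elim: n => [|n IH]; first by rewrite !expr0 powR1.
by rewrite !exprS powRM ?exprn_ge0 ?(ltW e1)// IH.
Qed.
Let s n := \sum_(0 <= k < n) q ^+ k.
Let s_le n : s n <= (1 - q)^-1.
Proof.
case/andP: q01 => q0 q1; rewrite -[leRHS]mul1r.
have -> : s n = series (geometric 1 q) n by apply: eq_bigr => k _; rewrite /= mul1r.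
by apply: geometric_le_lim => //; rewrite gtr0_norm.
Qed.
Let sS n : s n.+1 = s n + q ^+ n.
Proof. by rewrite /s big_nat_recr. Qed.
Let s0 : s 0 = 0. Proof. by rewrite /s big_geq. Qed.
Let q1_gt0 : 0 < (1 - q)^-1.
Proof. by case/andP: q01 => _ ?; rewrite invr_gt0 subr_gt0. Qed.

(** The chain rule product: the contraction ratio of the differential of [word_map S w] at [x]. *)
Fixpoint word_ratio w x : R :=
  if w is a :: w' then r a (word_map S w' x) * word_ratio w' x else 1.

Lemma word_map_X w x : X x -> X (word_map S w x).
Proof. by move=> Xx; elim: w => //= a w IH; apply: (SX (i := a)); exists (word_map S w x). Qed.

Lemma word_map_cat w w' x : word_map S (w ++ w') x = word_map S w (word_map S w' x).
Proof. by elim: w => //= a w ->. Qed.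

Lemma word_contract w x y : X x -> X y ->
  enorm (word_map S w x - word_map S w y) <= (1 - e) ^+ size w * enorm (x - y).
Proof.
move=> Xx Xy; elim: w => [|a w IH] /=; first by rewrite expr0 mul1r.
apply: le_trans (estimates_contract (est a) (word_map_X w Xx) (word_map_X w Xy)) _.
by rewrite exprS -mulrA ler_wpM2l// ltW.
Qed.

Lemma word_ratio_gt0 w x : X x -> 0 < word_ratio w x.
Proof.
move=> Xx; elim: w => [|a w IH] /=; first exact: ltr01.
have /andP[h _] := ratio_bounds (est a) (word_map_X w Xx).
exact: mulr_gt0 (lt_le_trans e0 h) IH.
Qed.

Let pow_contract w x y (t : R) : X x -> X y -> enorm (x - y) <= t ->
  enorm (word_map S w x - word_map S w y) `^ eta <= q ^+ size w * t `^ eta.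
Proof.
move=> Xx Xy xyt; have t0 : 0 <= t := le_trans (enorm_ge0 _) xyt.
have -> : q ^+ size w * t `^ eta = ((1 - e) ^+ size w * t) `^ eta.
  by rewrite powRM ?exprn_ge0 ?(ltW e1)// q_pow.
apply: ge0_ler_powR; rewrite ?nnegrE ?enorm_ge0 ?(ltW eta0)//.
  by rewrite mulr_ge0// exprn_ge0// ltW.
apply: le_trans (word_contract w Xx Xy) _.
by rewrite ler_wpM2l// exprn_ge0// ltW.
Qed.

(** Each letter contributes a factor [1 + b * q ^+ k <= expR (b * q ^+ k)], and the exponents form a
    geometric series. *)
Lemma word_upper : exists2 B : R, 0 < B & forall w x y, X x -> X y ->
  enorm (word_map S w x - word_map S w y) <= B * word_ratio w x * enorm (x - y).
Proof.
pose b := e^-1 * Delta `^ eta.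
have b0 : 0 < b by rewrite mulr_gt0 ?invr_gt0 ?powR_gt0.
exists (expR (b * (1 - q)^-1)); first exact: expR_gt0.
move=> w x y Xx Xy.
apply: (@le_trans _ _ (expR (b * s (size w)) * word_ratio w x * enorm (x - y))); last first.
  rewrite ler_wpM2r ?enorm_ge0// ler_wpM2r ?(ltW (word_ratio_gt0 _ _))//.
  by rewrite ler_expR ler_wpM2l// ltW.
elim: w => [|a w IH] /=; first by rewrite s0 mulr0 expR0 !mul1r.
have Xwx := word_map_X w Xx; have Xwy := word_map_X w Xy.
apply: le_trans (estimates_upper (est a) Xwx Xwy) _.
have /andP[ra _] := ratio_bounds (est a) Xwx.
have ra0 := lt_le_trans e0 ra.
have h : 1 + e^-1 * enorm (word_map S w x - word_map S w y) `^ eta <= expR (b * q ^+ size w).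
  apply: le_trans (expR_ge1Dx _); rewrite lerD2l /b -mulrA ler_wpM2l ?invr_ge0 ?(ltW e0)//.
  by rewrite mulrC pow_contract// XDelta.
rewrite sS [b * (_ + _)]mulrDr expRD.
apply: le_trans (_ : _ <= (r a (word_map S w x) * (expR (b * s (size w)) * word_ratio w x *
   enorm (x - y))) * expR (b * q ^+ size w)) _; last by apply: ler_of_eq; ring.
rewrite ler_pM ?mulr_ge0 ?enorm_ge0 ?(ltW ra0)//.
  by rewrite addr_ge0// mulr_ge0 ?powR_ge0 ?invr_ge0 ?(ltW e0).
by rewrite ler_wpM2l// ltW.
Qed.

(** Only nearby points: for these the factors are at least [1 - q ^+ k / 2], whereas for distant
    ones the lower estimate may be vacuous. The choice of [t] makes the error factor exactly 1/2 at
    distance [t]. *)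
Lemma word_lower : exists2 B : R, 0 < B & exists2 t : R, 0 < t &
  forall w x y, X x -> X y -> enorm (x - y) <= t ->
  word_ratio w x * enorm (x - y) <= B * enorm (word_map S w x - word_map S w y).
Proof.
exists (expR ((1 - q)^-1)); first exact: expR_gt0.
exists ((e / 2) `^ eta^-1); first by rewrite powR_gt0// divr_gt0.
set t := _ `^ _; move=> w x y Xx Xy xyt.
have te : e^-1 * t `^ eta = 2^-1.
  rewrite /t -powRrM mulVf ?gt_eqF// powRr1 ?divr_ge0 ?(ltW e0)//.
  by rewrite mulrA mulVf ?gt_eqF// mul1r.
apply: (@le_trans _ _ (expR (s (size w)) *
    enorm (word_map S w x - word_map S w y))); last first.
  by rewrite ler_wpM2r ?enorm_ge0// ler_expR.
elim: w => [|a w IH] /=; first by rewrite s0 expR0 !mul1r.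
have Xwx := word_map_X w Xx; have Xwy := word_map_X w Xy.
have /andP[ra _] := ratio_bounds (est a) Xwx.
have ra0 := lt_le_trans e0 ra.
have low := estimates_lower (est a) Xwx Xwy.
set z := enorm (word_map S w x - word_map S w y) in IH low; set z' := enorm (S a _ - _) in low *.
have zt : e^-1 * z `^ eta <= q ^+ size w / 2.
  apply: (@le_trans _ _ (e^-1 * (q ^+ size w * t `^ eta))).
    by rewrite ler_wpM2l ?invr_ge0 ?(ltW e0)// pow_contract.
  by rewrite mulrCA te.
have qn : 0 <= q ^+ size w <= 1.
  by case/andP: q01 => q0 q1; rewrite exprn_ge0 ?exprn_ile1 ?(ltW q0) ?(ltW q1).
(* [(1 - p / 2) * expR p >= (1 - p / 2) * (1 + p) >= 1] for [0 <= p <= 1] *)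
have h : 1 <= (1 - e^-1 * z `^ eta) * expR (q ^+ size w).
  move: zt qn; set p := q ^+ _; set p' := e^-1 * _ => zt /andP[p0 p1].
  apply: (@le_trans _ _ ((1 - p / 2) * (1 + p))).
    have := mulr_ge0 p0 (ltac:(lra) : 0 <= 1 - p); lra.
  apply: ler_pM; [lra|lra|lra|exact: expR_ge1Dx].
have z0 : 0 <= z := enorm_ge0 _.
rewrite sS expRD.
apply: (@le_trans _ _ (r a (word_map S w x) * (expR (s (size w)) * z))).
  by rewrite -mulrA ler_wpM2l// ltW.
apply: (@le_trans _ _ (r a (word_map S w x) * (expR (s (size w)) * z) *
    ((1 - e^-1 * z `^ eta) * expR (q ^+ size w)))).
  by rewrite ler_peMr// !mulr_ge0 ?expR_ge0 ?(ltW ra0).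
apply: le_trans (_ : _ <= (expR (s (size w)) * expR (q ^+ size w)) *
  (r a (word_map S w x) * z * (1 - e^-1 * z `^ eta))) _; first by apply: ler_of_eq; ring.
by rewrite ler_wpM2l// mulr_ge0 ?expR_ge0.
Qed.

(** Bounded distortion: ratios are at least [e], so Hölder differences are relative errors, summable
    along the word. *)
Lemma word_distortion : exists2 B : R, 0 < B & forall w x y, X x -> X y ->
  word_ratio w x <= B * word_ratio w y.
Proof.
pose b := e^-1 * (e^-1 * Delta `^ eta).
have b0 : 0 < b by rewrite !mulr_gt0 ?invr_gt0 ?powR_gt0.
exists (expR (b * (1 - q)^-1)); first exact: expR_gt0.
move=> w x y Xx Xy.
apply: (@le_trans _ _ (expR (b * s (size w)) * word_ratio w y)); last first.
  rewrite ler_wpM2r ?(ltW (word_ratio_gt0 _ _))//.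
  by rewrite ler_expR ler_wpM2l// ltW.
elim: w => [|a w IH] /=; first by rewrite s0 mulr0 expR0 !mul1r.
have Xwx := word_map_X w Xx; have Xwy := word_map_X w Xy.
have /andP[ra _] := ratio_bounds (est a) Xwx; have ra0 := lt_le_trans e0 ra.
have /andP[rb _] := ratio_bounds (est a) Xwy; have rb0 := lt_le_trans e0 rb.
have h : r a (word_map S w x) <= r a (word_map S w y) * expR (b * q ^+ size w).
  have := le_trans (ler_norm _) (ratio_holder (est a) Xwx Xwy).
  have := pow_contract w Xx Xy (XDelta Xx Xy).
  move: (enorm (_ - _) `^ _) => z zq h.
  apply: (@le_trans _ _ (r a (word_map S w y) * (1 + b * q ^+ size w))); last first.
    by rewrite ler_wpM2l ?(ltW rb0)// expR_ge1Dx.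
  have h1 : e^-1 * z <= e^-1 * (q ^+ size w * Delta `^ eta).
    by rewrite ler_wpM2l ?invr_ge0 ?(ltW e0).
  rewrite mulrDr mulr1 -lerBlDl (le_trans h)// (le_trans h1)//.
  have -> : e^-1 * (q ^+ size w * Delta `^ eta) = e * (b * q ^+ size w).
    rewrite /b (_ : e * _ = e * e^-1 * (e^-1 * (q ^+ size w * Delta `^ eta))); last by ring.
    by rewrite divff ?gt_eqF// mul1r.
  by rewrite ler_wpM2r// mulr_ge0 ?(ltW b0)// exprn_ge0//; case/andP: q01 => /ltW.
rewrite sS [b * (_ + _)]mulrDr expRD.
apply: le_trans (_ : _ <= (r a (word_map S w y) * expR (b * q ^+ size w)) *
    (expR (b * s (size w)) * word_ratio w y)) _; last by apply: ler_of_eq; ring.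
by rewrite ler_pM// ltW// word_ratio_gt0.
Qed.

Hypothesis hK : self_conformal_set X S K.

Let KX : K `<=` X. Proof. by case: hK. Qed.
Let cK : compact K. Proof. by case: hK. Qed.

Lemma word_map_K w x : K x -> K (word_map S w x).
Proof.
move=> Kx; elim: w => //= a w IH; have [_ _ _ ->] := hK.
by exists a => //; exists (word_map S w x).
Qed.

Lemma word_map_continuous w : {within K, continuous (word_map S w)}.
Proof.
apply/subspace_continuousP => x Kx; apply/cvgrPdist_le => t t0.
rewrite near_withinE; apply/nbhs_ballP.
exists (t / d.+1%:R) => /= [|y]; first by rewrite divr_gt0.
rewrite -ball_normE/= => /ltW xy Ky.
apply: le_trans (mxnorm_le_enorm _) _.
apply: le_trans (word_contract w (KX Kx) (KX Ky)) _.
apply: (@le_trans _ _ (enorm (x - y))).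
  rewrite ler_piMl ?enorm_ge0// exprn_ile1 ?(ltW e1)//.
  by rewrite gerBl ltW.
apply: le_trans (enorm_le_mxnorm _) _.
rewrite (@le_trans _ _ (d%:R * (t / d.+1%:R))) ?ler_wpM2l//.
by rewrite mulrCA ler_piMr ?(ltW t0)// ler_pdivrMr// mul1r ler_nat.
Qed.

Let nested u := \bigcap_n (word_map S (mkseq u n) @` K).

(** A cluster point of the images of one base point under the prefixes lies in every [K_(u|m)],
    because these sets are closed and contain all later images. *)
Lemma nested_nonempty u : nested u !=set0.
Proof.
have [[k0 Kk0] _ _ _] := hK.
pose x n := word_map S (mkseq u n) k0.
have xK n : K (x n) by exact: word_map_K.
have xFK : (x @ \oo) K by exists 0%N => // n _; exact: xK.
have [p [Kp cp]] := cK _ xFK.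
exists p => m _.
have cl : closed (word_map S (mkseq u m) @` K).
  apply: compact_closed; first exact: norm_hausdorff.
  by apply: continuous_compact => //; exact: word_map_continuous.
apply: cl => B pB; apply: cp pB; exists m => // n /= mn.
exists (word_map S (mkseq (iter m (@shift N) u) (n - m)) k0); first exact: word_map_K.
by rewrite -word_map_cat -mkseq_addn subnKC.
Qed.

Lemma nested_dist u n x y : (word_map S (mkseq u n) @` K) x -> (word_map S (mkseq u n) @` K) y ->
  enorm (x - y) <= (1 - e) ^+ n * Delta.
Proof.
move=> [x' Kx <-] [y' Ky <-]; apply: le_trans (word_contract _ (KX Kx) (KX Ky)) _.
rewrite size_mkseq ler_wpM2l ?exprn_ge0 ?(ltW e1)//.
by apply: XDelta; exact: KX.
Qed.

Lemma coding_map_unique u x : nested u x -> coding_map S K u = x.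
Proof.
move=> nx; apply: xget_unique => // y ny.
apply/eqP; rewrite eq_sym -subr_eq0; apply/negPn/negP => /enorm_gt0 xy.
have xy' : 0 < enorm (x - y) / Delta by rewrite divr_gt0.
have q1 : 0 < 1 - e < 1 by rewrite e1 ltrBlDr ltrDl.
have [n h] := expr_small q1 xy'.
have := nested_dist (ny n I) (nx n I).
rewrite -ler_pdivrMr// enormB.
by rewrite leNgt h.
Qed.

Lemma coding_map_nested u n : (word_map S (mkseq u n) @` K) (coding_map S K u).
Proof. by have [x nx] := nested_nonempty u; rewrite (coding_map_unique nx); exact: nx. Qed.

Lemma coding_map_K u : K (coding_map S K u).
Proof. by have [x Kx <-] := coding_map_nested u 0. Qed.

Lemma coding_map_shift1 u : coding_map S K u = S (u 0%N) (coding_map S K (shift u)).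
Proof.
apply: coding_map_unique => -[|n] _.
  exists (S (u 0%N) (coding_map S K (shift u))) => //.
  exact: (@word_map_K [:: u 0%N]) (coding_map_K _).
rewrite mkseq_shift; have [x Kx <-] := coding_map_nested (shift u) n.
by exists x.
Qed.

Lemma coding_map_shift u n :
  coding_map S K u = word_map S (mkseq u n) (coding_map S K (iter n (@shift N) u)).
Proof.
elim: n u => // n IH u.
by rewrite iterSr coding_map_shift1 mkseq_shift/= (IH (shift u)).
Qed.

Lemma coding_map_dist n u v : agree n u v ->
  enorm (coding_map S K u - coding_map S K v) <= (1 - e) ^+ n * Delta.
Proof.
move=> uv; apply: (nested_dist (u := u)); first exact: coding_map_nested.
have -> : mkseq u n = mkseq v n.
  by apply/eq_in_map => k; rewrite mem_iota => /andP[_ kn]; exact: uv.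
exact: coding_map_nested.
Qed.

Let Lambda u := ln (r (u 0%N) (coding_map S K (shift u))).

Let ratio_coding u : e <= r (u 0%N) (coding_map S K (shift u)) <= 1 - e.
Proof. by apply: (ratio_bounds (est _)); exact/KX/coding_map_K. Qed.

Lemma scaling_le u : Lambda u <= ln (1 - e).
Proof.
have /andP[h h'] := ratio_coding u.
by rewrite ler_ln ?posrE// (lt_le_trans e0 h).
Qed.

(** The bridge between Birkhoff sums of the scaling map and the geometry of the pieces [K_(u|n)]. *)
Lemma expR_birkhoff_scaling n u : expR (birkhoff_sum Lambda n u) =
  word_ratio (mkseq u n) (coding_map S K (iter n (@shift N) u)).
Proof.
elim: n u => [|n IH] u; first by rewrite birkhoff0 expR0.
rewrite birkhoffSl expRD IH iterSr mkseq_shift/= lnK; last first.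
  by have /andP[h _] := ratio_coding u; rewrite posrE (lt_le_trans e0 h).
by rewrite -coding_map_shift.
Qed.

Lemma ln_dist_le (a b : R) : e <= a -> e <= b -> `|ln a - ln b| <= e^-1 * `|a - b|.
Proof.
wlog ab : a b / b <= a => [H ea eb|ea eb].
  have [/ltW ab|ab] := ltP a b; last exact: H.
  by rewrite distrC [`|a - b|]distrC; exact: H.
have a0 := lt_le_trans e0 ea; have b0 := lt_le_trans e0 eb.
rewrite !ger0_norm ?subr_ge0// ?ler_ln ?posrE//.
rewrite -ln_div ?posrE//; have := @le_ln1Dx R (a / b - 1).
rewrite subrKC => h; apply: le_trans (h _) _.
  by rewrite ltrBrDl subrr divr_gt0.
rewrite -[X in _ - X](divff (lt0r_neq0 b0)) -mulrBl mulrC ler_wpM2r ?subr_ge0//.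
by rewrite lef_pV2.
Qed.

(** The rate is [q], unrelated to [gamma]. Agreement on [n.+1] letters fixes the map and only [n]
    letters of the shifted point, whence the division by [q]; the case of no common letter is
    covered by the oscillation [e^-1]. *)
Lemma scaling_holder : holder_code Lambda.
Proof.
pose b := e^-1 * (e^-1 * Delta `^ eta).
have b0 : 0 < b by rewrite !mulr_gt0 ?invr_gt0 ?powR_gt0.
case/andP: (q01) => q0 q1.
have bound u v : `|Lambda u - Lambda v| <= e^-1.
  have /andP[hu hu'] := ratio_coding u; have /andP[hv hv'] := ratio_coding v.
  apply: le_trans (ln_dist_le hu hv) _; rewrite ler_piMr ?invr_ge0 ?(ltW e0)//.
  rewrite ler_norml; apply/andP; split; move: e0; lra.
exists (e^-1 + b / q); first by rewrite addr_ge0 ?divr_ge0 ?invr_ge0 ?(ltW e0) ?(ltW b0) ?(ltW q0).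
exists q; first by rewrite q0.
move=> [|n] u v uv.
  rewrite expr0 mulr1 (le_trans (bound u v))// lerDl divr_ge0 ?(ltW b0) ?(ltW q0)//.
have /andP[hu _] := ratio_coding u; have /andP[hv _] := ratio_coding v.
apply: le_trans (ln_dist_le hu hv) _.
rewrite -(uv 0%N)//.
have h := ratio_holder (est (u 0%N)) (KX (coding_map_K (shift u))) (KX (coding_map_K (shift v))).
have := coding_map_dist (agree_shift (k := 1) uv).
move=> h2; have {}h2 : enorm (coding_map S K (shift u) - coding_map S K (shift v)) `^ eta <=
    q ^+ n * Delta `^ eta.
  have -> : q ^+ n * Delta `^ eta = ((1 - e) ^+ n * Delta) `^ eta.
    by rewrite powRM ?exprn_ge0 ?(ltW e1) ?(ltW Delta0)// q_pow.
  apply: ge0_ler_powR; rewrite ?nnegrE ?enorm_ge0 ?(ltW eta0)//.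
  by rewrite mulr_ge0 ?exprn_ge0 ?(ltW e1) ?(ltW Delta0).
apply: (@le_trans _ _ (e^-1 * (e^-1 * (q ^+ n * Delta `^ eta)))).
  rewrite ler_wpM2l ?invr_ge0 ?(ltW e0)// (le_trans h)//.
  by rewrite ler_wpM2l ?invr_ge0 ?(ltW e0).
have -> : e^-1 * (e^-1 * (q ^+ n * Delta `^ eta)) = b / q * q ^+ n.+1.
  by rewrite exprS [b / q * _]mulrA (divfK (lt0r_neq0 q0)) /b; ring.
by rewrite ler_wpM2r ?exprn_ge0 ?(ltW q0)// lerDr invr_ge0 ltW.
Qed.

Lemma word_image_dist : exists2 B : R, 0 < B & forall n u x y, X x -> X y ->
  enorm (word_map S (mkseq u n) x - word_map S (mkseq u n) y) <=
    B * expR (birkhoff_sum Lambda n u).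
Proof.
have [B B0 HB] := word_upper; have [B' B'0 HB'] := word_distortion.
exists (B * B' * Delta) => [|n u x y Xx Xy]; first by rewrite !mulr_gt0.
apply: le_trans (HB _ x y Xx Xy) _; rewrite expR_birkhoff_scaling.
have h := HB' (mkseq u n) x _ Xx (KX (coding_map_K (iter n (@shift N) u))).
set z := word_ratio _ _ in h *; set z' := word_ratio _ _ in h *.
apply: (@le_trans _ _ (B * (B' * z') * Delta)); last by apply: ler_of_eq; ring.
rewrite ler_pM ?enorm_ge0 ?XDelta//; first by rewrite mulr_ge0 ?(ltW B0)// ltW// word_ratio_gt0.
by rewrite ler_wpM2l// ltW.
Qed.

End WordMaps.

(** * The Open Set Condition *)

Section Packing.
Variables (R : realType) (d : nat).
Local Notation E := 'rV[R]_d.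

(** Cut space into cubes of side [a / d]: points in one cube are closer than [a], the Euclidean norm
    being at most the sum of the coordinates. *)
Lemma packing_bound (lam : R) : (0 < d)%N -> exists B, forall (T : eqType) (s : seq T) (p : T -> E)
  (c : E) (a : R), 0 < a -> uniq s ->
  (forall x, x \in s -> enorm (p x - c) <= lam * a) ->
  (forall x y, x \in s -> y \in s -> x != y -> a <= enorm (p x - p y)) ->
  (size s <= B)%N.
Proof.
move=> d0; pose M := Num.trunc (2 * lam * d%:R).
exists (M.+1 ^ d)%N => T s p c a a0 us pc pa.
pose f x j : R := (p x ord0 j - c ord0 j + lam * a) / (a / d%:R).
have dp : 0 < d%:R :> R by rewrite ltr0n.
have ad0 : 0 < a / d%:R by rewrite divr_gt0.
have f_bd x j : x \in s -> 0 <= f x j <= 2 * lam * d%:R.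
  move=> xs; have := coord_le_enorm (p x - c) j; rewrite !mxE => h.
  have := le_trans h (pc x xs); rewrite ler_norml => /andP[h1 h2].
  apply/andP; split; first by rewrite divr_ge0 ?(ltW ad0)// addrC -lerBlDl sub0r.
  rewrite ler_pdivrMr//.
  have -> : 2 * lam * d%:R * (a / d%:R) = 2 * (lam * a).
    by rewrite mulrACA -mulrA -mulrA divff ?gt_eqF// mulr1; ring.
  lra.
pose cell x : {ffun 'I_d -> 'I_M.+1} := [ffun j => inord (Num.trunc (f x j))].
have inj : {in s &, injective cell}.
  move=> x y xs ys exy; apply/eqP/negPn/negP => xy.
  have := pa x y xs ys xy; apply/negP; rewrite -ltNge.
  apply: le_lt_trans (enorm_le_sum _) _.
  have -> : a = \sum_(j < d) (a / d%:R).
    by rewrite sumr_const card_ord -[RHS]mulr_natr divfK ?gt_eqF.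
  apply: ltr_sum => [|j _]; last first.
    have := congr1 (fun g : {ffun _ -> _} => val (g j)) exy; rewrite /= !ffunE.
    have tr z : z \in s -> (Num.trunc (f z j) < M.+1)%N.
      by move=> zs; rewrite ltnS /M; case/andP: (f_bd z j zs) => _; exact: le_truncn.
    rewrite !inordK ?tr// => tt.
    have /andP[x1 x2] := truncn_itv (proj1 (andP (f_bd x j xs))).
    have /andP[y1 y2] := truncn_itv (proj1 (andP (f_bd y j ys))).
    have : `|f x j - f y j| < 1.
      rewrite ltr_norml; move: x1 x2 y1 y2; rewrite -tt -natr1; move: (_%:R) => n; lra.
    have -> : f x j - f y j = (p x ord0 j - p y ord0 j) / (a / d%:R).
      by rewrite /f -mulrBl; congr (_ / _); ring.
    rewrite normrM [`|(a / _)^-1|]gtr0_norm ?invr_gt0// ltr_pdivrMr// mul1r.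
    by rewrite !mxE.
  by apply/hasP; exists (Ordinal d0) => //; rewrite mem_index_enum.
rewrite -(size_map cell) -(card_uniqP _); last by rewrite map_inj_in_uniq.
by rewrite (leq_trans (max_card _))// card_ffun !card_ord.
Qed.

End Packing.

Section Separation.
Variables (R : realType) (d N : nat).
Local Notation E := 'rV[R]_d.
Local Notation letters := 'I_N.+1.
Variables (X O : set E) (S : letters -> E -> E).
Hypotheses (SX : forall i, S i @` X `<=` X) (OX : O `<=` X).
Hypothesis SO : forall i, S i @` O `<=` O.
Hypothesis SO0 : forall i j, i != j -> (S i @` O) `&` (S j @` O) = set0.
Hypothesis Sopen : forall i B, open B -> B `<=` X -> open (S i @` B).
Hypothesis Sinj : forall i x y, X x -> X y -> S i x = S i y -> x = y.
Implicit Types (w : seq letters) (x y z : E).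

Lemma word_map_O w x : O x -> O (word_map S w x).
Proof. by move=> Ox; elim: w => //= a w IH; apply: (SO (i := a)); exists (word_map S w x). Qed.

(** Strip the common prefix by injectivity; incomparable words then differ in a letter, where the
    images of [O] are disjoint. *)
Lemma word_map_disjoint w w' x y : ~~ prefix w w' -> ~~ prefix w' w -> O x -> O y ->
  word_map S w x <> word_map S w' y.
Proof.
move=> ww' w'w Ox Oy; elim: w w' ww' w'w => [|a w IH] [|b w']//= ww' w'w.
have [ab|ab] := eqVneq a b.
  rewrite -ab => e; move: ww' w'w; rewrite ab eqxx/= => ww' w'w.
  apply: IH ww' w'w _; rewrite ab in e; apply: Sinj e; apply: OX; exact: word_map_O.
move=> e; have : ((S a @` O) `&` (S b @` O)) (S a (word_map S w x)).
  split; first by exists (word_map S w x) => //; exact: word_map_O.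
  by rewrite e; exists (word_map S w' y) => //; exact: word_map_O.
by rewrite SO0.
Qed.

Lemma word_map_open w B : open B -> B `<=` X -> open (word_map S w @` B).
Proof.
move=> oB BX; elim: w => [|a w IH] /=; first by rewrite image_id.
rewrite -image_comp.
by apply: Sopen => // _ [x Bx <-]; apply: word_map_X => //; exact: BX.
Qed.

(* Minimise the distance to [z] over the image of a closed ball [D] around
   [x0]: an interior minimiser is mapped to [z] itself since [S_w] is open,
   and the boundary of [D] is mapped too far away from [S_w x0]. *)
Lemma word_image_contains_ball w x0 (t0 m : R) z : 0 < t0 ->
  (forall y, enorm (y - x0) <= t0 -> O y) ->
  (forall x y, X x -> X y -> enorm (word_map S w x - word_map S w y) <= enorm (x - y)) ->
  (forall y, enorm (y - x0) = t0 -> m <= enorm (word_map S w x0 - word_map S w y)) ->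
  2 * enorm (word_map S w x0 - z) < m -> exists2 y, O y & word_map S w y = z.
Proof.
move=> t00 tO lip bd zm.
pose D := [set y : E | enorm (y - x0) <= t0].
have lipe x y : X x -> X y ->
    `|enorm (word_map S w x - z) - enorm (word_map S w y - z)| <= 1 * enorm (x - y) `^ 1.
  move=> Xx Xy; rewrite mul1r powRr1 ?enorm_ge0//; apply: le_trans (lip _ _ Xx Xy).
  apply: le_trans (enorm_dist _ _) _; rewrite opprB addrA subrK//.
have DX y : D y -> X y by move=> /tO/OX.
have enormc (A : set E) (x1 : E) : {within A, continuous (fun y : E => enorm (y - x1))}.
  apply: (holder_within_continuous (H := 1) ltr01) => x y _ _.
  rewrite mul1r powRr1 ?enorm_ge0//; apply: le_trans (enorm_dist _ _) _.
  by rewrite opprB addrA subrK.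
have enormT (x1 : E) : continuous (fun y : E => enorm (y - x1)).
  by apply/continuous_subspace_setT; exact: enormc.
have cD : compact D.
  apply: bounded_closed_compact.
    exists (`|x0| + t0); split; first exact: num_real.
    move=> M hM y /= yD; apply: le_trans (ltW hM).
    rewrite -[y](subrK x0) addrC (le_trans (ler_normD _ _))// lerD2l.
    exact: le_trans (mxnorm_le_enorm _) yD.
  apply: (@closed_comp _ _ (fun y : E => enorm (y - x0)) [set t : R | t <= t0]).
    by move=> y _; exact: enormT.
  exact: closed_le.
have D0 : D !=set0 by exists x0; rewrite /D/= subrr enorm0 ltW.
have fc : {within D, continuous (fun y => enorm (word_map S w y - z))}.
  apply: (holder_within_continuous (H := 1) ltr01) => x y /DX Xx /DX Xy; exact: lipe.
have [y yD ymin] := compact_EVT_min D0 cD fc.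
have {}yD : D y := set_mem yD.
exists y; first exact: tO.
apply/eqP/negPn/negP => yz.
have yt : enorm (y - x0) < t0.
  rewrite lt_neqAle yD andbT; apply/negP => /eqP yt.
  have h1 := bd y yt.
  have h2 := ymin x0 (mem_set (_ : D x0)).
  have {}h2 := h2 (ltac:(by rewrite /D/= subrr enorm0 ltW)).
  have := enorm_triangle z (word_map S w x0) (word_map S w y).
  rewrite [enorm (z - _)]enormB; lra.
pose B := [set y : E | enorm (y - x0) < t0].
have oB : open B.
  have oo : open [set t : R | t < t0] by exact: open_lt.
  by apply: (open_comp _ oo) => v _; exact: enormT.
have BX : B `<=` X by move=> v /ltW/DX.
have : nbhs (word_map S w y) (word_map S w @` B).
  by apply: open_nbhs_nbhs; split; [exact: word_map_open|exists y].
set p := word_map S w y in yz ymin *.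
move=> /nbhs_ballP[ep /= ep0 epB].
(* A short step from [p] towards [z] stays in the open image and shortens the distance by the factor
   [1 - s], against minimality. *)
pose s := Num.min 2^-1 (ep / (2 * (`|z - p| + 1))).
have zp1 : 0 < `|z - p| + 1 by rewrite ltr_wpDl.
have s0 : 0 < s by rewrite lt_min invr_gt0 ltr0n/= divr_gt0 ?mulr_gt0.
have s1 : s <= 2^-1 by rewrite ge_min lexx.
have [y' By' e'] : (word_map S w @` B) (p + s *: (z - p)).
  apply: epB; rewrite -ball_normE/= opprD addNKr normrN normrZ gtr0_norm//.
  apply: (@le_lt_trans _ _ (ep / (2 * (`|z - p| + 1)) * (`|z - p| + 1))).
    by rewrite ler_pM ?(ltW s0)// ?ge_min ?lexx ?orbT// lerDl.
  have -> : ep / (2 * (`|z - p| + 1)) * (`|z - p| + 1) = ep / 2.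
    by field; rewrite gt_eqF.
  by rewrite ltr_pdivrMr// mulr_natr mulr2n ltrDl.
have := ymin y' (mem_set (ltW By' : D y')); apply/negP; rewrite -ltNge e'.
have -> : p + s *: (z - p) - z = (1 - s) *: (p - z).
  by rewrite scalerBl scale1r -scalerN opprB addrAC.
rewrite enormZ ger0_norm; last by lra.
have : 0 < enorm (p - z) by apply: enorm_gt0; rewrite subr_eq0.
by move=> h; rewrite gtr_pMl// ltrBlDr ltrDl.
Qed.

End Separation.

Section DiffeoImage.
Variables (R : realType) (d : nat).
Local Notation E := 'rV[R]_d.

Lemma diffeo_open eta (V B : set E) (g : E -> E) : C1plus_diffeo eta V g ->
  open B -> B `<=` V -> open (g @` B).
Proof.
move=> [_ oV [h [dh _] hg]] oB BV; rewrite openE => _ [x Bx <-].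
have Vx := BV x Bx.
have hc : {for g x, continuous h}.
  by apply: differentiable_continuous; apply: dh; exists x.
have nB : nbhs (h (g x)) B by rewrite hg//; exact: open_nbhs_nbhs.
have nV : nbhs (g x) (g @` V) by apply: open_nbhs_nbhs; split => //; exists x.
have nB' : nbhs (g x) (h @^-1` B) by exact: hc nB.
apply: filterS (filterI nB' nV) => z [Bz [x' Vx' e]].
by move: Bz; rewrite /= -e hg// => Bx'; exists x'.
Qed.

Lemma diffeo_inj eta (V : set E) (g : E -> E) x y : C1plus_diffeo eta V g ->
  V x -> V y -> g x = g y -> x = y.
Proof. by move=> [_ _ [h _ hg]] Vx Vy e; rewrite -(hg x)// e hg. Qed.

Lemma compact_enorm_bounded (X : set E) : compact X ->
  exists2 D : R, 0 < D & forall x y, X x -> X y -> enorm (x - y) <= D.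
Proof.
move=> /compact_bounded[M [_ HM]].
have {}HM x : X x -> `|x| <= `|M| + 1.
  by apply: HM; rewrite (le_lt_trans (ler_norm M))// ltrDl.
exists (d%:R * (2 * (`|M| + 1)) + 1).
  by rewrite ltr_wpDl// mulr_ge0// mulr_ge0// addr_ge0.
move=> x y Xx Xy; apply: le_trans (enorm_le_mxnorm _) _.
apply: (@le_trans _ _ (d%:R * (2 * (`|M| + 1)))); last by rewrite lerDl.
rewrite ler_wpM2l// (le_trans (ler_normB _ _))//.
by rewrite mulr2n mulrDl mul1r lerD ?HM.
Qed.

End DiffeoImage.

Section ConformalCoding.
Variables (R : realType) (d N : nat).
Local Notation E := 'rV[R]_d.
Local Notation letters := 'I_N.+1.

(* [pi] sees a bounded number of incomparable words of one scale [rho] through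
   a set of diameter at most [rho]. *)
Definition bounded_multiplicity (pi : code_space N -> E) (L : code_space N -> R) : Prop :=
  forall kap : R, 0 < kap -> exists B : nat, forall (rho : R) (U : set E) (s : seq (seq letters)),
    0 < rho -> uniq s ->
    (forall w w', w \in s -> w' \in s -> w != w' -> ~~ prefix w w') ->
    (forall x y, U x -> U y -> enorm (x - y) <= rho) ->
    (forall w, w \in s -> exists u, [/\ cylinder w u, U (pi u) &
       kap * rho <= expR (birkhoff_sum L (size w) u) <= rho]) ->
    (size s <= B)%N.

Variables (V X K : set E) (S : letters -> E -> E).
Hypotheses (d0 : (0 < d)%N) (ifs : conformal_ifs V X S) (hK : self_conformal_set X S K).
Local Notation pi := (coding_map S K).
Local Notation L := (scaling_map S K).

Lemma conformal_ifs_estimates : exists eta, exists e, [/\ 0 < eta, 0 < e < 1 &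
  forall i, conformal_estimates X eta (S i) (fun x => opnorm ('d (S i) x)) e].
Proof.
have [[oV _] [cX XV _] _ [eta /andP[eta0 _] hS] sim] := ifs; exists eta.
have [|i|e e01 H] := @common_constant _ _
    (fun i e => conformal_estimates X eta (S i) (fun x => opnorm ('d (S i) x)) e).
- by move=> i e e'; exact: conformal_estimates_le.
- have [[hC _ _] hc] := hS i.
  by apply: (conformal_estimates_exist d0 cX oV XV eta0 hC hc) => x; exact: sim.
by exists e.
Qed.

(** All that the dimension estimates use of the geometry. The Open Set Condition enters only through
    the last clause. *)
Lemma conformal_coding :
  [/\ holder_code L, exists2 l0, 0 < l0 & forall u, L u <= - l0,
    exists2 B, 0 < B & forall n u v, agree n u v ->
      enorm (pi u - pi v) <= B * expR (birkhoff_sum L n u) &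
    open_set_condition X S -> bounded_multiplicity pi L].
Proof.
have [[oV _] [cX XV _] SVX [eta0 _ hS] _] := ifs.
have SX i : S i @` X `<=` X by case: (SVX i).
have [eta [e [eta_gt0 e01 est]]] := conformal_ifs_estimates.
have [Delta Delta0 XDelta] := compact_enorm_bounded cX.
have /andP[e0 e1] := e01.
have KX : K `<=` X by case: hK.
have holder := scaling_holder e01 eta_gt0 SX est Delta0 XDelta hK.
have expE := expR_birkhoff_scaling e01 SX est Delta0 XDelta hK.
have piX u : X (pi u) by apply: KX; exact: (coding_map_K e01 SX est Delta0 XDelta hK).
have piE := coding_map_shift e01 SX est Delta0 XDelta hK.
have ratio0 := word_ratio_gt0 e01 SX est.
have [B B0 HB] := word_image_dist e01 eta_gt0 SX est Delta0 XDelta hK.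
split => //.
- exists (- ln (1 - e)); first by rewrite oppr_gt0 ln_lt0// subr_gt0 e1 ltrBlDr ltrDl.
  by move=> u; rewrite opprK; exact: (scaling_le e01 SX est Delta0 XDelta hK).
- exists B => // n u v uv; rewrite [pi u](piE u n) [pi v](piE v n).
  have -> : mkseq v n = mkseq u n.
    by apply/eq_in_map => k; rewrite mem_iota => /andP[_ kn]; exact/esym/uv.
  exact: HB.
move=> [W [oO [[x0 Ox0] _] OX SO SO0]] kap kap0.
have Xx0 := OX _ Ox0.
have [B1 B10 [t t_gt0 low]] := word_lower e01 eta_gt0 SX est.
have [B2 B20 dist] := word_distortion e01 eta_gt0 SX est Delta0 XDelta.
have /nbhs_ballP[t1 /= t10 t1O] : nbhs x0 W by exact: open_nbhs_nbhs.
pose t0 := Num.min t (t1 / 2).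
have t00 : 0 < t0 by rewrite lt_min t_gt0 divr_gt0.
have tO y : enorm (y - x0) <= t0 -> W y.
  move=> yt; apply: t1O; rewrite -ball_normE/= -normrN opprB.
  apply: le_lt_trans (mxnorm_le_enorm _) _; apply: le_lt_trans yt _.
  by rewrite gt_min orbC ltr_pdivrMr// mulr_natr mulr2n ltrDl t10.
(* By [word_lower] and bounded distortion, a ball of radius [a * rho] about the image of [x0] stays
   inside the image of [O] for every word of scale at least [kap * rho]. *)
pose a := t0 / B1 / 4 / B2 * kap.
have a0 : 0 < a by rewrite !mulr_gt0 ?invr_gt0.
have [M HM] := packing_bound ((B + 1) / a) d0.
exists M => rho U s rho0 us anti Urho Hs.
case: s us anti Hs => // w0 s0; set s := w0 :: s0 => us anti Hs.
have [u0 [_ Uu0 _]] := Hs w0 (mem_head _ _).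
apply: (HM _ s (fun w => word_map S w x0) (pi u0) (a * rho)) => //.
- by rewrite mulr_gt0.
- move=> w ws; have [u [wu Uu /andP[_ rhou]]] := Hs w ws.
  have -> : (B + 1) / a * (a * rho) = B * rho + rho by field; rewrite gt_eqF.
  apply: le_trans (enorm_triangle (pi u) _ _) _; apply: lerD; last exact: Urho.
  rewrite [pi u](piE u (size w)); have e' : mkseq u (size w) = w by exact/cylinderP.
  have := HB (size w) u x0 (pi (iter (size w) (@shift N) u)) Xx0 (piX _).
  rewrite e' => h; apply: le_trans h _.
  by rewrite ler_wpM2l// ltW.
(* Were the two images of [x0] closer than [a * rho], the image under [w'] would lie in the image of
   [O] under [w], which is excluded for incomparable words. *)
move=> w w' ws ws' ww'.
have [u [wu Uu /andP[rhou _]]] := Hs w ws.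
rewrite leNgt; apply/negP => lt.
have e' : mkseq u (size w) = w by exact/cylinderP.
have ra : kap * rho <= B2 * word_ratio S (fun i x => opnorm ('d (S i) x)) w x0.
  apply: le_trans rhou _; rewrite expE e'; exact: dist.
set ratio := word_ratio _ _ _ _ in ra.
have [x y Xx Xy|y yt||y Oy ey] := @word_image_contains_ball _ _ _ X W S SX OX
  (fun i B oB BX => diffeo_open (proj1 (hS i)) oB (subset_trans BX XV)) w x0 t0 (ratio * t0 / B1) (word_map S w' x0) t00 tO.
- apply: le_trans (word_contract e01 SX est _ Xx Xy) _.
  rewrite ler_piMl ?enorm_ge0// exprn_ile1//; move: e0 e1; lra.
- have := low w x0 y Xx0 (OX _ (tO y (ltac:(by rewrite yt)))).
  rewrite [enorm (x0 - y)]enormB yt => /(_ (ltac:(by rewrite ge_min lexx))) h.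
  by rewrite ler_pdivrMr// [leRHS]mulrC.
- have ra' : t0 / B1 / 4 / B2 * (kap * rho) <= t0 / B1 / 4 / B2 * (B2 * ratio).
    by rewrite ler_wpM2l// !mulr_ge0 ?invr_ge0 ?(ltW t00) ?(ltW B10) ?(ltW B20).
  have e1' : t0 / B1 / 4 / B2 * (B2 * ratio) = ratio * t0 / B1 / 4.
    by field; rewrite !gt_eqF.
  have e2' : t0 / B1 / 4 / B2 * (kap * rho) = a * rho by rewrite /a mulrA.
  have : 0 < ratio * t0 / B1 by rewrite !mulr_gt0 ?invr_gt0// /ratio ratio0.
  move: lt ra'; rewrite e1' e2'; set z := enorm _; set z' := _ * t0 / B1; lra.
apply: (@word_map_disjoint _ _ _ X W S OX SO SO0 _ w w' y x0) ey => //; try exact: anti.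
  by move=> i x z Xx Xz; apply: diffeo_inj (proj1 (hS i)) (XV _ Xx) (XV _ Xz).
by apply: anti => //; rewrite eq_sym.
Qed.

End ConformalCoding.

(** * The upper bound for the dimension *)

Section Clusters.
Variable R : realType.
Implicit Types (C : set R) (a : nat -> R).

(** By compactness, infinitely many exceptions would accumulate at a point of [C], near which there
    are none. *)
Lemma cluster_eventually C a (M : R) : (forall n, `|a n| <= M) ->
  cluster (a n @[n --> \oo]) `<=` C ->
  forall r, 0 < r -> exists n0, forall n, (n0 <= n)%N -> set_nbhd C r (a n).
Proof.
move=> aM clC r r0; apply/not_existsP => H.
have {}H n0 : exists n, (n0 <= n)%N /\ ~ set_nbhd C r (a n).
  have /existsNP[n /not_implyP[? ?]] := H n0; by exists n.
have [phi Hphi] := choice H.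
have cM : compact (`[- M, M] : set R) by exact: segment_compact.
have FM : (a (phi n) @[n --> \oo]) [set` `[- M, M]].
  by exists 0%N => // n _; rewrite /= in_itv/= -ler_norml.
have [p [_ clp]] := cM _ _ FM.
have Cp : C p.
  apply: clC => A B [n0 _ hA] pB; apply: clp pB; exists n0 => // n /= nn.
  by apply: hA; apply: leq_trans nn _; case: (Hphi n).
have aF : (a (phi n) @[n --> \oo]) [set a (phi n) | n in setT].
  by exists 0%N => // n _; exists n.
have [_ [[n _ <-] bn]] := clp _ _ aF (nbhsx_ballx p r r0).
have [_ nn] := Hphi n; apply: nn; apply: (set_nbhd_near (c := p)) => //.
by move: bn; rewrite -ball_normE/= distrC.
Qed.

Lemma cvg_cluster_sub C a (l : R) : C l -> a n @[n --> \oo] --> l ->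
  cluster (a n @[n --> \oo]) `<=` C.
Proof.
move=> Cl al p clp; suff -> : p = l by [].
apply/eqP/negPn/negP => pl.
have e0 : 0 < `|p - l| / 2 by rewrite divr_gt0// normr_gt0 subr_eq0.
have h : (a n @[n --> \oo]) [set x | `|l - x| < `|p - l| / 2].
  by move/cvgrPdist_lt : al => /(_ _ e0).
have [x [/= hx]] := clp _ _ h (nbhsx_ballx p _ e0).
rewrite -ball_normE/= => px; have := ler_distD x p l; rewrite [`|x - l|]distrC.
move: hx px; lra.
Qed.

Lemma cluster_set1_cvg a (l M : R) : (forall n, `|a n| <= M) ->
  cluster (a n @[n --> \oo]) `<=` [set l] -> a n @[n --> \oo] --> l.
Proof.
move=> aM cl; apply/cvgrPdist_lt => e e0.
have [n0 H] := cluster_eventually aM cl e0.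
exists n0 => // n /= n0n; have [c -> h] := set_nbhdP (H n n0n).
by rewrite distrC.
Qed.

End Clusters.

Lemma sum_uniq_sub (R : numDomainType) (T : eqType) (phi : T -> R) (s t : seq T) :
  (forall x, 0 <= phi x) -> uniq s -> {subset s <= t} ->
  \sum_(x <- s) phi x <= \sum_(x <- t) phi x.
Proof.
move=> phi0; elim: s t => [|x s IH] t /=; first by rewrite big_nil sumr_ge0.
case/andP=> xs us st; have xt : x \in t by rewrite st ?mem_head.
rewrite big_cons (perm_big _ (perm_to_rem xt)) big_cons lerD2l; apply: IH => // y ys.
have := st y; rewrite inE ys orbT (perm_mem (perm_to_rem xt)) inE => /(_ isT).
by case: eqP => // yx; rewrite yx (negbTE xs) in ys.
Qed.

Lemma nneseries_le_partial (R : realType) (F : nat -> \bar R) (c : \bar R) :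
  (forall k, (0 <= F k)%E) -> (forall n, (\sum_(0 <= k < n) F k <= c)%E) ->
  (\sum_(0 <= k <oo) F k <= c)%E.
Proof.
move=> F0 H; apply: lime_le; first exact: is_cvg_nneseries.
exact: nearW.
Qed.

Section UpperBound.
Variables (R : realType) (N d : nat) (gamma : R).
Hypothesis gamma01 : 0 < gamma < 1.
Local Notation T := (borel_code N gamma).
Local Notation letters := 'I_N.+1.
Variables (f g : code_space N -> R) (l0 : R) (pi : code_space N -> 'rV[R]_d) (C : set R) (Bpi : R).
Hypotheses (hf : holder_code f) (hg : holder_code g) (cC : closed C).
Hypotheses (l0_gt0 : 0 < l0) (g_le : forall u, g u <= - l0).
Hypothesis Bpi0 : 0 < Bpi.
Hypothesis pi_dist : forall n u v, agree n u v ->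
  enorm (pi u - pi v) <= Bpi * expR (birkhoff_sum g n u).

Definition level_set : set (code_space N) :=
  [set u | cluster (birkhoff_avg f n u @[n --> \oo]) `<=` C].

Lemma birkhoff_avg_bound : exists2 M : R, 0 < M & forall n u, `|birkhoff_avg f n u| <= M.
Proof.
have [M M0 HM] := holder_bounded hf; exists M => // n u.
rewrite /birkhoff_avg normrM ger0_norm ?invr_ge0//.
have [->|n0] := eqVneq n 0%N; first by rewrite invr0 mul0r ltW.
by rewrite mulrC ler_pdivrMr ?ltr0n ?lt0n// birkhoff_bound.
Qed.

Lemma level_set_periodic u r : level_set u -> 0 < r -> exists n0, forall n, (n0 <= n)%N ->
  set_nbhd C r (birkhoff_avg f n (periodic (mkseq u n))).
Proof.
move=> Au r0; have [M _ HM] := birkhoff_avg_bound.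
have r2 : 0 < r / 2 by rewrite divr_gt0.
have [n0 H] := cluster_eventually (fun n => HM n u) Au r2.
have [D D0 HD] := holder_distortion hf.
exists (maxn n0 (Num.trunc (D / (r / 2))).+1) => n; rewrite geq_max => /andP[n0n nD].
have [c Cc uc] := set_nbhdP (H n n0n).
apply: (set_nbhd_near Cc).
have np : 0 < n%:R :> R by rewrite ltr0n (leq_ltn_trans _ nD).
have ag : agree n (periodic (mkseq u n)) u.
  move=> k kn; have := @cylinder_periodic _ (mkseq u n) k.
  by rewrite size_mkseq nth_mkseq//; exact.
have h : `|birkhoff_avg f n (periodic (mkseq u n)) - birkhoff_avg f n u| < r / 2.
  rewrite /birkhoff_avg -mulrBr normrM ger0_norm ?invr_ge0 ?(ltW np)//.
  rewrite mulrC ltr_pdivrMr// (le_lt_trans (HD _ _ _ ag))//.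
  rewrite -ltr_pdivrMl// mulrC (lt_le_trans (truncnS_gt _))//.
  by rewrite ler_nat.
have := ler_distD (birkhoff_avg f n u) (birkhoff_avg f n (periodic (mkseq u n))) c; move: h uc.
by move: `|_ - _| => x1; move: `|_ - _| => x2; move: `|_ - _| => x3; lra.
Qed.

(** Otherwise orbit sums grow at every negative rate in every neighbourhood, and
    [invariant_measure_of_growth] at rate 0 yields an admissible measure with a nonnegative
    value. *)
Lemma orbit_sum_decay (s : R) :
  (forall mu h, @admissible _ _ gamma f C mu -> entropy mu = h%:E -> h + s * \int[mu]_u g u < 0) ->
  exists r eta n0, [/\ 0 < r, 0 < eta & forall n, (n0 <= n)%N ->
    orbit_sum f g (set_nbhd C r) s n <= expR (- (n%:R * eta))].
Proof.
move=> neg; apply: contrapT => H.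
have [|mu [h [inv Cf eh le]]] := @invariant_measure_of_growth _ _ _ gamma01 f g C s 0 hf hg cC.
  move=> r e' r0 e'0 n0; apply: contrapT => nn; apply: H.
  exists r, (- e'), n0; split => //; first by rewrite oppr_gt0.
  move=> n n0n; rewrite mulrN opprK leNgt; apply/negP => lt; apply: nn.
  by exists n => //; exact: ltW.
by have := neg mu h (conj inv Cf) eh; rewrite ltNge le.
Qed.

(** At [s = 0] the orbit sums count words. Without admissible measures the counts would fall below
    1, but the prefixes of [u] are counted. *)
Lemma level_set_admissible u : level_set u -> exists mu, @admissible _ _ gamma f C mu.
Proof.
move=> Au; apply: contrapT => nadm.
have [|r [eta [n0 [r0 eta0 H]]]] := @orbit_sum_decay 0.
  by move=> mu h adm _; exfalso; apply: nadm; exists mu.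
have [n1 H1] := level_set_periodic Au r0.
pose n := (maxn n0 n1).+1.
have := H n (leqW (leq_maxl _ _)); apply/negP; rewrite -ltNge.
have Pw := H1 n (leqW (leq_maxr _ _)).
rewrite -prefix_tupleE in Pw.
rewrite /orbit_sum (bigD1 (prefix_tuple n u))/=; last exact/asboolP.
rewrite mul0r expR0 ltr_wpDr//; first by apply: sumr_ge0 => w _; exact: expR_ge0.
by rewrite expR_lt1 oppr_lt0 mulr_gt0.
Qed.

Let good r (w : seq letters) : bool := `[< set_nbhd C r (birkhoff_avg f (size w) (periodic w)) >].

Lemma birkhoff_le_neg n u : birkhoff_sum g n u <= - (n%:R * l0).
Proof.
elim: n u => [|n IH] u; first by rewrite birkhoff0 mul0r oppr0.
rewrite birkhoffSl -natr1 mulrDl mul1r; have := IH (shift u); have := g_le u.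
move: (_ * _) => x; lra.
Qed.

Lemma diam_cylinder w :
  (diam (pi @` cylinder w) <= (2 * Bpi * expR (birkhoff_sum g (size w) (periodic w)))%:E)%E.
Proof.
have H u : cylinder w u ->
    enorm (pi (periodic w) - pi u) <= Bpi * expR (birkhoff_sum g (size w) (periodic w)).
  by move=> wu; apply: pi_dist; exact: (@cylinder_agree _ _ _ u (@cylinder_periodic _ w) wu).
apply: ge_ereal_sup => _ [[x y] /= [[u wu <-] [v wv <-]] <-]; rewrite lee_fin.
apply: le_trans (enorm_triangle (pi (periodic w)) _ _) _.
rewrite [enorm (pi u - _)]enormB; have := H u wu; have := H v wv.
rewrite -mulrA; move: (Bpi * _) => z; lra.
Qed.

Lemma diam_pow_cylinder (s : R) w : 0 <= s -> (diam_pow s (pi @` cylinder w) <=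
  ((2 * Bpi) `^ s * expR (s * birkhoff_sum g (size w) (periodic w)))%:E)%E.
Proof.
move=> s0; rewrite /diam_pow ifF; last first.
  by apply/negbTE/set0P; exists (pi (periodic w)), (periodic w) => //; exact: cylinder_periodic.
rewrite [s * _]mulrC expRM -powRM ?expR_ge0 ?mulr_ge0 ?(ltW Bpi0)// -poweR_EFin.
apply: gt0_ler_poweR (diam_cylinder w) => //; rewrite in_itv/= ?leey ?andbT.
  apply: ereal_sup_ubound; exists (pi (periodic w), pi (periodic w)); rewrite /= ?subrr ?enorm0//.
  by split; exists (periodic w) => //; exact: cylinder_periodic.
by rewrite lee_fin !mulr_ge0 ?expR_ge0 ?(ltW Bpi0).
Qed.

Section Cover.
Variables (s r eta : R) (n0 : nat).
Hypotheses (s0 : 0 <= s) (r0 : 0 < r) (eta0 : 0 < eta).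
Hypothesis decay : forall n, (n0 <= n)%N ->
  orbit_sum f g (set_nbhd C r) s n <= expR (- (n%:R * eta)).
Variables (M : nat).
Hypothesis n0M : (n0 <= M)%N.

Let sel w := (M <= size w)%N && good r w.
Let phi w : R := if sel w then expR (s * birkhoff_sum g (size w) (periodic w)) else 0.
(** Half of the decay rate is spent on the small factor [p ^+ M], the other half on summability over
    the lengths [n >= M]. *)
Let p := expR (- (eta / 2)).

Let phi_ge0 w : 0 <= phi w. Proof. by rewrite /phi; case: ifP => // _; exact: expR_ge0. Qed.

Let sum_tuple n : \sum_(w : n.-tuple letters) phi w =
  if (M <= n)%N then orbit_sum f g (set_nbhd C r) s n else 0.
Proof.
rewrite /phi /sel /good /orbit_sum; case: leqP => Mn.
  rewrite [RHS]big_mkcond; apply: eq_bigr => w _; rewrite size_tuple Mn/=.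
  by case: asboolP.
by rewrite big1// => w _; rewrite size_tuple leqNgt Mn.
Qed.

Let sum_tuple_le n : \sum_(w : n.-tuple letters) phi w <= p ^+ M * p ^+ n.
Proof.
rewrite sum_tuple; case: leqP => Mn; last by rewrite mulr_ge0 ?exprn_ge0 ?expR_ge0.
apply: le_trans (decay (leq_trans n0M Mn)) _.
rewrite -exprD /p -expRM_natl ler_expR mulrN lerN2 natrD.
rewrite (_ : n%:R * eta = (n%:R + n%:R) * (eta / 2)); last by field.
by rewrite ler_wpM2r ?divr_ge0 ?(ltW eta0)// lerD2r ler_nat.
Qed.

Let partial_sum K : \sum_(0 <= k < K) oapp phi 0 (pickle_inv k) <= p ^+ M / (1 - p).
Proof.
rewrite -big_pmap.
pose sK : seq (seq letters) := pmap pickle_inv (index_iota 0 K).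
have usK : uniq sK by apply: (pmap_uniq (@pickle_invK _)); exact: iota_uniq.
pose L := (\max_(w <- sK) size w).+1.
pose tL := flatten [seq [seq val w | w <- enum {: n.-tuple letters}] | n <- index_iota 0 L].
apply: (@le_trans _ _ (\sum_(w <- tL) phi w)).
  apply: sum_uniq_sub => // w wK; apply/flattenP.
  exists [seq val w' | w' <- enum {: (size w).-tuple letters}].
    apply/mapP; exists (size w) => //; rewrite mem_index_iota/= ltnS.
    exact: (leq_bigmax_seq w).
  by apply/mapP; exists (in_tuple w); rewrite ?mem_enum.
have p01 : 0 < p < 1 by rewrite expR_gt0/= -expR0 ltr_expR oppr_lt0 divr_gt0.
case/andP: p01 => p0 p1.
apply: (@le_trans _ _ (series (geometric (p ^+ M) p) L)).
  rewrite big_flatten big_map; apply: ler_sum => n _.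
  by rewrite big_map big_enum/=; exact: sum_tuple_le.
by apply: geometric_le_lim; rewrite ?exprn_ge0 ?ger0_norm ?(ltW p0).
Qed.

(** The cover is indexed by the codes of words. Indices without a selected word give the empty set,
    of weight 0 even for [s = 0]. *)
Let U k : set 'rV[R]_d :=
  if pickle_inv k is Some w then if sel w then pi @` cylinder w else set0 else set0.

Lemma level_set_premeasure (delta : R) : 2 * Bpi * expR (- (M%:R * l0)) <= delta ->
  (hausdorff_premeasure s delta (pi @` level_set) <=
   ((2 * Bpi) `^ s * (p ^+ M / (1 - p)))%:E)%E.
Proof.
move=> Md; have diam0 : (diam (@set0 'rV[R]_d) <= 0)%E.
  by apply: ge_ereal_sup => _ [[x y] [[]]].
have delta0 : 0 <= delta by apply: le_trans Md; rewrite !mulr_ge0 ?expR_ge0 ?(ltW Bpi0).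
apply: ereal_inf_le; exists (\sum_(0 <= k <oo) diam_pow s (U k))%E.
  exists U => //; split => [_ [u Au <-]|k].
    have [n1 H1] := level_set_periodic Au r0.
    pose w := mkseq u (maxn M n1); have sw : size w = maxn M n1 by rewrite size_mkseq.
    exists (pickle w) => //; rewrite /U pickleK_inv ifT.
      by exists u => //; apply/cylinderP; rewrite sw.
    rewrite /sel sw leq_maxl/= /good; apply/asboolP; rewrite sw; apply: H1.
    exact: leq_maxr.
  rewrite /U; case: (pickle_inv k) => [w|]; last by rewrite (le_trans diam0)// lee_fin.
  case: ifP => [/andP[Mw _]|_]; last by rewrite (le_trans diam0)// lee_fin.
  apply: le_trans (diam_cylinder w) _; rewrite lee_fin (le_trans _ Md)//.
  rewrite ler_wpM2l ?mulr_ge0 ?(ltW Bpi0)// ler_expR (le_trans (birkhoff_le_neg _ _))//.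
  by rewrite lerN2 ler_wpM2r ?(ltW l0_gt0)// ler_nat.
have pow0 k : (0 <= diam_pow s (U k))%E.
  by rewrite /diam_pow; case: ifP => // _; exact: poweR_ge0.
apply: nneseries_le_partial => // K.
apply: (@le_trans _ _ (\sum_(0 <= k < K) ((2 * Bpi) `^ s * oapp phi 0 (pickle_inv k))%:E)%E).
  apply: lee_sum => k _; rewrite /U; case: (pickle_inv k) => [w|] /=; last first.
    by rewrite /diam_pow eqxx mulr0.
  rewrite /phi; case: ifP => _; first exact: diam_pow_cylinder.
  by rewrite /diam_pow eqxx mulr0.
by rewrite sumEFin lee_fin -mulr_sumr ler_wpM2l ?powR_ge0.
Qed.

End Cover.

Lemma level_set_null (s : R) : 0 <= s ->
  (forall mu h, @admissible _ _ gamma f C mu -> entropy mu = h%:E -> h + s * \int[mu]_u g u < 0) ->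
  hausdorff_measure s (pi @` level_set) = 0%E.
Proof.
move=> s0 /orbit_sum_decay[r [eta [n0 [r0 eta0 decay]]]].
have pre_ge0 delta : (0 <= hausdorff_premeasure s delta (pi @` level_set))%E.
  apply: le_ereal_inf_tmp => _ [U _ <-]; apply: nneseries_ge0 => k _ _.
  by rewrite /diam_pow; case: ifP => // _; exact: poweR_ge0.
apply/eqP; rewrite eq_le; apply/andP; split; last first.
  apply: le_trans (pre_ge0 1) _; apply: ereal_sup_ubound; exists 1 => //=.
apply: ge_ereal_sup => _ [delta /= delta0 <-].
apply/lee_addgt0Pr => e e0; rewrite add0e.
pose p := expR (- (eta / 2)); pose q := expR (- l0).
have p01 : 0 < p < 1 by rewrite expR_gt0/= -expR0 ltr_expR oppr_lt0 divr_gt0.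
have q01 : 0 < q < 1 by rewrite expR_gt0/= -expR0 ltr_expR oppr_lt0.
have p1 : 0 < 1 - p by case/andP: p01; rewrite subr_gt0.
pose K := (2 * Bpi) `^ s / (1 - p) + 1.
have K0 : 0 < K by rewrite ltr_wpDl// divr_ge0 ?powR_ge0// ltW.
have [m1 h1] := expr_small p01 (divr_gt0 e0 K0).
have B2 : 0 < 2 * Bpi by rewrite mulr_gt0.
have [m2 h2] := expr_small q01 (divr_gt0 delta0 B2).
have mono (z : R) i j : 0 < z < 1 -> (i <= j)%N -> z ^+ j <= z ^+ i.
  by move=> /andP[? ?] ij; rewrite ler_iXn2l.
pose M := maxn n0 (maxn m1 m2).
have [M0 M1 M2] : [/\ (n0 <= M)%N, (m1 <= M)%N & (m2 <= M)%N].
  by rewrite /M !leq_max !leqnn !orbT.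
apply: le_trans (level_set_premeasure s0 r0 eta0 decay M0 (delta := delta) _) _.
  rewrite -mulrN expRM_natl -ler_pdivlMl// mulrC (le_trans _ (ltW h2))//.
  exact: mono.
rewrite lee_fin -/p; have {}h1 := le_lt_trans (mono p m1 M p01 M1) h1.
rewrite ltr_pdivlMr// in h1; apply: le_trans (ltW h1).
rewrite mulrCA ler_wpM2l ?exprn_ge0 ?expR_ge0//.
by rewrite /K lerDl.
Qed.

End UpperBound.

(** * A measure on concatenations of typical words *)

Section MoranMass.
Variables (R : realType) (N : nat) (gamma : R).
Hypothesis gamma01 : 0 < gamma < 1.
Local Notation T := (borel_code N gamma).
Local Notation letters := 'I_N.+1.
Variables (f g : code_space N -> R) (alpha beta h : R).
Hypotheses (hf : holder_code f) (hg : holder_code g).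
Variables (ell : nat -> nat) (G : nat -> seq (seq letters)) (eb : nat -> R).
Hypotheses (ell_gt0 : forall k, (0 < ell k)%N).
Hypothesis G_size : forall k w, w \in G k -> size w = ell k.
Hypothesis G_uniq : forall k, uniq (G k).
Hypothesis G_birkhoff : forall k w u, w \in G k -> cylinder w u ->
  `|birkhoff_sum f (ell k) u - (ell k)%:R * alpha| <= (ell k)%:R * eb k /\
  `|birkhoff_sum g (ell k) u - (ell k)%:R * beta| <= (ell k)%:R * eb k.
Hypothesis G_card : forall k, expR ((ell k)%:R * (h - eb k)) <= (size (G k))%:R.
Hypothesis eb_ge0 : forall k, 0 <= eb k.
Hypothesis eb_small : forall e, 0 < e -> exists k0, forall k, (k0 <= k)%N ->
  eb k <= e /\ (ell k)%:R <= e * k%:R.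
Implicit Types w : seq letters.

Let sizeG_gt0 k : 0 < (size (G k))%:R :> R.
Proof. exact: lt_le_trans (expR_gt0 _) (G_card k). Qed.

(** [n] is fuel: every step drops a nonempty block, so [(size w).+1] suffices. An incomplete last
    block is weighed by the share of words of [G k] that extend it. *)
Fixpoint mass_rec n k w : R :=
  if n is n'.+1 then
    if (ell k <= size w)%N then
      (take (ell k) w \in G k)%:R / (size (G k))%:R * mass_rec n' k.+1 (drop (ell k) w)
    else (count (prefix w) (G k))%:R / (size (G k))%:R
  else 0.

(* The probability that a concatenation of independent uniform blocks from
   [G k], [G k.+1], ... starts with [w]. *)
Definition mass k w := mass_rec (size w).+1 k w.

Let size_drop_lt k w : (ell k <= size w)%N -> (size (drop (ell k) w) < size w)%N.
Proof. by move=> kw; rewrite size_drop; have := ell_gt0 k; lia. Qed.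

Lemma mass_rec_irr n n' k w : (size w < n)%N -> (size w < n')%N ->
  mass_rec n k w = mass_rec n' k w.
Proof.
elim: n n' k w => [//|n IH] [//|n'] k w wn wn' /=; case: leqP => // kw.
by congr (_ * _); apply: IH; apply: leq_trans (size_drop_lt kw) _.
Qed.

Lemma massE k w : mass k w = if (ell k <= size w)%N then
    (take (ell k) w \in G k)%:R / (size (G k))%:R * mass k.+1 (drop (ell k) w)
  else (count (prefix w) (G k))%:R / (size (G k))%:R.
Proof.
rewrite {1}/mass /=; case: leqP => // kw; congr (_ * _).
by apply: mass_rec_irr => //; exact: size_drop_lt.
Qed.

Lemma mass_nil k : mass k [::] = 1.
Proof.
rewrite massE leqNgt ell_gt0/= (eq_count (a2 := predT)) => [|y]; last exact: prefix0s.
by rewrite count_predT divff// gt_eqF.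
Qed.

Lemma mass_ge0_le1 k w : 0 <= mass k w <= 1.
Proof.
have [n] := ubnP (size w); elim: n k w => // n IH k w wn.
rewrite massE; case: leqP => kw.
  have /andP[m0 m1] := IH k.+1 (drop (ell k) w) (leq_trans (size_drop_lt kw) wn).
  case: (_ \in _); rewrite ?mul0r ?mul1r ?lexx ?ler01//.
  rewrite mulr_ge0 ?invr_ge0//= mulr_ile1 ?invr_ge0// invf_le1//.
  by rewrite ler1n -(ltr0n R).
by rewrite divr_ge0//= ler_pdivrMr// mul1r ler_nat count_size.
Qed.

Lemma mass_short k w : (size w <= ell k)%N ->
  mass k w = (count (prefix w) (G k))%:R / (size (G k))%:R.
Proof.
move=> wk; rewrite massE; case: leqP => // kw.
have e : size w = ell k by apply/eqP; rewrite eqn_leq wk.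
rewrite -{1 2}e take_size drop_size mass_nil mulr1; congr (_%:R / _).
rewrite -count_uniq_mem//; apply: eq_in_count => y yG /=.
by rewrite prefixE e -(G_size yG) take_size.
Qed.

Lemma count_prefix_rcons (s : seq (seq letters)) w :
  (forall y, y \in s -> (size w < size y)%N) ->
  count (prefix w) s = (\sum_a count (prefix (rcons w a)) s)%N.
Proof.
elim: s => [|y s IH] H /=; first by rewrite big1.
rewrite IH => [|z zs]; last by apply: H; rewrite inE zs orbT.
rewrite big_split/=; congr addn.
have wy := H y (mem_head _ _).
rewrite (eq_bigr (fun a => (prefix w y && (nth ord0 y (size w) == a) : nat))); last first.
  by move=> a _; rewrite !prefixE size_rcons (take_nth ord0)// eqseq_rcons.
case: (prefix w y) => /=; last by rewrite big1.
rewrite (bigD1 (nth ord0 y (size w)))//= eqxx big1 ?addn0// => a /negbTE.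
by rewrite eq_sym => ->.
Qed.

Lemma mass_rcons k w : mass k w = \sum_a mass k (rcons w a).
Proof.
have [n] := ubnP (size w); elim: n k w => // n IH k w wn.
have [kw|kw] := leqP (ell k) (size w).
  rewrite massE kw (IH k.+1) ?(leq_trans (size_drop_lt kw) wn)// mulr_sumr.
  apply: eq_bigr => a _; rewrite [RHS]massE size_rcons (leqW kw).
  rewrite drop_rcons//; have -> // : take (ell k) (rcons w a) = take (ell k) w.
  by rewrite -cats1 takel_cat.
rewrite mass_short ?(ltnW kw)// count_prefix_rcons => [|y /G_size ->//].
rewrite natr_sum mulr_suml; apply: eq_bigr => a _.
by rewrite mass_short// size_rcons.
Qed.

(** The three estimates share one error [b], so that they can be peeled block by block together.
    Words of mass 0 are exempt. *)
Definition controlled k w (b : R) : Prop := mass k w != 0 -> forall u, cylinder w u ->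
  [/\ `|birkhoff_sum f (size w) u - (size w)%:R * alpha| <= b,
      `|birkhoff_sum g (size w) u - (size w)%:R * beta| <= b &
      mass k w <= expR (b - (size w)%:R * h)].

Lemma controlled_le k w b b' : b <= b' -> controlled k w b -> controlled k w b'.
Proof.
move=> bb' H m0 u wu; have [h1 h2 h3] := H m0 u wu.
split; [exact: le_trans bb'|exact: le_trans bb'|apply: le_trans h3 _].
by rewrite ler_expR lerD2r.
Qed.

(** The crude linear bound, applied to the incomplete last block only. *)
Lemma controlled_trivial : exists2 Q : R, 0 < Q & forall k w, controlled k w (Q * (size w)%:R).
Proof.
have [Mf Mf0 HMf] := holder_bounded hf; have [Mg Mg0 HMg] := holder_bounded hg.
have Q0 : 0 < Mf + Mg + `|alpha| + `|beta| + `|h|.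
  have := normr_ge0 alpha; have := normr_ge0 beta; have := normr_ge0 h; lra.
exists (Mf + Mg + `|alpha| + `|beta| + `|h|) => // k w _ u _.
have s0 : 0 <= (size w)%:R :> R by [].
have bd q (M al : R) : (forall u, `|q u| <= M) ->
    `|birkhoff_sum q (size w) u - (size w)%:R * al| <= (M + `|al|) * (size w)%:R.
  move=> qM; apply: le_trans (ler_normB _ _) _; rewrite mulrDl lerD ?birkhoff_bound//.
  by rewrite normrM ger0_norm// mulrC.
split.
- apply: le_trans (bd f Mf alpha HMf) _; rewrite ler_wpM2r//.
  have := normr_ge0 beta; have := normr_ge0 h; lra.
- apply: le_trans (bd g Mg beta HMg) _; rewrite ler_wpM2r//.
  have := normr_ge0 alpha; have := normr_ge0 h; lra.
case/andP: (mass_ge0_le1 k w) => _ m1; apply: le_trans m1 _.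
rewrite -expR0 ler_expR [_ * h]mulrC -mulrBl mulr_ge0//.
have := normr_ge0 alpha; have := normr_ge0 beta; have := ler_norm h; lra.
Qed.

Lemma controlled_peel k w b : (ell k <= size w)%N -> controlled k.+1 (drop (ell k) w) b ->
  controlled k w ((ell k)%:R * eb k + b).
Proof.
move=> kw H; rewrite /controlled massE kw.
case: (boolP (_ \in _)) => [wG|_]; last by rewrite !mul0r eqxx.
rewrite mul1r mulf_eq0 negb_or => /andP[_ m0] u wu.
have cu : cylinder (drop (ell k) w) (iter (ell k) (@shift N) u).
  move=> j; rewrite size_drop => jk; rewrite iter_shiftE nth_drop wu//; lia.
have cu' : cylinder (take (ell k) w) u.
  move=> j; rewrite size_takel// => jk; rewrite nth_take// wu//; lia.
have [h1 h2 h3] := H m0 _ cu; have [g1 g2] := G_birkhoff wG cu'.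
have e : size w = (ell k + size (drop (ell k) w))%N by rewrite size_drop subnKC.
have bd q (al b1 b2 : R) : `|birkhoff_sum q (ell k) u - (ell k)%:R * al| <= b1 ->
    `|birkhoff_sum q (size (drop (ell k) w)) (iter (ell k) (@shift N) u) -
      (size (drop (ell k) w))%:R * al| <= b2 ->
    `|birkhoff_sum q (size w) u - (size w)%:R * al| <= b1 + b2.
  move=> H1 H2; rewrite e birkhoffD natrD mulrDl opprD addrACA.
  by apply: le_trans (ler_normD _ _) _; exact: lerD.
split; [exact: bd|exact: bd|].
rewrite e natrD.
have -> : (ell k)%:R * eb k + b - ((ell k)%:R + (size (drop (ell k) w))%:R) * h =
  - ((ell k)%:R * (h - eb k)) + (b - (size (drop (ell k) w))%:R * h) by ring.
rewrite expRD; apply: ler_pM => //.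
  by case/andP: (mass_ge0_le1 k.+1 (drop (ell k) w)).
by rewrite expRN lef_pV2 ?posrE ?expR_gt0.
Qed.

(** From block [k0] on the tolerances are at most [e / 2]. The incomplete block costs at most
    [e / 2 * k]; the index [k] grows by one per block of length at least 1, which the other [e / 2]
    per letter pays for. Finitely many earlier blocks only change the constant, by induction
    backwards from [k0]. *)
Lemma mass_controlled (e : R) : 0 < e -> forall k, exists c, forall w,
  controlled k w (e * (size w)%:R + c).
Proof.
move=> e0; have [Q Q0 triv] := controlled_trivial.
have e2 : 0 < e / 2 by rewrite divr_gt0.
pose dl := Num.min (e / 2) (e / 2 / Q).
have dl0 : 0 < dl by rewrite lt_min e2 divr_gt0.
have [k0 Hk0] := eb_small dl0.
have large k w : (k0 <= k)%N -> controlled k w (e * (size w)%:R + e / 2 * k%:R).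
  have [n] := ubnP (size w); elim: n k w => // n IH k w wn k0k.
  have [h1 h2] := Hk0 k k0k; have k_ge0 : 0 <= k%:R :> R by [].
  have [kw|kw] := leqP (ell k) (size w); last first.
    apply: controlled_le (triv k w).
    apply: (@le_trans _ _ (Q * (ell k)%:R)); first by rewrite ler_wpM2l ?(ltW Q0)// ler_nat ltnW.
    apply: (@le_trans _ _ (Q * (dl * k%:R))); first by rewrite ler_wpM2l// ltW.
    rewrite ler_wpDl ?mulr_ge0 ?(ltW e0)// mulrA ler_wpM2r//.
    by rewrite mulrC -ler_pdivlMr// /dl ge_min lexx orbT.
  have {}IH := IH k.+1 (drop (ell k) w) (leq_trans (size_drop_lt kw) wn) (leqW k0k).
  apply: controlled_le (controlled_peel kw IH).
  rewrite size_drop natrB// -[k.+1%:R]natr1.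
  have l1 : 1 <= (ell k)%:R :> R by rewrite ler1n ell_gt0.
  have eb2 : eb k <= e / 2 by rewrite (le_trans h1)// /dl ge_min lexx.
  have := ler_wpM2l (le_trans ler01 l1) eb2; have := ler_wpM2l (ltW e2) l1.
  move: ((ell k)%:R) ((size w)%:R) (k%:R) => x y z; rewrite !mulrDr !mulrN; lra.
have small j : (j <= k0)%N -> exists c, forall w, controlled (k0 - j) w (e * (size w)%:R + c).
  elim: j => [_|j IH jk]; first by exists (e / 2 * k0%:R) => w; rewrite subn0; exact: large.
  have [c Hc] := IH (ltnW jk); set k := (k0 - j.+1)%N.
  have ek : k.+1 = (k0 - j)%N by rewrite /k; lia.
  have l0 : 0 <= (ell k)%:R * eb k by rewrite mulr_ge0.
  exists (`|c| + (ell k)%:R * eb k + Q * (ell k)%:R) => w.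
  have [kw|kw] := leqP (ell k) (size w); last first.
    apply: controlled_le (triv k w).
    have : Q * (size w)%:R <= Q * (ell k)%:R by rewrite ler_wpM2l ?(ltW Q0)// ler_nat ltnW.
    have : 0 <= e * (size w)%:R by rewrite mulr_ge0 ?(ltW e0).
    have := normr_ge0 c.
    move: (Q * _) (Q * _) (e * _) (_ * eb k) l0 => x1 x2 x3 x4; lra.
  have := Hc (drop (ell k) w); rewrite -ek => /(controlled_peel kw); apply: controlled_le.
  have : e * (size (drop (ell k) w))%:R <= e * (size w)%:R.
    by rewrite ler_wpM2l ?(ltW e0)// ler_nat size_drop leq_subr.
  have : 0 <= Q * (ell k)%:R by rewrite mulr_ge0 ?(ltW Q0).
  have := ler_norm c.
  move: (Q * _) (e * _) (e * _) (_ * eb k) l0 => x1 x2 x3 x4; lra.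
move=> k; have [k0k|kk0] := leqP k0 k.
  by exists (e / 2 * k%:R) => w; exact: large.
have [c Hc] := small (k0 - k)%N (leq_subr _ _).
by exists c => w; move: (Hc w); rewrite subKn// ltnW.
Qed.

Lemma moran_measure : exists nu : probability T R, forall e, 0 < e -> exists c, forall w u,
  nu (cylinder w) != 0%E -> cylinder w u ->
  [/\ `|birkhoff_sum f (size w) u - (size w)%:R * alpha| <= e * (size w)%:R + c,
      `|birkhoff_sum g (size w) u - (size w)%:R * beta| <= e * (size w)%:R + c &
      (nu (cylinder w) <= (expR (e * (size w)%:R + c - (size w)%:R * h))%:E)%E].
Proof.
have [nu Hnu] := exists_code_measure gamma01 (mass_nil 0)
  (fun w => proj1 (andP (mass_ge0_le1 0 w))) (mass_rcons 0).
exists nu => e e0; have [c Hc] := mass_controlled e0 0.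
exists c => w u; rewrite Hnu => m0 wu; by rewrite lee_fin; exact: Hc.
Qed.

End MoranMass.

Section TypicalMeasure.
Variables (R : realType) (N : nat) (gamma : R).
Hypothesis gamma01 : 0 < gamma < 1.
Local Notation T := (borel_code N gamma).
Local Notation letters := 'I_N.+1.

(* Independent blocks of typical words of [mu] with tolerances [1 / (j + 1)]
   tending to [0]; the [k]-th block has the largest type [j <= k] whose block
   length is at most [k / (j + 1)], so that single blocks are negligible. *)
Lemma typical_measure (f g : code_space N -> R) (mu : probability T R) h :
  holder_code f -> holder_code g -> shift_invariant mu -> entropy mu = h%:E ->
  exists nu : probability T R, forall e, 0 < e -> exists c, forall w u,
  nu (cylinder w) != 0%E -> cylinder w u ->
  [/\ `|birkhoff_sum f (size w) u - (size w)%:R * \int[mu]_u f u| <= e * (size w)%:R + c,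
      `|birkhoff_sum g (size w) u - (size w)%:R * \int[mu]_u g u| <= e * (size w)%:R + c &
      (nu (cylinder w) <= (expR (e * (size w)%:R + c - (size w)%:R * h))%:E)%E].
Proof.
move=> hf hg inv eh.
have [h' [eh' h0 hent _]] := entropy_spec gamma01 inv.
move: eh' h0 hent; rewrite eh => -[<-] h0 hent {h'}.
pose al := \int[mu]_u f u; pose be := \int[mu]_u g u.
have H j : exists p : nat * seq (seq letters), [/\ (0 < p.1)%N,
    forall w, w \in p.2 -> size w = p.1, uniq p.2,
    forall w u, w \in p.2 -> cylinder w u ->
      `|birkhoff_sum f p.1 u - p.1%:R * al| <= p.1%:R * j.+1%:R^-1 /\
      `|birkhoff_sum g p.1 u - p.1%:R * be| <= p.1%:R * j.+1%:R^-1 &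
    expR (p.1%:R * (h - j.+1%:R^-1)) <= (size p.2)%:R].
  have j0 : 0 < j.+1%:R^-1 :> R by rewrite invr_gt0.
  have [L0 HL] := typical_words gamma01 inv hf hg h0 hent j0.
  have [W [W1 W2]] := HL L0.+1 (leqnSn _).
  exists (L0.+1, [seq val w | w <- enum W]); split => //=.
  - by move=> w /mapP[w' _ ->]; rewrite size_tuple.
  - by rewrite map_inj_uniq ?enum_uniq//; exact: val_inj.
  - by move=> w u /mapP[w' wW ->]; apply: W1; move: wW; rewrite mem_enum.
  by rewrite size_map -cardE.
have [F HF] := choice H.
have F0 j : (0 < (F j).1)%N by have [] := HF j.
pose P k i := (i.+1 * (F i).1 <= k)%N.
pose jk k := \max_(i < k.+1 | P k i) i.
have jk_P k : jk k = 0%N \/ P k (jk k).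
  rewrite /jk; elim/big_ind: _ => [|x y|i Pi]; [by left| |by right].
  by rewrite /maxn; case: ltnP.
have jk_ge k i : P k i -> (i <= jk k)%N.
  move=> Pi; have ik : (i < k.+1)%N.
    by apply: leq_trans (leqW Pi); rewrite leq_pmulr.
  exact: (@leq_bigmax_cond _ (fun i : 'I_k.+1 => P k i) (fun i => i : nat) (Ordinal ik)).
have HFk k := HF (jk k).
apply: (@moran_measure _ _ _ gamma01 f g al be h hf hg (fun k => (F (jk k)).1)
  (fun k => (F (jk k)).2) (fun k => (jk k).+1%:R^-1)).
- by move=> k; have [] := HFk k.
- by move=> k; have [] := HFk k.
- by move=> k; have [] := HFk k.
- by move=> k; have [] := HFk k.
- by move=> k; have [] := HFk k.
- by move=> k; rewrite invr_ge0.
move=> e e0; pose i := (Num.trunc e^-1).+1.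
exists (i.+1 * (F i).1)%N => k ik; have ij := jk_ge k i ik.
have je : (jk k).+1%:R^-1 <= e.
  rewrite -[e]invrK lef_pV2 ?posrE ?invr_gt0//.
  by rewrite (le_trans (ltW (truncnS_gt _)))// ler_nat leqW.
(* [i >= 1] rules out the default value 0 of an empty maximum. *)
split => //; have [j0|Pj] := jk_P k; first by move: ij; rewrite j0.
have : (jk k).+1%:R * (F (jk k)).1%:R <= k%:R :> R by rewrite -natrM ler_nat.
rewrite mulrC -ler_pdivlMr// => /le_trans; apply.
by rewrite mulrC ler_wpM2r.
Qed.

End TypicalMeasure.

(** * The lower bound for the dimension *)

Section MassDistribution.
Variables (R : realType) (N d : nat) (gamma : R).
Hypothesis gamma01 : 0 < gamma < 1.
Local Notation T := (borel_code N gamma).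
Local Notation letters := 'I_N.+1.
Variables (g : code_space N -> R) (l0 : R) (pi : code_space N -> 'rV[R]_d).
Hypotheses (hg : holder_code g) (l0_gt0 : 0 < l0) (g_le : forall u, g u <= - l0).
Hypothesis mult : bounded_multiplicity pi g.
Variables (nu : probability T R).
Implicit Types (w : seq letters) (u : code_space N).

(** An enumeration of the null cylinders: being countably many, they have a null union, and almost
    every code has only prefixes of positive mass. *)
Let nullset k : set T :=
  if pickle_inv k is Some w then if nu (cylinder w) == 0%E then cylinder w else set0 else set0.

Let measurable_nullset k : measurable (nullset k).
Proof.
rewrite /nullset; case: (pickle_inv k) => [w|]; last exact: measurable0.
by case: ifP => _; [exact: measurable_cylinder|exact: measurable0].
Qed.

Let nullset0 k : nu (nullset k) = 0%E.
Proof.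
rewrite /nullset; case: (pickle_inv k) => [w|]; last exact: measure0.
by case: ifP => [/eqP//|_]; exact: measure0.
Qed.

Let nullsetP u : (exists n, nu (cylinder (mkseq u n)) = 0%E) -> (\bigcup_k nullset k) u.
Proof.
move=> [n nu0]; exists (pickle (mkseq u n)) => //.
by rewrite /nullset pickleK_inv nu0 eqxx; exact/cylinder_mkseq.
Qed.

Lemma support_nonempty : exists u, forall n, nu (cylinder (mkseq u n)) != 0%E.
Proof.
apply: contrapT => H.
have sub : [set: T] `<=` \bigcup_k nullset k.
  move=> u _; apply: nullsetP; apply: contrapT => Hu; apply: H; exists u => n.
  by apply/eqP => n0; apply: Hu; exists n.
have h := measure_sigma_subadditive nu measurable_nullset measurableT sub.
have nuT : nu [set: T] = 1%E := probability_setT nu.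
have := le_trans (_ : (1 <= nu [set: T])%E) h; rewrite nuT => /(_ (lexx _)).
rewrite eseries0 => [|k _ _]; last exact: nullset0.
by rewrite lee_fin ler10.
Qed.

Variables (s C1 : R).
Hypotheses (s0 : 0 <= s) (C10 : 0 < C1).
Hypothesis nu_le : forall w u, cylinder w u ->
  (nu (cylinder w) <= (C1 * expR (s * birkhoff_sum g (size w) u))%:E)%E.

Let nu_bigsetU (ws : seq (seq letters)) (c : R) :
  (forall w, w \in ws -> (nu (cylinder w) <= c%:E)%E) ->
  (nu (\big[setU/set0]_(w <- ws) cylinder w) <= ((size ws)%:R * c)%:E)%E.
Proof.
elim: ws => [|w ws IH] H; first by rewrite big_nil measure0 mul0r.
rewrite big_cons; apply: le_trans (measureU2 _ _ _) _.
- exact: measurable_cylinder.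
- by apply: bigsetU_measurable => w' _; exact: measurable_cylinder.
apply: (@le_trans _ _ (c%:E + ((size ws)%:R * c)%:E)%E).
  apply: leeD; first exact: H (mem_head _ _).
  by apply: IH => w' w'w; apply: H; rewrite inE w'w orbT.
by rewrite -EFinD lee_fin /= -natr1; lra.
Qed.

(* Words at which the contraction first drops to the scale [rho]. *)
Let stopped rho w := (expR (birkhoff_sum g (size w) (ext w)) <= rho) &&
  [forall n : 'I_(size w), rho < expR (birkhoff_sum g n (ext (take n w)))].

Let take_mkseq u m n : (m <= n)%N -> take m (mkseq u n) = mkseq u m.
Proof.
move=> mn; rewrite -(subnKC mn) mkseq_addn take_size_cat//.
by rewrite size_mkseq.
Qed.

Let stopped_prefix rho u M : expR (- (M%:R * l0)) <= rho ->
  exists2 n, (n <= M)%N & stopped rho (mkseq u n).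
Proof.
move=> Mrho.
pose P n := expR (birkhoff_sum g n (ext (mkseq u n))) <= rho.
have PM : P M by rewrite /P (le_trans _ Mrho)// ler_expR birkhoff_le_neg.
have exP : exists n, P n by exists M.
case: (ex_minnP exP) => n Pn nmin; exists n; first exact: nmin.
rewrite /stopped size_mkseq -[X in X && _]/(P n) Pn/=; apply/forallP => -[m /= mn].
rewrite take_mkseq ?(ltnW mn)// ltNge; apply/negP => Pm.
by have := nmin m Pm; rewrite leqNgt mn.
Qed.

Let stopped_anti rho w w' : stopped rho w -> stopped rho w' -> w != w' -> ~~ prefix w w'.
Proof.
move=> /andP[sw _] /andP[_ /forallP sw'] ww'; apply/negP => pw.
have sz := size_prefix pw; move: pw; rewrite prefixE => /eqP tw.
have [lt|ge] := ltnP (size w) (size w').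
  by have := sw' (Ordinal lt); rewrite /= tw ltNge sw.
by move: ww'; rewrite -tw take_oversize ?eqxx.
Qed.

(** The preimage of [U] need not be measurable; it is enclosed in the cylinders of the stopped words
    that meet it. These form an antichain at one scale, so [mult] bounds their number. *)
Lemma scale_cover : exists2 C2 : R, 0 < C2 & forall rho (U : set 'rV[R]_d), 0 < rho < 1 ->
  (forall x y, U x -> U y -> enorm (x - y) <= rho) ->
  exists V : set T, [/\ measurable V, pi @^-1` U `<=` V & (nu V <= (C2 * rho `^ s)%:E)%E].
Proof.
have [D D0 HD] := holder_distortion hg; have [M M0 HM] := holder_bounded hg.
(* One [D] for enlarging the scale to [expR D * rho], one for passing from the sample point [ext] to
   [u], and [M] for the last letter of a stopped word. *)
have [B HB] := mult (expR_gt0 (- (2 * D + M))).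
exists (B.+1%:R * C1) => [|rho U /andP[rho0 rho1] Urho]; first by rewrite mulr_gt0.
pose L := (Num.trunc (- ln rho / l0)).+1.
have HL : expR (- (L%:R * l0)) <= rho.
  rewrite -[leRHS]lnK ?posrE// ler_expR lerNl -ler_pdivrMr//.
  exact: ltW (truncnS_gt _).
pose all_words := flatten [seq [seq val x | x <- enum {: n.-tuple letters}] | n <- iota 0 L.+1].
have all_wordsP w : (size w <= L)%N -> w \in all_words.
  move=> wL; apply/flattenP; exists [seq val x | x <- enum {: (size w).-tuple letters}].
    by apply/mapP; exists (size w) => //; rewrite mem_iota.
  by apply/mapP; exists (in_tuple w); rewrite ?mem_enum.
pose hit w := stopped rho w && `[< exists u, cylinder w u /\ U (pi u) >].
pose ws := undup [seq w <- all_words | hit w].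
have wsP w : w \in ws -> hit w by rewrite mem_undup mem_filter => /andP[].
exists (\big[setU/set0]_(w <- ws) cylinder w); split.
- by apply: bigsetU_measurable => w _; exact: measurable_cylinder.
- move=> u Uu; have [n nL st] := stopped_prefix u HL.
  rewrite -bigcup_seq; exists (mkseq u n); last exact/cylinder_mkseq.
  rewrite /= mem_undup mem_filter all_wordsP ?size_mkseq// andbT /hit st/=.
  by apply/asboolP; exists u; split => //; exact/cylinder_mkseq.
apply: le_trans (nu_bigsetU (c := C1 * rho `^ s) _) _.
  move=> w /wsP/andP[/andP[sw _] _]; apply: le_trans (nu_le (@cylinder_ext _ w)) _.
  rewrite lee_fin ler_wpM2l ?(ltW C10)// mulrC expRM.
  by apply: ge0_ler_powR; rewrite ?nnegrE ?expR_ge0 ?(ltW rho0).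
rewrite lee_fin -mulrA ler_wpM2r ?mulr_ge0 ?powR_ge0 ?(ltW C10)// ler_nat leqW//.
apply: (HB (expR D * rho) U); rewrite ?mulr_gt0 ?expR_gt0 ?undup_uniq//.
- move=> w w' /wsP/andP[sw _] /wsP/andP[sw' _]; exact: stopped_anti sw sw'.
- move=> x y Ux Uy; apply: le_trans (Urho x y Ux Uy) _.
  by rewrite ler_peMl ?(ltW rho0)// -expR0 ler_expR ltW.
move=> w /wsP/andP[/andP[sw /forallP sw'] /asboolP[u [wu Uu]]]; exists u; split => //.
have dist n w' : agree n (ext w') u -> `|birkhoff_sum g n (ext w') - birkhoff_sum g n u| <= D.
  exact: HD.
apply/andP; split.
  (* The empty word has scale 1 and is not stopped, as [rho < 1]. *)
  have w0 : (0 < size w)%N.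
    rewrite lt0n; apply/eqP => w0; move: sw; rewrite w0 birkhoff0 expR0 leNgt rho1//.
  pose n := (size w).-1; have nw : n.+1 = size w by rewrite /n prednK.
  have ltn : (n < size w)%N by rewrite -nw.
  have := sw' (Ordinal ltn) => /= h.
  have ag : agree n (ext (take n w)) u.
    by move=> k kn; rewrite /ext nth_take// -wu// (ltn_trans kn).
  have := dist n _ ag; rewrite ler_norml => /andP[_ h1].
  rewrite mulrA -expRD -nw birkhoffSr.
  rewrite -[rho]lnK ?posrE// -expRD ler_expR.
  have h2 : ln rho < birkhoff_sum g n (ext (take n w)).
    by rewrite -ltr_expR lnK ?posrE.
  have := HM (iter n (@shift N) u); rewrite ler_norml => /andP[h3 _].
  move: h1 h2 h3; lra.
have ag : agree (size w) (ext w) u by exact: (@cylinder_agree _ w _ u (@cylinder_ext _ w) wu).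
have := dist (size w) w ag; rewrite ler_norml => /andP[h1 _].
apply: le_trans (_ : _ <= expR D * expR (birkhoff_sum g (size w) (ext w))) _.
  by rewrite -expRD ler_expR; move: h1; lra.
by rewrite ler_wpM2l ?expR_ge0.
Qed.

Lemma mass_distribution (A : set (code_space N)) :
  (forall u, (forall n, nu (cylinder (mkseq u n)) != 0%E) -> A u) ->
  hausdorff_measure s (pi @` A) <> 0%E.
Proof.
move=> HA; have [C2 C20 HC] := scale_cover.
have pos : (0 < ((2 * C2)^-1)%:E)%E by rewrite lte_fin invr_gt0 mulr_gt0.
(* Covers of mesh 1/2 keep the scales below 1. The errors [2^-1 / 2 ^ k.+1] sum to 1/2, so at least
   1/2 is left for [C2] times the [s]-sum. *)
suff low : (((2 * C2)^-1)%:E <= hausdorff_premeasure s (1 / 2) (pi @` A))%E.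
  move=> H0; have := lt_le_trans pos low; apply/negP; rewrite -leNgt -H0.
  by apply: ereal_sup_ubound; exists (1 / 2) => //=; rewrite divr_gt0.
apply: le_ereal_inf_tmp => _ [U [cov dU] <-].
have ex k : exists V : set T, [/\ measurable V, pi @^-1` U k `<=` V &
    (nu V <= C2%:E * diam_pow s (U k) + (2^-1 / (2 ^ k.+1)%:R)%:E)%E].
  have ek : 0 < 2^-1 / (2 ^ k.+1)%:R :> R by rewrite divr_gt0// ltr0n expn_gt0.
  set e := _ / _ in ek *.
  have [U0|Un0] := eqVneq (U k) set0.
    exists set0; split; first exact: measurable0.
      by rewrite U0.
    by rewrite measure0 U0 /diam_pow eqxx mule0 add0e lee_fin ltW.
  have [x Ux] : (U k) !=set0 by exact/set0P.
  have d0 : (0 <= diam (U k))%E.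
    by apply: ereal_sup_ubound; exists (x, x); rewrite /= ?subrr ?enorm0.
  have [dl ddl /andP[dl0 dl2]] : exists2 dl : R, diam (U k) = dl%:E & 0 <= dl <= 1 / 2.
    by move: d0 (dU k); case: (diam (U k)) => [dl| |]//; rewrite !lee_fin => d1 d2; exists dl; rewrite ?d1.
  (* A set of diameter 0 still needs a positive scale: one with [C2 * rho ^ s <= e] if [s > 0], and
     any scale if [s = 0], where the set weighs 1. *)
  have [rho [rho01 dlrho rhoe]] : exists rho : R, [/\ 0 < rho < 1, dl <= rho &
      C2 * rho `^ s <= C2 * dl `^ s + e].
    have half0 : (0 : R) < 1 / 2 by [].
    have half1 : (1 / 2 : R) < 1 by rewrite ltr_pdivrMr// mul1r ltr1n.
    have [dlz|dlz] := eqVneq dl 0; last first.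
      exists dl; split=> //; last by rewrite lerDl ltW.
      by rewrite lt_def dlz dl0/= (le_lt_trans dl2).
    have [sz|sz] := eqVneq s 0.
      by exists (1 / 2); split; rewrite ?half0 ?dlz ?divr_ge0// sz !powRr0 lerDl ltW.
    have eC : 0 < e / C2 by rewrite divr_gt0.
    exists (Num.min (1 / 2) ((e / C2) `^ s^-1)); split.
    - by rewrite lt_min powR_gt0// half0/= gt_min half1.
    - by rewrite dlz le_min powR_ge0 divr_ge0.
    apply: (@le_trans _ _ e); last by rewrite lerDr mulr_ge0 ?powR_ge0 ?(ltW C20).
    rewrite -ler_pdivlMl// [C2^-1 * e]mulrC.
    have ep : e / C2 = ((e / C2) `^ s^-1) `^ s by rewrite -powRrM mulVf// powRr1// ltW.
    rewrite [leRHS]ep.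
    apply: ge0_ler_powR; rewrite ?nnegrE ?powR_ge0//.
      by rewrite le_min powR_ge0 divr_ge0.
    by rewrite ge_min lexx orbT.
  have [|V [mV UV nuV]] := HC rho (U k) rho01.
    move=> y z Uy Uz; apply: le_trans dlrho; rewrite -lee_fin -ddl.
    by apply: ereal_sup_ubound; exists (y, z).
  exists V; split=> //; apply: le_trans nuV _.
  by rewrite /diam_pow (negbTE Un0) ddl poweR_EFin -EFinM -EFinD lee_fin.
have [V HV] := choice ex.
have sub : [set: T] `<=` \bigcup_k (nullset k `|` V k).
  move=> u _; have [[n n0]|nn] := pselect (exists n, nu (cylinder (mkseq u n)) = 0%E).
    by have [k _ ku] := nullsetP (ex_intro _ n n0); exists k => //; left.
  have Au : A u by apply: HA => n; apply/eqP => n0; apply: nn; exists n.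
  have [k _ Uk] := cov (pi u) (ex_intro2 _ _ u Au erefl).
  by exists k => //; right; have [_ h _] := HV k; exact: h.
have mV k : measurable (nullset k `|` V k : set T).
  by apply: measurableU => //; have [] := HV k.
have h := measure_sigma_subadditive nu mV measurableT sub.
have nuT : nu [set: T] = 1%E := probability_setT nu.
have h1 := le_trans (_ : (1 <= nu [set: T])%E) h; rewrite nuT in h1.
have {}h1 := h1 (lexx _).
have pow0 k : (0 <= diam_pow s (U k))%E.
  by rewrite /diam_pow; case: ifP => // _; exact: poweR_ge0.
have : (1 <= C2%:E * \sum_(0 <= k <oo) diam_pow s (U k) + (2^-1)%:E)%E.
  apply: le_trans h1 _; rewrite -nneseriesZl//.
  apply: le_trans (epsilon_trick _ _ _); last 2 first.
  - by move=> k; rewrite mule_ge0// lee_fin ltW.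
  - by rewrite invr_ge0.
  apply: lee_nneseries => // k _; apply: le_trans (measureU2 _ _ _) _ => //.
    by have [] := HV k.
  by rewrite [X in (X + _)%E]nullset0 add0e; have [] := HV k.
have S0 : (0 <= \sum_(0 <= k <oo) diam_pow s (U k))%E by apply: nneseries_ge0 => k _ _.
move: (\sum_(0 <= k <oo) _)%E S0 => [r| |]// _; last by rewrite leey.
rewrite -EFinM -EFinD !lee_fin => hr.
rewrite invfM ler_pdivrMr//; move: hr; rewrite [r * _]mulrC; lra.
Qed.

End MassDistribution.

(** * The dimension of the level sets *)

Section LevelSetDimension.
Variables (R : realType) (N d : nat) (gamma : R).
Hypothesis gamma01 : 0 < gamma < 1.
Local Notation T := (borel_code N gamma).
Variables (f g : code_space N -> R) (l0 : R) (pi : code_space N -> 'rV[R]_d) (C : set R) (Bpi : R).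
Hypotheses (hf : holder_code f) (hg : holder_code g) (cC : closed C).
Hypotheses (l0_gt0 : 0 < l0) (g_le : forall u, g u <= - l0).
Hypothesis Bpi0 : 0 < Bpi.
Hypothesis pi_dist : forall n u v, agree n u v ->
  enorm (pi u - pi v) <= Bpi * expR (birkhoff_sum g n u).
Hypothesis mult : bounded_multiplicity pi g.

Lemma typical_level_set (mu nu : probability T R) (u : code_space N) :
  C (\int[mu]_u f u) ->
  (forall e, 0 < e -> exists c, forall w u, nu (cylinder w) != 0%E -> cylinder w u ->
    `|birkhoff_sum f (size w) u - (size w)%:R * \int[mu]_u f u| <= e * (size w)%:R + c) ->
  (forall n, nu (cylinder (mkseq u n)) != 0%E) -> level_set f C u.
Proof.
move=> Cf Hnu nz; apply: (cvg_cluster_sub Cf); apply/cvgrPdist_le => e e0.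
have e2 : 0 < e / 2 by rewrite divr_gt0.
have [c Hc] := Hnu _ e2.
exists (Num.trunc (`|c| / (e / 2))).+1 => // n /= nc.
have np : 0 < n%:R :> R by rewrite ltr0n (leq_ltn_trans _ nc).
have := Hc (mkseq u n) u (nz n) (ltac:(exact/cylinder_mkseq)).
rewrite size_mkseq => h.
have cn : c <= e / 2 * n%:R.
  rewrite (le_trans (ler_norm _))// -ler_pdivrMl// mulrC ltW//.
  by rewrite (lt_le_trans (truncnS_gt _))// ler_nat.
rewrite distrC /birkhoff_avg.
have -> : n%:R^-1 * birkhoff_sum f n u - \int[mu]_u f u =
    n%:R^-1 * (birkhoff_sum f n u - n%:R * \int[mu]_u f u).
  by rewrite mulrBr mulKf// gt_eqF.
rewrite normrM gtr0_norm ?invr_gt0// ler_pdivrMl// (le_trans h)//.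
have -> : n%:R * e = e / 2 * n%:R + e / 2 * n%:R by field.
by rewrite lerD2l.
Qed.

Lemma level_set_nonempty (mu : probability T R) : admissible f C mu -> level_set f C !=set0.
Proof.
move=> [inv Cf]; have [h eh _] := entropyE gamma01 inv.
have [nu Hnu] := typical_measure gamma01 hf hg inv eh.
have [u Hu] := support_nonempty gamma01 nu; exists u.
apply: (typical_level_set Cf _ Hu) => e e0; have [c Hc] := Hnu e e0.
by exists c => w v w0 wv; have [] := Hc w v w0 wv.
Qed.

Lemma level_set_dim_ge (mu : probability T R) h s : admissible f C mu -> entropy mu = h%:E ->
  0 <= s -> 0 < h + s * \int[mu]_u g u -> hausdorff_measure s (pi @` level_set f C) <> 0%E.
Proof.
move=> [inv Cf] eh s0 sh; have [nu Hnu] := typical_measure gamma01 hf hg inv eh.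
set be := \int[mu]_u g u in sh Hnu.
have s1 : 0 < 1 + s by rewrite ltr_wpDr.
(* The mass exponent loses [e] per letter and [s] times the Birkhoff sum loses [s * e]; together
   they use up exactly [h + s * be]. *)
pose e := (h + s * be) / (1 + s).
have e0 : 0 < e by rewrite divr_gt0.
have es : e * (1 + s) = h + s * be by rewrite divfK// gt_eqF.
have [c Hc] := Hnu e e0.
apply: (mass_distribution gamma01 hg l0_gt0 g_le mult s0 (expR_gt0 (c + s * c)) (nu := nu)).
  move=> w u wu; have [->|w0] := eqVneq (nu (cylinder w)) 0%E.
    by rewrite lee_fin mulr_ge0 ?expR_ge0.
  have [_ hgw hnu] := Hc w u w0 wu; apply: le_trans hnu _.
  rewrite lee_fin -expRD ler_expR.
  have {}hgw : (size w)%:R * be - (e * (size w)%:R + c) <= birkhoff_sum g (size w) u.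
    by move: hgw; rewrite ler_norml => /andP[+ _]; lra.
  have := ler_wpM2l s0 hgw.
  have : e * (1 + s) * (size w)%:R = (h + s * be) * (size w)%:R by rewrite es.
  clearbody e be => h1 h2; lra.
move=> u; apply: (typical_level_set Cf) => e' e'0; have [c' Hc'] := Hnu e' e'0.
by exists c' => w v w0 wv; have [] := Hc' w v w0 wv.
Qed.

(** At the root [t] some measure reaches 0 and none exceeds it. As [\int g < 0], that measure is
    strictly positive for [s < t], and all measures are strictly negative for [s > t]. *)
Lemma level_set_dim : frakf C f g = hausdorff_dim (pi @` level_set f C).
Proof.
have [adm|nadm] := pselect (exists mu : probability T R, admissible f C mu); last first.
  rewrite /hausdorff_dim ifT; last first.
    apply/eqP; rewrite -subset0 => x [u Au _]; apply: nadm.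
    exact: (@level_set_admissible _ _ _ gamma01 f g C hf hg cC u Au).
  rewrite /frakf xgetPN// => x [t rt _]; apply: nadm.
  have [mu [h [adm _] _]] := root_measure gamma01 hf hg cC rt.
  by exists mu.
have [t rt] := zeta_root_exists gamma01 hf hg l0_gt0 g_le cC adm.
rewrite (frakf_root gamma01 hf hg l0_gt0 g_le cC rt).
have neg (mu : probability T R) : \int[mu]_u g u < 0.
  by rewrite (le_lt_trans (Rintegral_le_neg gamma01 hg g_le mu))// oppr_lt0.
have [mu [h [adm_mu eh] le_mu]] := root_measure gamma01 hf hg cC rt.
(* The infimum defining the dimension ranges over [s >= 0] only. *)
have t0 : 0 <= t.
  have [h' eh' /andP[h0 _]] := entropyE gamma01 (proj1 adm_mu).
  move: eh'; rewrite eh => -[hh']; rewrite -hh' in h0.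
  have := root_measure_le gamma01 hf hg rt adm_mu eh => le.
  by rewrite -(ler_nM2r (neg mu)) mul0r; lra.
rewrite /hausdorff_dim ifF; last first.
  by have [u Au] := level_set_nonempty adm_mu; apply/negbTE/set0P; exists (pi u), u.
apply/eqP; rewrite eq_le; apply/andP; split.
  apply: le_ereal_inf_tmp => _ [s [s0 Hs] <-]; rewrite lee_fin leNgt; apply/negP => st.
  apply: (level_set_dim_ge adm_mu eh s0 _ Hs).
  by apply: le_lt_trans le_mu _; rewrite ltrD2l ltr_nM2r.
apply/lee_addgt0Pr => e e0; rewrite -EFinD; apply: ereal_inf_lbound.
have te : 0 <= t + e by rewrite addr_ge0// ltW.
exists (t + e) => //; split => //.
apply: (level_set_null gamma01 hf hg cC l0_gt0 g_le Bpi0 pi_dist te) => nu k adm_nu ek.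
have := root_measure_le gamma01 hf hg rt adm_nu ek => le; apply: lt_le_trans le.
by rewrite ltrD2l ltr_nM2r// ltrDl.
Qed.

End LevelSetDimension.

Theorem theorem6p6 (R : realType) (d N : nat) (gamma : R)
  (V X K : set 'rV[R]_d) (S : 'I_N.+1 -> 'rV[R]_d -> 'rV[R]_d)
  (f : code_space N -> R) (C : set R) :
  (0 < d)%N ->
  0 < gamma < 1 ->
  conformal_ifs V X S ->
  self_conformal_set X S K ->
  code_lipschitz gamma f ->
  closed C ->
  let Lambda := scaling_map S K in
  [/\ (exists mu : probability (borel_code N gamma) R,
         shift_invariant mu /\ C (\int[mu]_u f u)) ->
      exists! t : R, zeta_root C f Lambda t,
      frakf C f Lambda =
        ereal_sup [set
          ereal_sup [set (- (entropy mu / (\int[mu]_u Lambda u)%:E))%E |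
            mu in [set mu : probability (borel_code N gamma) R |
                     shift_invariant mu /\ \int[mu]_u f u = alpha]] |
          alpha in C],
      open_set_condition X S ->
      frakf C f Lambda =
        hausdorff_dim (coding_map S K @`
          [set u | cluster (birkhoff_avg f n u @[n --> \oo]) `<=` C]) &
      open_set_condition X S ->
      forall alpha : R,
      frakf [set alpha] f Lambda =
        hausdorff_dim (coding_map S K @`
          [set u | birkhoff_avg f n u @[n --> \oo] --> alpha])].
Proof.
move=> d0 gamma01 ifs hK flip cC Lambda.
have hf := lipschitz_holder gamma01 flip.
have [hL [l0 l00 Lle] [B B0 pid] osc] := conformal_coding d0 ifs hK.
have dim (D : set R) : closed D -> open_set_condition X S ->
    frakf D f Lambda = hausdorff_dim (coding_map S K @` level_set f D).
  by move=> cD /osc mult; exact: (level_set_dim gamma01 hf hL cD l00 Lle B0 pid mult).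
split.
- move=> adm; have [t rt] := zeta_root_exists gamma01 hf hL l00 Lle cC adm.
  exists t; split => // t' rt'.
  exact: (zeta_root_unique gamma01 hf hL l00 Lle cC rt rt').
- exact: (frakf_variational gamma01 hf hL l00 Lle cC).
- exact: dim.
move=> OSC alpha; rewrite dim//.
congr (hausdorff_dim (_ @` _)); have [M _ HM] := birkhoff_avg_bound hf.
(* A bounded sequence has its accumulation points in [[set alpha]] exactly when it converges to
   [alpha]. *)
apply/seteqP; split => u /=.
  exact: (cluster_set1_cvg (fun n => HM n u)).
exact: cvg_cluster_sub.
Qed.
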